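(* There exist unital non-self-adjoint dual operator algebras $A$ and $B$ such that $A\subset_\Delta B$ and $B\subset_\Delta A$, but $A\sim_\Delta B$ does not hold.
   Context: A dual operator algebra is an operator algebra which is also a dual operator space (i.e. completely isometrically isomorphic to the operator space dual of some operator space). $[S]^{-w^*}$ is the $w^*$-closure of the linear span of $S$. A TRO is a subspace $M\subseteq B(H,K)$ with $m_1m_2^*m_3\in M$ for all $m_i\in M$. $w^*$-closed algebras $A\subseteq B(H)$, $B\subseteq B(K)$ are weakly TRO-equivalent, $A\sim_{TRO}B$, if there is a TRO $M\subseteq B(H,K)$ with $A=[M^*BM]^{-w^*}$ and $B=[MAM^*]^{-w^*}$. For unital $w^*$-closed algebras $A\subseteq B(H)$, $B\subseteq B(K)$ (unital: containing the identity operator), $B\subset_{TRO}A$ means that there is a projection $p\in A$ with $B\sim_{TRO}pAp$, where $pAp$ is identified with $pA|_{p(H)}\subseteq B(p(H))$. For unital dual operator algebras $A,B$: $A\sim_\Delta B$ means that there exist $w^*$-continuous completely isometric homomorphisms $\alpha:A\to\alpha(A)$, $\beta:B\to\beta(B)$ onto such concretely acting algebras with $\alpha(A)\sim_{TRO}\beta(B)$; and $B\subset_\Delta A$ means that there exist such $\alpha,\beta$ with $\beta(B)\subset_{TRO}\alpha(A)$. *)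

(* Defs.v *)
(* Hilbert spaces are complex, over [R[i]] for an arbitrary [R : realType];   *)
(* inner products are linear in the first variable.                           *)
From HB Require Import structures.
From mathcomp Require Import all_boot all_order all_algebra.
From mathcomp Require Import complex.
From mathcomp Require Import all_classical all_reals all_analysis.
From mathcomp Require Import lra.

Set Implicit Arguments.
Unset Strict Implicit.
Unset Printing Implicit Defensive.

Import Order.TTheory GRing.Theory Num.Theory.
Import numFieldNormedType.Exports.
Local Open Scope classical_set_scope.
Local Open Scope ring_scope.

(* The type [R[i]], presented so that its usual topology is inferred. *)
Notation Cplx R := (Num.NumField.sort (R[i] : numFieldType)).

Section DotNorm.
Variables (R : realType) (V : lmodType R[i]) (d : {dot V for Num.conj}).

Definition dotnorm (x : V) : R := Num.sqrt (complex.Re (d x x)).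

Lemma dotnorm_ge0 x : 0 <= dotnorm x. Proof. exact: sqrtr_ge0. Qed.

Lemma dotnorm_sqr x : dotnorm x ^+ 2 = complex.Re (d x x).
Proof.
rewrite sqr_sqrtr //; have : 0 <= d x x by exact: dnorm_ge0.
by rewrite lecE => /andP[].
Qed.

Lemma dotnorm0 : dotnorm 0 = 0.
Proof. by rewrite /dotnorm linear0r sqrtr0. Qed.

Lemma dotnorm_eq0 x : dotnorm x = 0 -> x = 0.
Proof.
move=> x0; apply/eqP; rewrite -(dnorm_eq0 d x).
have : 0 <= d x x by exact: dnorm_ge0.
have : complex.Re (d x x) = 0 by rewrite -dotnorm_sqr x0 expr0n.
by case: (d x x) => u v /= ->; rewrite lecE eq_complex /= eqxx andbC => /andP[].
Qed.

Lemma dotnormZ_sqr a x :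
  dotnorm (a *: x) ^+ 2 = complex.Re (`|a| ^+ 2) * dotnorm x ^+ 2.
Proof.
rewrite !dotnorm_sqr dnormZ.
have : 0 <= `|a| ^+ 2 by exact: exprn_ge0.
case: (`|a| ^+ 2) (d x x) => s t [u v]; rewrite lecE /= => /andP[/eqP -> _].
by rewrite mul0r subr0.
Qed.

Lemma dotnormD_sqr x y :
  dotnorm (x + y) ^+ 2 <= 2 * (dotnorm x ^+ 2 + dotnorm y ^+ 2).
Proof.
have := sqr_ge0 (dotnorm (x - y)).
rewrite !dotnorm_sqr dnormB dnormD.
case: (d x x) (d y y) (d x y + _) => [a ?] [b ?] [c ?] /=.
lra.
Qed.

Lemma dotnormN x : dotnorm (- x) = dotnorm x.
Proof. by rewrite /dotnorm linearN/= linearNl opprK. Qed.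

Definition dot_complete : Prop :=
  forall u : nat -> V,
    (forall e, 0 < e -> exists N, forall m n, (N <= m)%N -> (N <= n)%N ->
       dotnorm (u m - u n) < e) ->
    exists l, forall e, 0 < e -> exists N, forall n, (N <= n)%N ->
       dotnorm (u n - l) < e.

End DotNorm.

Record hilbert (R : realType) := Hilbert {
  hcar :> lmodType R[i];
  hdot : {dot hcar for Num.conj};
  hilbert_complete : dot_complete hdot }.

Notation hnorm := (dotnorm (hdot _)).

Section BoundedOperators.
Variable R : realType.
Implicit Types H K L : hilbert R.

Definition is_bounded_op H K (f : H -> K) : Prop :=
  linear f /\ exists M : R, forall x, hnorm (f x) <= M * hnorm x.

Definition bounded_op_pred H K : {pred H -> K} :=
  fun f => `[< is_bounded_op f >].
Arguments bounded_op_pred : clear implicits.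

Lemma bounded_op_submod_closed H K : submod_closed (bounded_op_pred H K).
Proof.
have bnd (f : H -> K) : (exists M : R, forall x, hnorm (f x) ^+ 2 <= M * hnorm x ^+ 2) ->
    exists M : R, forall x, hnorm (f x) <= M * hnorm x.
  move=> [M fM]; exists (1 + `|M|) => x.
  have M0 : 0 <= (1 + `|M|) * hnorm x.
    by rewrite mulr_ge0 ?dotnorm_ge0 // addr_ge0.
  rewrite -(@ler_pXn2r _ 2) ?nnegrE ?dotnorm_ge0 // exprMn.
  apply: le_trans (fM x) _; apply: ler_wpM2r; first exact: sqr_ge0.
  have := ler_norm M; have := normr_ge0 M; nra.
have sq (f : H -> K) (M : R) : (forall x, hnorm (f x) <= M * hnorm x) ->
    forall x, hnorm (f x) ^+ 2 <= M ^+ 2 * hnorm x ^+ 2.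
  move=> fM x; rewrite -exprMn ler_pXn2r ?nnegrE ?dotnorm_ge0 //.
  exact: le_trans (dotnorm_ge0 _ _) (fM x).
split.
  apply/asboolP; split; first by move=> a u v /=; rewrite scaler0 addr0.
  by exists 0 => x; rewrite dotnorm0 mul0r.
move=> a f g /asboolP[flin [M fM]] /asboolP[glin [N gN]].
have E w : (a *: f + g) w = a *: f w + g w by [].
apply/asboolP; split.
  move=> b u v; rewrite !E flin glin !scalerDr !scalerA [a * b]mulrC.
  by rewrite addrACA.
apply: bnd; exists (2 * (complex.Re (`|a| ^+ 2) * M ^+ 2 + N ^+ 2)) => x.
apply: le_trans (dotnormD_sqr _ _ _) _.
rewrite -mulrA ler_pM2l // mulrDl lerD ?sq // dotnormZ_sqr -mulrA.
apply: ler_wpM2l; last exact: sq.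
have : 0 <= `|a| ^+ 2 by exact: exprn_ge0.
by rewrite lecE => /andP[].
Qed.

HB.instance Definition _ H K :=
  GRing.isSubmodClosed.Build R[i] (H -> K) (bounded_op_pred H K)
    (bounded_op_submod_closed H K).

(* [bop H K] is the vector space B(H, K). *)
Record bop H K := Bop {
  bop_fun :> H -> K;
  bop_funP : bop_fun \in bounded_op_pred H K }.

HB.instance Definition _ H K := [isSub for @bop_fun H K].
HB.instance Definition _ H K := [Choice of bop H K by <:].
HB.instance Definition _ H K :=
  [SubChoice_isSubLmodule of bop H K by <:].

Lemma bop_linear H K (T : bop H K) : linear T.
Proof. by have /asboolP[] := bop_funP T. Qed.

Lemma bop_bounded H K (T : bop H K) :
  exists M : R, forall x, hnorm (T x) <= M * hnorm x.
Proof. by have /asboolP[] := bop_funP T. Qed.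

Lemma bid_subproof H : (idfun : H -> H) \in bounded_op_pred H H.
Proof. by apply/asboolP; split => //; exists 1 => x; rewrite mul1r. Qed.

Definition bid H : bop H H := Bop (bid_subproof H).

Lemma bcomp_subproof H K L (S : bop K L) (T : bop H K) :
  S \o T \in bounded_op_pred H L.
Proof.
apply/asboolP; split; first by move=> a u v /=; rewrite !bop_linear.
have [M SM] := bop_bounded S; have [N TN] := bop_bounded T.
exists (`|M| * N) => x /=; apply: le_trans (SM _) _.
apply: (@le_trans _ _ (`|M| * hnorm (T x))).
  by apply: ler_wpM2r; [exact: dotnorm_ge0|exact: ler_norm].
by rewrite -mulrA; apply: ler_wpM2l.
Qed.

Definition bcomp H K L (S : bop K L) (T : bop H K) : bop H L :=
  Bop (bcomp_subproof S T).

(* [is_adjoint T S] says S = T*; every T has exactly one adjoint, by Riesz. *)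
Definition is_adjoint H K (T : bop H K) (S : bop K H) : Prop :=
  forall x y, hdot K (T x) y = hdot H x (S y).

Definition adjoints H K (M : set (bop H K)) : set (bop K H) :=
  [set S | exists2 T, M T & is_adjoint T S].

Definition is_subspace (V : lmodType R[i]) (M : set V) : Prop :=
  M 0 /\ forall (a : R[i]) u v, M u -> M v -> M (a *: u + v).

Definition lin_span (V : lmodType R[i]) (M : set V) : set V :=
  [set v | exists (n : nat) (a : 'I_n -> R[i]) (s : 'I_n -> V),
     (forall k, M (s k)) /\ v = \sum_(k < n) a k *: s k].

Definition opnorm H K (T : bop H K) : R :=
  sup [set hnorm (T x) | x in [set x : H | hnorm x <= 1]].

(* The norm of a matrix of operators acting from H^n to K^n. *)
Definition opmxnorm H K n (T : 'M[bop H K]_n) : R :=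
  sup [set Num.sqrt (\sum_i hnorm (\sum_j T i j (x j)) ^+ 2)
      | x in [set x : 'I_n -> H | \sum_j hnorm (x j) ^+ 2 <= 1]].

Definition norm_closed H K (X : set (bop H K)) : Prop :=
  forall T, (forall e, 0 < e -> exists2 S, X S & opnorm (T - S) < e) -> X T.

(* The w*-topology of B(H, K) is the one induced by the normal functionals    *)
(* T |-> \sum_k <T x_k, y_k>, with (x_k) and (y_k) square-summable: these are *)
(* the trace-class functionals.                                               *)
Definition sqsum H : Type :=
  {x : nat -> H | cvgn (series (fun k => hnorm (x k) ^+ 2))}.

Definition normal_pairing H K (T : bop H K) (xy : sqsum H * sqsum K) : Cplx R :=
  limn (series (fun k => hdot K (T (sval xy.1 k)) (sval xy.2 k) : Cplx R)).

Definition wstar H K : topologicalType :=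
  initial_topology (@normal_pairing H K : _ -> {ptws _ -> Cplx R}).

Definition wspan H K (M : set (bop H K)) : set (bop H K) :=
  closure (lin_span M : set (wstar H K)).

Definition is_TRO H K (M : set (bop H K)) : Prop :=
  is_subspace M /\
  forall m1 m2 m3 m2', M m1 -> M m2 -> M m3 -> is_adjoint m2 m2' ->
    M (bcomp m1 (bcomp m2' m3)).

Definition triple_prod H1 H2 H3 H4
    (X : set (bop H3 H4)) (Y : set (bop H2 H3)) (Z : set (bop H1 H2)) :
    set (bop H1 H4) :=
  [set T | exists x y z, [/\ X x, Y y, Z z & T = bcomp x (bcomp y z)]].

Definition unital_wclosed_algebra H (A : set (bop H H)) : Prop :=
  [/\ is_subspace A, A (bid H), (forall S T, A S -> A T -> A (bcomp S T)) &
      closed (A : set (wstar H H))].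

Definition TRO_equiv H K (A : set (bop H H)) (B : set (bop K K)) : Prop :=
  exists M : set (bop H K),
    [/\ is_TRO M, A = wspan (triple_prod (adjoints M) B M) &
        B = wspan (triple_prod M A (adjoints M))].

Definition is_selfadjoint H (A : set (bop H H)) : Prop := adjoints A `<=` A.

Definition is_projection H (p : bop H H) : Prop :=
  bcomp p p = p /\ is_adjoint p p.

End BoundedOperators.

Section ProjectionRange.
Variables (R : realType) (H : hilbert R) (p : bop H H).

(* For a projection p, this is p(H). *)
Definition fix_pred : {pred H} := fun x => p x == x.

Lemma fix_submod_closed : submod_closed fix_pred.
Proof.
split; last by move=> a u v /eqP pu /eqP pv; apply/eqP; rewrite bop_linear pu pv.
apply/eqP; have := bop_linear p (-1) 0 0.
by rewrite scaler0 addr0 scaleN1r addNr.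
Qed.

HB.instance Definition _ :=
  GRing.isSubmodClosed.Build R[i] H fix_pred fix_submod_closed.

Record fixspace := Fixspace { fix_val : H; fix_valP : fix_val \in fix_pred }.

HB.instance Definition _ := [isSub for fix_val].
HB.instance Definition _ := [Choice of fixspace by <:].
HB.instance Definition _ := [SubChoice_isSubLmodule of fixspace by <:].

Definition fix_dot (x y : fixspace) : R[i] := hdot H (fix_val x) (fix_val y).

Lemma fix_dot_bilinear : bilinear_for *%R (Num.conj \; *%R) fix_dot.
Proof.
have E a u v : fix_val (a *: u + v) = a *: fix_val u + fix_val v.
  exact: (linearP (val : {linear fixspace -> H})).
split=> [y a u v|x a u v]; rewrite /fix_dot E.
  by rewrite linearDl linearZl_LR.
by rewrite linearDr linearZr_LR.
Qed.

Lemma fix_dot_hermitian x y : fix_dot x y = (-1) ^+ false * Num.conj (fix_dot y x).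
Proof. exact: hermitian_subproof. Qed.

Lemma fix_dot_gt0 x : x != 0 -> 0 < fix_dot x x.
Proof. by move=> x0; apply: neq0_dnorm_gt0. Qed.

HB.instance Definition _ :=
  bilinear_isBilinear.Build R[i] fixspace fixspace R[i] *%R (Num.conj \; *%R)
    fix_dot fix_dot_bilinear.
HB.instance Definition _ :=
  isHermitianSesquilinear.Build R[i] fixspace false Num.conj fix_dot
    fix_dot_hermitian.
HB.instance Definition _ :=
  isDotProduct.Build R[i] fixspace fix_dot fix_dot_gt0.

Lemma fix_dot_complete : dot_complete (fix_dot : {dot fixspace for Num.conj}).
Proof.
have B u v : fix_val (u - v) = fix_val u - fix_val v.
  exact: (linearB (val : {linear fixspace -> H})).
have nE u : dotnorm (fix_dot : {dot _ for _}) u = hnorm (fix_val u) by [].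
move=> u ucauchy.
have [|l lP] := @hilbert_complete _ H (fix_val \o u).
  move=> e /ucauchy[N uN]; exists N => m n Nm Nn /=.
  by rewrite -B; exact: uN.
suff pl : p l = l.
  have lin : l \in fix_pred by apply/eqP.
  exists (Fixspace lin) => e /lP[N uN]; exists N => n /uN.
  by rewrite nE B.
have pB x y : p (x - y) = p x - p y.
  by have := bop_linear p (-1) y x; rewrite !scaleN1r ![- _ + _]addrC.
have [M pM] := bop_bounded p.
apply/eqP; rewrite -subr_eq0; apply/eqP/(@dotnorm_eq0 _ _ (hdot H)).
apply/eqP; rewrite -sqrf_eq0 eq_le sqr_ge0 andbT; apply/ler_addgt0Pr => e e0.
rewrite add0r.
have M0 : 0 < 2 * (M ^+ 2 + 1) by have := sqr_ge0 M; lra.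
pose d := Num.sqrt (e / (2 * (M ^+ 2 + 1))).
have d0 : 0 < d by rewrite sqrtr_gt0 divr_gt0.
have [N uN] := lP _ d0; have {uN} := uN N (leqnn N); rewrite /= => uN.
have uN2 : hnorm (fix_val (u N) - l) ^+ 2 <= e / (2 * (M ^+ 2 + 1)).
  have -> : e / (2 * (M ^+ 2 + 1)) = d ^+ 2.
    by rewrite sqr_sqrtr // divr_ge0 // ltW.
  by rewrite ler_pXn2r ?nnegrE ?dotnorm_ge0 // ltW.
have pu : p (fix_val (u N)) = fix_val (u N) by apply/eqP; exact: fix_valP.
have -> : p l - l = - p (fix_val (u N) - l) + (fix_val (u N) - l).
  by rewrite pB pu opprB addrA subrK.
apply: le_trans (dotnormD_sqr _ _ _) _; rewrite dotnormN.
have pM2 : hnorm (p (fix_val (u N) - l)) ^+ 2 <=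
    M ^+ 2 * hnorm (fix_val (u N) - l) ^+ 2.
  rewrite -exprMn ler_pXn2r ?nnegrE ?dotnorm_ge0 //.
  exact: le_trans (dotnorm_ge0 _ _) (pM _).
apply: (@le_trans _ _ (2 * (M ^+ 2 + 1) * hnorm (fix_val (u N) - l) ^+ 2)).
  by move: pM2; lra.
by rewrite mulrC -ler_pdivlMr.
Qed.

Definition fix_hilbert : hilbert R := Hilbert fix_dot_complete.

End ProjectionRange.

Section DualOperatorAlgebras.
Variable R : realType.
Implicit Types H K : hilbert R.

(* pAp as an algebra of operators on p(H). *)
Definition corner H (A : set (bop H H)) (p : bop H H) :
    set (bop (fix_hilbert p) (fix_hilbert p)) :=
  [set b | exists2 a, A a &
     forall x : fix_hilbert p, fix_val (b x) = p (a (fix_val x))].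

Arguments corner {H} A p.

Definition TRO_sub H K (B : set (bop K K)) (A : set (bop H H)) : Prop :=
  exists p : bop H H, [/\ A p, is_projection p & TRO_equiv B (corner A p)].

(* An operator space is a vector space with matrix norms that come from a     *)
(* norm-closed subspace of some B(H). Closedness matters: an incomplete       *)
(* predual would induce a different w*-topology on the dual.                  *)
Record operator_space := OperatorSpace {
  os_car :> lmodType R[i];
  os_norm : forall n, 'M[os_car]_n -> R;
  os_concrete : exists H (u : {linear os_car -> bop H H}),
    [/\ injective u, norm_closed (range u) &
        forall n (x : 'M[_]_n), opmxnorm (map_mx u x) = os_norm x] }.

Definition bounded_functionals (X : operator_space) : set (X -> R[i]) :=
  [set f | linear (f : X -> R[i]^o) /\
     exists M : R, forall x, complex.Re `|f x| <= M * os_norm (const_mx x : 'M[_]_1)].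

Arguments bounded_functionals X : clear implicits.

Definition scalar_mxnorm (I : finType) (a : I -> I -> R[i]) : R :=
  sup [set Num.sqrt (\sum_i complex.Re `|\sum_j a i j * z j| ^+ 2)
      | z in [set z : I -> R[i] | \sum_j complex.Re `|z j| ^+ 2 <= 1]].

(* The completely bounded norm of a matrix of functionals, seen as a map      *)
(* X -> M_n: this is the norm of M_n(X^* ) for the operator space dual X^*.   *)
Definition dual_mxnorm (X : operator_space) n (f : 'M[X -> R[i]]_n) : R :=
  sup [set r | exists (m : nat) (x : 'M[X]_m), os_norm x <= 1 /\
     r = scalar_mxnorm (fun p q : 'I_n * 'I_m => f p.1 q.1 (x p.2 q.2))].

(* A unital operator algebra, with a completely isometric identification      *)
(* [uda_pair] of its underlying operator space with the dual of [uda_predual]. *)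
Record unital_dual_algebra := UnitalDualAlgebra {
  uda_alg :> algType R[i];
  uda_norm : forall n, 'M[uda_alg]_n -> R;
  uda_concrete : exists H (u : {linear uda_alg -> bop H H}),
    [/\ injective u /\ norm_closed (range u), u 1 = bid H,
        (forall a b, u (a * b) = bcomp (u a) (u b)) &
        forall n (a : 'M[_]_n), opmxnorm (map_mx u a) = uda_norm a];
  uda_predual : operator_space;
  uda_pair : uda_alg -> uda_predual -> R[i];
  uda_pair_linear : forall x, linear (uda_pair^~ x : uda_alg -> R[i]^o);
  uda_pair_bij : set_bij setT (bounded_functionals uda_predual) uda_pair;
  uda_pair_isometry : forall n (a : 'M[_]_n),
    dual_mxnorm (map_mx uda_pair a) = uda_norm a }.

Definition uda_wstar (A : unital_dual_algebra) : topologicalType :=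
  initial_topology (@uda_pair A : A -> {ptws _ -> Cplx R}).

(* w*-continuous completely isometric homomorphisms onto a unital w*-closed   *)
(* algebra of operators on H.                                                 *)
Definition normal_rep (A : unital_dual_algebra) H
    (alpha : {linear A -> bop H H}) : Prop :=
  [/\ forall a b, alpha (a * b) = bcomp (alpha a) (alpha b),
      forall n (a : 'M[_]_n), opmxnorm (map_mx alpha a) = uda_norm a,
      continuous (alpha : uda_wstar A -> wstar H H) &
      unital_wclosed_algebra (range alpha)].

Definition delta_equiv (A B : unital_dual_algebra) : Prop :=
  exists H K (alpha : {linear A -> bop H H}) (beta : {linear B -> bop K K}),
    [/\ normal_rep alpha, normal_rep beta & TRO_equiv (range alpha) (range beta)].

Definition delta_sub (B A : unital_dual_algebra) : Prop :=
  exists H K (alpha : {linear A -> bop H H}) (beta : {linear B -> bop K K}),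
    [/\ normal_rep alpha, normal_rep beta & TRO_sub (range beta) (range alpha)].

(* The self-adjoint dual operator algebras are the von Neumann algebras. *)
Definition uda_selfadjoint (A : unital_dual_algebra) : Prop :=
  exists H (alpha : {linear A -> bop H H}),
    normal_rep alpha /\ is_selfadjoint (range alpha).

End DualOperatorAlgebras.

(* Main.v *)
From HB Require Import structures.
Require Import Defs.
From mathcomp Require Import all_boot all_order all_algebra.
From mathcomp Require Import complex.
From mathcomp Require Import all_classical all_reals all_analysis.
From mathcomp Require Import ring lra.

(** Let [T_2] be the algebra of upper triangular 2x2 matrices, A the
    [l^oo]-direct sum of countably many copies of [T_2] and B = C (+) A, both
    acting on [l^2].  Cutting A down by the projection that removes one basis
    vector leaves a copy of B, and cutting B down by the unit of A leaves A.

    If A and B were TRO-equivalent through M, let z be the projection onto the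
    summand C of B, so that z B = C z = B z.  For m in M the operator m* z m is
    then a multiple of a projection e with e A e = C e, that is, of a diagonal
    matrix unit of A.  Two operators m* z n and n* z m are adjoint to each other
    and both lie in A, so by antisymmetry of the order on the matrix units they
    are multiples of the same e.  Hence e commutes with M* B M, which spans A:
    but no diagonal matrix unit of A is central.

    For the abstract dual algebra the predual is [l^1] of the set of matrix
    units.  It becomes a concrete operator space by sending x to the direct sum,
    over all n and all f in [M_n(A)], of the matrices [<f_ij, x> / |f|]. *)

Set Implicit Arguments.
Unset Strict Implicit.
Unset Printing Implicit Defensive.

Import Order.TTheory GRing.Theory Num.Theory.
Import numFieldNormedType.Exports.
Local Open Scope classical_set_scope.
Local Open Scope ring_scope.

(** * Moduli and inner products *)

(** The representations allowed in Delta-equivalence are multiplicative, completely isometric and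
    w*-continuous, but nothing is assumed about adjoints, while a TRO argument needs projections.
    What survives is that an idempotent of norm at most 1 on a Hilbert space is self-adjoint:
    diagonal matrix units stay projections in every representation, and projections of the image
    pull back to contractive idempotents of the algebra. Chains of length at most two keep the
    analysis elementary. A row has at most two nonzero entries, so every bounded family of
    coefficients on the order comes from an operator, with a factor 2 in the norm; this makes the
    algebra the Banach dual of [l^1], and it makes every normal functional restrict to a summable
    family. For the exact matrix norms, the normalised direct sum gives one inequality at once, by
    looking at the block indexed by the given matrix itself. The reverse inequality tests against
    matrices of unit vectors of [l^1]: pairing with them returns the finite truncations of an
    operator. *)

Definition cabs (R : realType) (z : R[i]) : R := complex.Re `|z|.

Section ComplexModulus.
Variable R : realType.
Implicit Types z w : R[i].
Local Notation cabs := (@cabs R).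

(** The norm of [R[i]] takes complex values; [cabs] is its real form. Through this equation and
    [complexI], identities for the complex norm become identities for [cabs]. *)
Lemma cabsE z : `|z| = (cabs z)%:C%C.
Proof. by rewrite /cabs normc_def. Qed.

Lemma cabs_ge0 z : 0 <= cabs z.
Proof. by rewrite -ler0c -cabsE. Qed.

Lemma cabs0 : cabs 0 = 0.
Proof. by apply: complexI; rewrite -cabsE normr0. Qed.

Lemma cabs1 : cabs 1 = 1.
Proof. by apply: complexI; rewrite -cabsE normr1. Qed.

Lemma cabsM z w : cabs (z * w) = cabs z * cabs w.
Proof. by apply: complexI; rewrite -cabsE normrM !cabsE -rmorphM. Qed.

Lemma cabsN z : cabs (- z) = cabs z.
Proof. by apply: complexI; rewrite -!cabsE normrN. Qed.

Lemma cabsJ z : cabs z^* = cabs z.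
Proof. by apply: complexI; rewrite -!cabsE norm_conjC. Qed.

Lemma cabsD z w : cabs (z + w) <= cabs z + cabs w.
Proof. by rewrite -lecR rmorphD /= -!cabsE ler_normD. Qed.

Lemma cabs_sum (I : Type) (s : seq I) (P : pred I) (F : I -> R[i]) :
  cabs (\sum_(i <- s | P i) F i) <= \sum_(i <- s | P i) cabs (F i).
Proof.
elim/big_ind2: _ => [|z x w y zx wy|//]; first by rewrite cabs0.
exact: le_trans (cabsD _ _) (lerD zx wy).
Qed.

Lemma cabsV z : cabs z^-1 = (cabs z)^-1.
Proof. by apply: complexI; rewrite -cabsE normfV cabsE fmorphV. Qed.

Lemma cabs_real (x : R) : 0 <= x -> cabs x%:C%C = x.
Proof. by move=> x0; apply: complexI; rewrite -cabsE ger0_norm // ler0c. Qed.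

Lemma cabs_eq0 z : (cabs z == 0) = (z == 0).
Proof. by rewrite -[RHS]normr_eq0 cabsE (inj_eq (@complexI R) _ 0). Qed.

Lemma cabs_sqr z : cabs z ^+ 2 = complex.Re z ^+ 2 + complex.Im z ^+ 2.
Proof. by apply: complexI; rewrite rmorphXn /= -cabsE add_Re2_Im2. Qed.

Lemma conjCM_cabs z : z * z^* = (cabs z ^+ 2)%:C%C.
Proof. by rewrite -normCK cabsE -rmorphXn. Qed.

Lemma le_Re_cabs z : `|complex.Re z| <= cabs z.
Proof.
rewrite -(@ler_pXn2r _ 2) ?nnegrE ?cabs_ge0 // cabs_sqr real_normK ?num_real //.
by rewrite lerDl sqr_ge0.
Qed.

Lemma le_Im_cabs z : `|complex.Im z| <= cabs z.
Proof.
rewrite -(@ler_pXn2r _ 2) ?nnegrE ?cabs_ge0 // cabs_sqr real_normK ?num_real //.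
by rewrite lerDr sqr_ge0.
Qed.

Lemma cabs_le_ReIm z : cabs z <= `|complex.Re z| + `|complex.Im z|.
Proof.
rewrite -(@ler_pXn2r _ 2) ?nnegrE ?cabs_ge0 ?addr_ge0 // cabs_sqr sqrrD.
by rewrite !real_normK ?num_real // lerD2r lerDl mulrn_wge0 // mulr_ge0.
Qed.

Lemma conjC_re (x : R) : (x%:C%C)^* = x%:C%C :> R[i].
Proof. exact: conjc_real. Qed.

(** The value 1 at 0 keeps the modulus equal to 1 everywhere, so that conjugate phases can serve as
    coefficients without a case distinction. *)
Definition cphase z : R[i] := if z == 0 then 1 else z / `|z|.

Lemma cabs_phase z : cabs (cphase z) = 1.
Proof.
rewrite /cphase; case: eqVneq => [_|z0]; first exact: cabs1.
rewrite cabsM cabsV /cabs normr_id divff //.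
by have := cabs_eq0 z; rewrite (negPf z0) => /negbT.
Qed.

Lemma conj_phaseM z : (cphase z)^* * z = (cabs z)%:C%C.
Proof.
rewrite /cphase; case: eqVneq => [->|z0]; first by rewrite mulr0 cabs0.
rewrite cabsE -fmorphV rmorphM /= conjC_re fmorphV mulrAC [_^* * _]mulrC.
rewrite conjCM_cabs expr2 rmorphM mulfK //.
by rewrite (inj_eq (@complexI R) _ 0) cabs_eq0.
Qed.

End ComplexModulus.

Section DotNormTheory.
Variables (R : realType) (V : lmodType R[i]) (d : {dot V for Num.conj}).
Local Notation N := (dotnorm d).

Lemma dotE x : d x x = (N x ^+ 2)%:C%C.
Proof.
rewrite dotnorm_sqr; have : 0 <= d x x by exact: dnorm_ge0.
by move=> /ger0_Im h; rewrite [LHS]complexE h mulr0 addr0.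
Qed.

Lemma dotC x y : d x y = (d y x)^*.
Proof. by rewrite hermC mul1r. Qed.

Lemma dotZl a x y : d (a *: x) y = a * d x y.
Proof. exact: linearZl_LR. Qed.

Lemma dotZr a x y : d x (a *: y) = a^* * d x y.
Proof. exact: linearZr_LR. Qed.

Lemma dot_suml (I : Type) (s : seq I) (P : pred I) (F : I -> V) y :
  d (\sum_(i <- s | P i) F i) y = \sum_(i <- s | P i) d (F i) y.
Proof. exact: linear_sumlz. Qed.

Lemma dotnormZ a x : N (a *: x) = cabs a * N x.
Proof.
apply/eqP; rewrite -(@eqrXn2 _ 2) ?mulr_ge0 ?dotnorm_ge0 ?cabs_ge0 //.
by rewrite dotnormZ_sqr exprMn /cabs cabsE -rmorphXn /=.
Qed.

Lemma dot_CS x y : cabs (d x y) <= N x * N y.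
Proof.
rewrite -(@ler_pXn2r _ 2) ?nnegrE ?mulr_ge0 ?dotnorm_ge0 ?cabs_ge0 // exprMn.
have [->|y0] := eqVneq y 0; first by rewrite linear0r cabs0 dotnorm0 expr0n mulr0.
have Ny : 0 < N y ^+ 2 by rewrite -ltcR -dotE dnorm_gt0.
(* [|y|^2] times the component of [x] orthogonal to [y]; this scaling avoids a division, and
   positivity of [d w w] is the inequality multiplied by [|y|^2]. *)
pose w := (N y ^+ 2)%:C%C *: x - d x y *: y.
have : d w w = (N y ^+ 2 * (N x ^+ 2 * N y ^+ 2 - cabs (d x y) ^+ 2))%:C%C.
  rewrite /w linearBl /= !linearBr /= !dotZl !dotZr !dotE (dotC y x) conjC_re.
  have := conjCM_cabs (d x y); move: (_ ^+ 2) (_ ^+ 2) (cabs _ ^+ 2) => Y X Z.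
  by rewrite !(rmorphB, rmorphM) /= => <-; ring.
have /[swap] -> : 0 <= d w w by exact: dnorm_ge0.
by rewrite ler0c pmulr_rge0 // subr_ge0.
Qed.

Lemma dotnormD x y : N (x + y) <= N x + N y.
Proof.
rewrite -(@ler_pXn2r _ 2) ?nnegrE ?addr_ge0 ?dotnorm_ge0 //.
rewrite -lecR -dotE dnormD (dotC x y) conjCK !dotE.
have -> : ((d y x)^* + d y x) = (complex.Re (d y x) *+ 2)%:C%C.
  by case: (d y x) => a b; apply/eqP; rewrite eq_complex /= mulr2n addNr !eqxx.
rewrite -!rmorphD lecR sqrrD.
have := le_trans (ler_norm _) (le_trans (le_Re_cabs (d y x)) (dot_CS y x)).
by rewrite !mulr2n => h; nra.
Qed.

Lemma dotnormB x y : N (x - y) = N (y - x).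
Proof. by rewrite -dotnormN opprB. Qed.

Lemma dotnorm_sum (I : Type) (s : seq I) (P : pred I) (F : I -> V) :
  N (\sum_(i <- s | P i) F i) <= \sum_(i <- s | P i) N (F i).
Proof.
elim/big_ind2: _ => [|z x w y zx wy|//]; first by rewrite dotnorm0.
exact: le_trans (dotnormD _ _) (lerD zx wy).
Qed.

Lemma ler_dotnormB x y : N x - N y <= N (x - y).
Proof. by rewrite lerBlDr (le_trans _ (dotnormD _ _)) ?subrK. Qed.

Lemma dotnorm_dist x y : `|N x - N y| <= N (x - y).
Proof. by rewrite ler_norml ler_dotnormB lerNl opprB dotnormB ler_dotnormB. Qed.

Lemma dot_eq0 x : (forall y, d x y = 0) -> x = 0.
Proof. by move=> /(_ x) /eqP; rewrite dnorm_eq0 => /eqP. Qed.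

Lemma dot_inj x x' : (forall y, d x y = d x' y) -> x = x'.
Proof.
move=> h; apply/eqP; rewrite -subr_eq0; apply/eqP/dot_eq0 => y.
by rewrite linearBl /= h subrr.
Qed.

End DotNormTheory.

(** * Unordered sums *)

Lemma sum_seq_split (I : eqType) (V : nmodType) (g : I -> V) (s t : seq I) :
  uniq s -> uniq t -> {subset s <= t} ->
  \sum_(i <- t) g i = \sum_(i <- s) g i + \sum_(i <- t | i \notin s) g i.
Proof.
move=> us ut st; rewrite (bigID (mem s)) /=; congr (_ + _).
rewrite -big_filter; apply: perm_big; apply: uniq_perm => //.
  exact: filter_uniq.
by move=> i; rewrite mem_filter; case: (boolP (i \in s)) => // /st ->.
Qed.

Section UnorderedSums.
Variables (R : realType) (I : eqType).
Implicit Types (g h : I -> R[i]) (p q : I -> R) (s t : seq I).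

(** Finite subsets of the index type are represented by duplicate-free sequences. Unordered sums are
    used because the index types are positions in a matrix and, for the predual, the uncountable
    type of all finite matrices over the algebra. *)
Definition fin_bounded p (M : R) :=
  forall s, uniq s -> \sum_(i <- s) p i <= M.

Definition psum p : R := sup [set \sum_(i <- s) p i | s in [set s | uniq s]].

Lemma psum_ub p M s : fin_bounded p M -> uniq s -> \sum_(i <- s) p i <= psum p.
Proof.
move=> pM us; apply: ub_le_sup; last by exists s.
by exists M => _ [t /= ut <-]; exact: pM.
Qed.

Lemma psum_le p M : fin_bounded p M -> psum p <= M.
Proof.
move=> pM; apply: ge_sup; first by exists 0, [::] => //; rewrite big_nil.
by move=> _ [t /= ut <-]; exact: pM.
Qed.

Lemma psum_ge0 p M : fin_bounded p M -> 0 <= psum p.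
Proof. by move=> pM; have := psum_ub pM (s := [::]) isT; rewrite big_nil. Qed.

Lemma psum_fin_bounded p M : fin_bounded p M -> fin_bounded p (psum p).
Proof. by move=> pM s us; exact: psum_ub pM us. Qed.

Lemma psum_approx p M e : fin_bounded p M -> 0 < e ->
  exists2 s, uniq s & psum p - e < \sum_(i <- s) p i.
Proof.
move=> pM e0.
have hs : has_sup [set \sum_(i <- s) p i | s in [set s | uniq s]].
  split; first by exists 0, [::] => //; rewrite big_nil.
  by exists M => _ [t /= ut <-]; exact: pM.
by have [_ [s /= us <-] h] := sup_adherent e0 hs; exists s.
Qed.

Lemma fin_boundedW p q M : (forall i, p i <= q i) -> fin_bounded q M ->
  fin_bounded p M.
Proof. by move=> pq qM s us; apply: le_trans (qM s us); apply: ler_sum. Qed.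

Lemma fin_boundedD p q M N : fin_bounded p M -> fin_bounded q N ->
  fin_bounded (fun i => p i + q i) (M + N).
Proof. by move=> pM qN s us; rewrite big_split lerD ?pM ?qN. Qed.

Lemma fin_boundedZ a p M : 0 <= a -> fin_bounded p M ->
  fin_bounded (fun i => a * p i) (a * M).
Proof. by move=> a0 pM s us; rewrite -mulr_sumr ler_wpM2l ?pM. Qed.

Lemma fin_bounded_term p M i : fin_bounded p M -> p i <= M.
Proof. by move=> /(_ [:: i] isT); rewrite big_seq1. Qed.

Lemma psum_tail p M e : (forall i, 0 <= p i) -> fin_bounded p M -> 0 < e ->
  exists2 s, uniq s & forall t, uniq t -> {subset s <= t} ->
    psum p - e < \sum_(i <- t) p i.
Proof.
move=> p0 pM e0; have [s us hs] := psum_approx pM e0; exists s => // t ut st.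
by apply: lt_le_trans hs _; rewrite (sum_seq_split _ us ut st) lerDl sumr_ge0.
Qed.

(** Convergence of the net of finite partial sums, directed by inclusion. *)
Definition is_csum g (c : R[i]) := forall e : R, 0 < e ->
  exists2 s, uniq s & forall t, uniq t -> {subset s <= t} ->
    cabs (\sum_(i <- t) g i - c) < e.

Lemma is_csum_unique g c c' : is_csum g c -> is_csum g c' -> c = c'.
Proof.
move=> gc gc'; apply/eqP; rewrite -subr_eq0 -cabs_eq0 eq_le cabs_ge0 andbT.
apply/ler_addgt0Pr => e e0; rewrite add0r.
have [s us hs] := gc (e / 2) (divr_gt0 e0 (ltr0n _ 2)).
have [s' us' hs'] := gc' (e / 2) (divr_gt0 e0 (ltr0n _ 2)).
have ut := undup_uniq (s ++ s').
have {}hs := hs _ ut; have {}hs' := hs' _ ut.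
have {}hs : cabs (\sum_(i <- undup (s ++ s')) g i - c) < e / 2.
  by apply: hs => i is_; rewrite mem_undup mem_cat is_.
have {}hs' : cabs (\sum_(i <- undup (s ++ s')) g i - c') < e / 2.
  by apply: hs' => i is_; rewrite mem_undup mem_cat is_ orbT.
set S := \sum_(i <- _) _ in hs hs'.
have -> : c - c' = (S - c') + - (S - c) by ring.
apply: le_trans (cabsD _ _) _; rewrite cabsN.
by move: (cabs _) (cabs _) hs hs' => x y; lra.
Qed.

Lemma is_csumD g h c c' : is_csum g c -> is_csum h c' ->
  is_csum (fun i => g i + h i) (c + c').
Proof.
move=> gc hc' e e0.
have [s us hs] := gc (e / 2) (divr_gt0 e0 (ltr0n _ 2)).
have [s' us' hs'] := hc' (e / 2) (divr_gt0 e0 (ltr0n _ 2)).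
exists (undup (s ++ s')); first exact: undup_uniq.
move=> t ut st.
have {}hs : cabs (\sum_(i <- t) g i - c) < e / 2.
  by apply: hs => // i is_; apply: st; rewrite mem_undup mem_cat is_.
have {}hs' : cabs (\sum_(i <- t) h i - c') < e / 2.
  by apply: hs' => // i is_; apply: st; rewrite mem_undup mem_cat is_ orbT.
rewrite big_split /= opprD addrACA; apply: le_lt_trans (cabsD _ _) _.
by move: (cabs _) (cabs _) hs hs' => x y; lra.
Qed.

Lemma is_csumZ a g c : is_csum g c -> is_csum (fun i => a * g i) (a * c).
Proof.
move=> gc e e0.
have a0 : 0 < cabs a + 1 by rewrite ltr_wpDl ?cabs_ge0.
have [s us hs] := gc (e / (cabs a + 1)) (divr_gt0 e0 a0).
exists s => // t ut st; rewrite -mulr_sumr -mulrBr cabsM.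
have := hs t ut st; rewrite ltr_pdivlMr // => /(le_lt_trans _); apply.
by rewrite mulrC ler_wpM2l ?cabs_ge0 // lerDl.
Qed.

Lemma is_csumJ g c : is_csum g c -> is_csum (fun i => (g i)^*) c^*.
Proof.
move=> gc e e0; have [s us hs] := gc e e0; exists s => // t ut st.
by rewrite -rmorph_sum -rmorphB cabsJ; exact: hs.
Qed.

Lemma is_csum_psum p M : (forall i, 0 <= p i) -> fin_bounded p M ->
  is_csum (fun i => (p i)%:C%C) (psum p)%:C%C.
Proof.
move=> p0 pM e e0; have [s us hs] := psum_tail p0 pM e0; exists s => // t ut st.
rewrite -rmorph_sum -rmorphB -cabsN -rmorphN opprB.
rewrite cabs_real ?subr_ge0 ?(psum_ub pM) //.
by rewrite ltrBlDr -ltrBlDl; exact: hs.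
Qed.

Lemma is_csum_fin g s : uniq s -> (forall i, i \notin s -> g i = 0) ->
  is_csum g (\sum_(i <- s) g i).
Proof.
move=> us g0 e e0; exists s => // t ut st.
by rewrite (sum_seq_split _ us ut st) addrAC subrr add0r big1 ?cabs0.
Qed.

Lemma is_csum_le g c p M : (forall i, cabs (g i) <= p i) -> fin_bounded p M ->
  is_csum g c -> cabs c <= M.
Proof.
move=> gp pM gc; apply/ler_addgt0Pr => e e0; have [s us hs] := gc e e0.
have := hs s us (fun _ => id).
set S := \sum_(i <- s) g i => hS.
have -> : c = S + - (S - c) by ring.
apply: le_trans (cabsD _ _) _; rewrite cabsN lerD ?(ltW hS) //.
apply: le_trans (cabs_sum _ _ _) (le_trans _ (pM s us)).
exact: ler_sum.
Qed.

Definition abs_summable g := exists M, fin_bounded (fun i => cabs (g i)) M.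

Lemma abs_summableW g p M : (forall i, cabs (g i) <= p i) -> fin_bounded p M ->
  abs_summable g.
Proof. by move=> gp pM; exists M; exact: fin_boundedW gp pM. Qed.

(** A real family is the difference of the nonnegative families [p + |p|] and [|p|], whose sums
    exist as suprema. *)
Lemma real_csum_exists p M : fin_bounded (fun i => `|p i|) M ->
  exists c, is_csum (fun i => (p i)%:C%C) c.
Proof.
move=> pM.
have q0 i : 0 <= p i + `|p i| by have := ler_norm (- p i); rewrite normrN; lra.
have qM : fin_bounded (fun i => p i + `|p i|) (M + M).
  by apply: fin_boundedD => //; apply: fin_boundedW pM => i; exact: ler_norm.
have := is_csumD (is_csum_psum q0 qM)
  (is_csumZ (-1) (is_csum_psum (fun i => normr_ge0 (p i)) pM)).
set c := (X in is_csum _ X); set f := (X in is_csum X _) => h; exists c.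
suff <- : f = (fun i => (p i)%:C%C) by [].
by apply/funext => i; rewrite /f rmorphD /= mulN1r addrK.
Qed.

Lemma csum_exists g : abs_summable g -> exists c, is_csum g c.
Proof.
move=> [M gM].
have [c1 h1] : exists c, is_csum (fun i => (complex.Re (g i))%:C%C) c.
  by apply: (@real_csum_exists _ M); apply: fin_boundedW gM => i; exact: le_Re_cabs.
have [c2 h2] : exists c, is_csum (fun i => (complex.Im (g i))%:C%C) c.
  by apply: (@real_csum_exists _ M); apply: fin_boundedW gM => i; exact: le_Im_cabs.
exists (c1 + 'i%C * c2).
have := is_csumD h1 (is_csumZ 'i%C h2).
by under eq_fun do rewrite -complexE.
Qed.

Definition csum g : R[i] := xget 0 [set c | is_csum g c].

Lemma csumP g : abs_summable g -> is_csum g (csum g).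
Proof. by move=> /csum_exists[c h]; rewrite /csum; case: xgetP => [x -> //|/(_ c)]. Qed.

Lemma csumE g c : is_csum g c -> csum g = c.
Proof.
by move=> gc; rewrite /csum; case: xgetP => [x -> /is_csum_unique /(_ gc)|/(_ c)].
Qed.

Lemma psum_cauchy_tail p M e : fin_bounded p M -> 0 < e ->
  exists2 s, uniq s & forall t, uniq t -> (forall i, i \in t -> i \notin s) ->
    \sum_(i <- t) p i < e.
Proof.
move=> gM e0; have [s us hs] := psum_approx gM e0; exists s => // t ut st.
have us' : uniq (s ++ t).
  by rewrite cat_uniq us ut andbT /=; apply/hasPn => i /st.
have := psum_ub gM us'; rewrite big_cat /=.
by move: hs; set x := \sum_(_ <- s) _; set y := \sum_(_ <- t) _; lra.
Qed.

End UnorderedSums.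

(** * The Hilbert spaces l^2(I; V) *)

Lemma real_cauchy (R : realType) (u : nat -> R) :
  (forall e : R, 0 < e -> exists N, forall m n, (N <= m)%N -> (N <= n)%N ->
     `|u m - u n| < e) ->
  exists l : R, forall e : R, 0 < e -> exists N, forall n, (N <= n)%N -> `|u n - l| < e.
Proof.
move=> uC.
have cu : cvg (u @ \oo).
  apply/cauchy_cvgP/cauchy_exP => e e0.
  have [N uN] := uC e e0; exists (u N); exists N => // n /= Nn.
  by rewrite -ball_normE /=; exact: uN.
exists (lim (u @ \oo)) => e e0.
have /cvgrPdist_lt/(_ e e0) [N _ uN] := cu.
by exists N => n Nn; rewrite distrC; exact: uN.
Qed.

Section ScalarHilbert.
Variable R : realType.

Definition cdot (x y : R[i]^o) : R[i] := x * y^*.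

Lemma cdot_bilinear : bilinear_for *%R (Num.conj \; *%R) cdot.
Proof.
split=> [y a u v|x a u v]; rewrite /cdot.
  by rewrite mulrDl /GRing.scale /= mulrA.
by rewrite rmorphD rmorphM /= mulrDr mulrCA.
Qed.

Lemma cdot_hermitian x y : cdot x y = (-1) ^+ false * Num.conj (cdot y x).
Proof. by rewrite /cdot rmorphM /= conjCK mul1r mulrC. Qed.

Lemma cdot_gt0 x : x != 0 -> 0 < cdot x x.
Proof. by move=> x0; rewrite /cdot -normCK exprn_gt0 // normr_gt0. Qed.

HB.instance Definition _ :=
  bilinear_isBilinear.Build R[i] R[i]^o R[i]^o R[i] *%R (Num.conj \; *%R)
    cdot cdot_bilinear.
HB.instance Definition _ :=
  isHermitianSesquilinear.Build R[i] R[i]^o false Num.conj cdot cdot_hermitian.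
HB.instance Definition _ := isDotProduct.Build R[i] R[i]^o cdot cdot_gt0.

Lemma cdotnormE x : dotnorm (cdot : {dot R[i]^o for Num.conj}) x = cabs x.
Proof.
apply/eqP; rewrite -(@eqrXn2 _ 2) ?dotnorm_ge0 ?cabs_ge0 // dotnorm_sqr /=.
by rewrite /cdot conjCM_cabs.
Qed.

Lemma cdot_complete : dot_complete (cdot : {dot R[i]^o for Num.conj}).
Proof.
move=> u uC.
have [l lP] : exists l, forall e, 0 < e -> exists N, forall n, (N <= n)%N ->
    `|complex.Re (u n) - l| < e.
  apply: real_cauchy => e /uC[N uN]; exists N => m n Nm Nn.
  apply: le_lt_trans (uN m n Nm Nn); rewrite cdotnormE.
  by apply: le_trans (le_Re_cabs _); rewrite raddfB.
have [k kP] : exists l, forall e, 0 < e -> exists N, forall n, (N <= n)%N ->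
    `|complex.Im (u n) - l| < e.
  apply: real_cauchy => e /uC[N uN]; exists N => m n Nm Nn.
  apply: le_lt_trans (uN m n Nm Nn); rewrite cdotnormE.
  by apply: le_trans (le_Im_cabs _); rewrite raddfB.
exists (l +i* k)%C => e e0.
have [N1 h1] := lP (e / 2) (divr_gt0 e0 (ltr0n _ 2)).
have [N2 h2] := kP (e / 2) (divr_gt0 e0 (ltr0n _ 2)).
exists (maxn N1 N2) => n; rewrite geq_max => /andP[/h1 + /h2].
rewrite cdotnormE; have := cabs_le_ReIm (u n - (l +i* k)%C).
case: (u n) => a b /=; lra.
Qed.

Definition chilbert : hilbert R := Hilbert cdot_complete.

Lemma chnormE (x : chilbert) : hnorm x = cabs (x : R[i]).
Proof. exact: cdotnormE. Qed.

End ScalarHilbert.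

Section L2.
Variables (R : realType) (I : eqType) (V : hilbert R).
Implicit Types z w : I -> V.

(** Needed for two choices: [I = nat] with scalar [V] is the space on which the algebras act, and
    [I = blockIndex] with [V = ell2] is the direct sum on which the predual is realised. *)
Definition l2_pred : {pred I -> V} :=
  fun z => `[< exists M, fin_bounded (fun i => hnorm (z i) ^+ 2) M >].

Lemma l2_submod_closed : submod_closed l2_pred.
Proof.
split.
  apply/asboolP; exists 0 => s us; rewrite big1 // => i _.
  by rewrite dotnorm0 expr0n.
move=> a z w /asboolP[M zM] /asboolP[N wN]; apply/asboolP.
exists (2 * (cabs a ^+ 2 * M + N)).
apply: (@fin_boundedW _ _ _ (fun i => 2 * (cabs a ^+ 2 * hnorm (z i) ^+ 2 + hnorm (w i) ^+ 2))).
  move=> i; apply: le_trans (dotnormD_sqr _ _ _) _.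
  by rewrite dotnormZ exprMn.
by apply: fin_boundedZ => //; apply: fin_boundedD => //; apply: fin_boundedZ => //; exact: sqr_ge0.
Qed.

HB.instance Definition _ :=
  GRing.isSubmodClosed.Build R[i] (I -> V) l2_pred l2_submod_closed.

Record l2 := L2 { l2_val :> I -> V; l2_valP : l2_val \in l2_pred }.

HB.instance Definition _ := [isSub for l2_val].
HB.instance Definition _ := [Choice of l2 by <:].
HB.instance Definition _ := [SubChoice_isSubLmodule of l2 by <:].

Lemma l2ext (x y : l2) : (forall i, x i = y i) -> x = y.
Proof. by move=> h; apply/val_inj/funext. Qed.

Lemma l2D (x y : l2) i : (x + y) i = x i + y i. Proof. by []. Qed.
Lemma l2Z a (x : l2) i : (a *: x) i = a *: x i. Proof. by []. Qed.
Lemma l2B (x y : l2) i : (x - y) i = x i - y i. Proof. by []. Qed.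

Lemma l2_sum (J : Type) (s : seq J) (P : pred J) (F : J -> l2) i :
  (\sum_(j <- s | P j) F j) i = \sum_(j <- s | P j) F j i.
Proof. by elim/big_rec2: _ => // j y x _ <-. Qed.

Lemma l2_bounded (x : l2) : exists M, fin_bounded (fun i => hnorm (x i) ^+ 2) M.
Proof. by have /asboolP := l2_valP x. Qed.

Definition l2dot (x y : l2) : R[i] := csum (fun i => hdot V (x i) (y i)).

Lemma l2dot_summable (x y : l2) : abs_summable (fun i => hdot V (x i) (y i)).
Proof.
have [M xM] := l2_bounded x; have [N yN] := l2_bounded y.
apply: abs_summableW (fin_boundedD xM yN) => i; apply: le_trans (dot_CS _ _ _) _.
have := sqr_ge0 (hnorm (x i) - hnorm (y i)).
have := sqr_ge0 (hnorm (x i) + hnorm (y i)); nra.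
Qed.

Lemma l2dotP (x y : l2) : is_csum (fun i => hdot V (x i) (y i)) (l2dot x y).
Proof. exact/csumP/l2dot_summable. Qed.

Lemma l2dot_bilinear : bilinear_for *%R (Num.conj \; *%R) l2dot.
Proof.
split=> [y a u v|x a u v].
  have := is_csumD (is_csumZ a (l2dotP u y)) (l2dotP v y).
  move=> /csumE <-; congr csum; apply/funext => i.
  by rewrite l2D l2Z linearDl linearZl_LR.
have := is_csumD (is_csumZ a^* (l2dotP x u)) (l2dotP x v).
move=> /csumE <-; congr csum; apply/funext => i.
by rewrite l2D l2Z linearDr linearZr_LR.
Qed.

Lemma l2dot_hermitian x y : l2dot x y = (-1) ^+ false * Num.conj (l2dot y x).
Proof.
rewrite mul1r; have := is_csumJ (l2dotP y x).
by move=> /csumE <-; congr csum; apply/funext => i; rewrite [LHS]dotC.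
Qed.

Lemma l2dot_diag (x : l2) : l2dot x x = (psum (fun i => hnorm (x i) ^+ 2))%:C%C.
Proof.
have [M xM] := l2_bounded x; apply: csumE.
have := is_csum_psum (fun i => sqr_ge0 (hnorm (x i))) xM.
by under eq_fun do rewrite -dotE.
Qed.

Lemma l2dot_gt0 x : x != 0 -> 0 < l2dot x x.
Proof.
move=> x0; rewrite l2dot_diag ltcR.
have [M xM] := l2_bounded x; rewrite lt_neqAle (psum_ge0 xM) andbT.
apply: contra_neq x0 => ps0; apply: l2ext => i.
apply/(@dotnorm_eq0 _ _ (hdot V))/eqP; rewrite -sqrf_eq0 eq_le sqr_ge0 andbT.
have /(_ [:: i] isT) := psum_fin_bounded xM.
by rewrite big_seq1 -ps0.
Qed.

HB.instance Definition _ :=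
  bilinear_isBilinear.Build R[i] l2 l2 R[i] *%R (Num.conj \; *%R)
    l2dot l2dot_bilinear.
HB.instance Definition _ :=
  isHermitianSesquilinear.Build R[i] l2 false Num.conj l2dot l2dot_hermitian.
HB.instance Definition _ := isDotProduct.Build R[i] l2 l2dot l2dot_gt0.

Local Notation N2 := (dotnorm (l2dot : {dot l2 for Num.conj})).

Lemma l2norm_sqr (x : l2) : N2 x ^+ 2 = psum (fun i => hnorm (x i) ^+ 2).
Proof. by rewrite dotnorm_sqr /= l2dot_diag. Qed.

Lemma l2norm_fin_bounded (x : l2) :
  fin_bounded (fun i => hnorm (x i) ^+ 2) (N2 x ^+ 2).
Proof. by rewrite l2norm_sqr; have [M /psum_fin_bounded] := l2_bounded x. Qed.

Lemma l2norm_sqr_le (x : l2) M : fin_bounded (fun i => hnorm (x i) ^+ 2) M ->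
  N2 x ^+ 2 <= M.
Proof. by rewrite l2norm_sqr; exact: psum_le. Qed.

Lemma l2norm_coord (x : l2) i : hnorm (x i) <= N2 x.
Proof.
rewrite -(@ler_pXn2r _ 2) ?nnegrE ?dotnorm_ge0 //.
exact: fin_bounded_term i (l2norm_fin_bounded x).
Qed.

(** A form of Fatou's lemma: the bound concerns only finite sums, and each of these passes to the
    limit. Completeness of [l2] and of the predual both rest on it. *)
Lemma fin_bounded_limit (p : nat -> I -> R) (q : I -> R) M :
  (\forall n \near \oo, fin_bounded (p n) M) ->
  (forall i, p ^~ i @ \oo --> q i) -> fin_bounded q M.
Proof.
move=> pM pq s us.
have h : (fun n => \sum_(i <- s) p n i) @ \oo --> \sum_(i <- s) q i.
  elim: s {us} => [|i s IH].
    by rewrite big_nil; under eq_fun do rewrite big_nil; exact: cvg_cst.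
  by rewrite big_cons; under eq_fun do rewrite big_cons; exact: cvgD (pq i) IH.
rewrite -(cvg_lim (@Rhausdorff R) h); apply: limr_le; first by apply/cvg_ex; exists (\sum_(i <- s) q i).
by apply: filterS pM => n; exact.
Qed.

Lemma l2dot_complete : dot_complete (l2dot : {dot l2 for Num.conj}).
Proof.
move=> u uC.
have /choice[l lP] : forall i, exists l, forall e, 0 < e -> exists N, forall n, (N <= n)%N ->
    hnorm (u n i - l) < e.
  move=> i; apply: (@hilbert_complete _ V) => e /uC[N uN]; exists N => m n Nm Nn.
  by apply: le_lt_trans (uN m n Nm Nn); rewrite -l2B; exact: l2norm_coord.
have lim1 m i : (fun n => hnorm (u m i - u n i) ^+ 2) @ \oo --> hnorm (u m i - l i) ^+ 2.
  apply: (@cvg_comp _ _ _ (fun n => hnorm (u m i - u n i)) (fun x => x ^+ 2)); last exact: exprn_continuous.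
  apply/cvgrPdist_lt => e e0; have [N hN] := lP i e e0.
  exists N => // n /= /hN; apply: le_lt_trans.
  apply: le_trans (dotnorm_dist _ _ _) _.
  by rewrite opprB addrC addrA subrK.
have bnd e : 0 < e -> exists N, forall m, (N <= m)%N ->
    fin_bounded (fun i => hnorm (u m i - l i) ^+ 2) (e ^+ 2).
  move=> e0; have [N uN] := uC e e0; exists N => m Nm.
  apply: fin_bounded_limit (lim1 m); exists N => // n /= Nn.
  move=> s us; apply: le_trans (l2norm_fin_bounded (u m - u n) us) _.
  by rewrite ler_pXn2r ?nnegrE ?dotnorm_ge0 ?(ltW e0) // ltW // uN.
have [N hN] := bnd 1 ltr01.
(* The coordinatewise limit is obtained as [u N] minus the square-summable difference [u N - l], so
   that its own square-summability needs no separate estimate. *)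
have ld : (fun i => u N i - l i) \in l2_pred.
  by apply/asboolP; exists (1 ^+ 2); exact: hN.
pose x : l2 := u N - L2 ld.
have xE i : x i = l i by rewrite /x l2B /= subKr.
exists x => e e0; have [K hK] := bnd (e / 2) (divr_gt0 e0 (ltr0n _ 2)).
exists K => n Kn; apply: (@le_lt_trans _ _ (e / 2)); last by lra.
rewrite -(@ler_pXn2r _ 2) ?nnegrE ?dotnorm_ge0 //; last by lra.
apply: l2norm_sqr_le; move=> s us; apply: le_trans (hK n Kn s us).
by apply: ler_sum => i _; rewrite l2B xE.
Qed.

Definition l2hilbert : hilbert R := Hilbert l2dot_complete.

End L2.

(** * Bounded operators *)

Section SupremumNorm.
Variables (R : realType) (X : Type) (f g : X -> R) (D : set X) (sc : R -> X -> X).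
Hypothesis f0 : forall x, 0 <= f x.
Hypothesis g0 : forall x, 0 <= g x.
Hypothesis DE : forall x, D x <-> g x <= 1.

(** [opnorm], [opmxnorm] and [scalar_mxnorm] are all suprema of a homogeneous [f] over the unit ball
    of a homogeneous [g], with [sc t] the scaling by [t >= 0]; their common properties are proved
    here once. *)
Lemma supnorm_le M : D !=set0 -> 0 <= M -> (forall x, f x <= M * g x) ->
  sup [set f x | x in D] <= M.
Proof.
move=> [x0 D0] M0 fM; apply: ge_sup; first by exists (f x0), x0.
by move=> _ [x /DE gx <-]; apply: le_trans (fM x) _; rewrite ler_piMr.
Qed.

Hypothesis scf : forall t x, 0 <= t -> f (sc t x) = t * f x.
Hypothesis scg : forall t x, 0 <= t -> g (sc t x) = t * g x.
Hypothesis fg : exists M, forall x, f x <= M * g x.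

Lemma supnorm_has_ub : has_ubound [set f x | x in D].
Proof.
have [M fM] := fg; exists `|M| => _ [x /DE gx <-]; apply: le_trans (fM x) _.
apply: (@le_trans _ _ (`|M| * g x)); last by rewrite ler_piMr.
by rewrite ler_wpM2r // ler_norm.
Qed.

Lemma supnorm_ub x : f x <= sup [set f x | x in D] * g x.
Proof.
(* A vector with [g x = 0] cannot be normalised, but boundedness already gives [f x <= 0]. *)
have [gx|gx] := eqVneq (g x) 0.
  by have [M /(_ x)] := fg; rewrite gx !mulr0.
have gp : 0 < g x by rewrite lt_neqAle eq_sym gx g0.
rewrite -ler_pdivrMr // mulrC -scf ?invr_ge0 //.
apply: ub_le_sup; first exact: supnorm_has_ub.
by exists (sc (g x)^-1 x) => //; apply/DE; rewrite scg ?invr_ge0 // mulVf.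
Qed.

Lemma supnorm_ge0 : D !=set0 -> 0 <= sup [set f x | x in D].
Proof.
move=> [x Dx]; apply: le_trans (f0 x) _; apply: ub_le_sup; last by exists x.
exact: supnorm_has_ub.
Qed.

End SupremumNorm.

Lemma archi_inv (R : realType) (e : R) : 0 < e -> exists N : nat, N.+1%:R^-1 < e.
Proof.
move=> e0; exists (Num.bound e^-1); rewrite invf_plt ?posrE //.
apply: lt_trans (archi_boundP _) _; first by rewrite invr_ge0 ltW.
by rewrite ltr_nat.
Qed.

Lemma cabs_nat (R : realType) n : cabs (n%:R : R[i]) = n%:R.
Proof. by rewrite -(rmorph_nat (real_complex R)) cabs_real // ler0n. Qed.

Section OperatorTheory.
Variable R : realType.
Implicit Types H K L : hilbert R.

Lemma bopP H K (S T : bop H K) : (forall x, S x = T x) -> S = T.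
Proof. by move=> h; apply/val_inj/funext. Qed.

Lemma bopD H K (T : bop H K) x y : T (x + y) = T x + T y.
Proof. by have := bop_linear T 1 x y; rewrite !scale1r. Qed.

Lemma bop0 H K (T : bop H K) : T 0 = 0.
Proof. by have := bop_linear T (-1) 0 0; rewrite scaler0 addr0 scaleN1r addNr. Qed.

Lemma bopZ H K (T : bop H K) a x : T (a *: x) = a *: T x.
Proof. by have := bop_linear T a x 0; rewrite !addr0 bop0 addr0. Qed.

Lemma bopN H K (T : bop H K) x : T (- x) = - T x.
Proof. by rewrite -scaleN1r bopZ scaleN1r. Qed.

Lemma bopB H K (T : bop H K) x y : T (x - y) = T x - T y.
Proof. by rewrite bopD bopN. Qed.

Lemma bop_sumr H K (T : bop H K) (J : Type) (s : seq J) (P : pred J) F :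
  T (\sum_(j <- s | P j) F j) = \sum_(j <- s | P j) T (F j).
Proof. by elim/big_rec2: _ => [|j y x _ <-]; rewrite ?bop0 ?bopD. Qed.

Lemma bopDl H K (S T : bop H K) x : (S + T) x = S x + T x. Proof. by []. Qed.
Lemma bopZl H K a (T : bop H K) x : (a *: T) x = a *: T x. Proof. by []. Qed.
Lemma bopNl H K (T : bop H K) x : (- T) x = - T x. Proof. by []. Qed.
Lemma bop0l H K x : (0 : bop H K) x = 0. Proof. by []. Qed.

Lemma bop_suml H K (J : Type) (s : seq J) (P : pred J) (F : J -> bop H K) x :
  (\sum_(j <- s | P j) F j) x = \sum_(j <- s | P j) F j x.
Proof. by elim/big_rec2: _ => // j y z _ <-. Qed.

Lemma bcompDl H K L (S S' : bop K L) (T : bop H K) :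
  bcomp (S + S') T = bcomp S T + bcomp S' T.
Proof. exact: bopP. Qed.

Lemma bcompDr H K L (S : bop K L) (T T' : bop H K) :
  bcomp S (T + T') = bcomp S T + bcomp S T'.
Proof. by apply: bopP => x; exact: (bopD S (T x) (T' x)). Qed.

Lemma bcompZl H K L a (S : bop K L) (T : bop H K) :
  bcomp (a *: S) T = a *: bcomp S T.
Proof. exact: bopP. Qed.

Lemma bcompZr H K L a (S : bop K L) (T : bop H K) :
  bcomp S (a *: T) = a *: bcomp S T.
Proof. by apply: bopP => x; exact: (bopZ S a (T x)). Qed.

Lemma bcompA H K L J (S : bop K L) (T : bop H K) (U : bop J H) :
  bcomp S (bcomp T U) = bcomp (bcomp S T) U.
Proof. exact: bopP. Qed.

Lemma bcomp1l H K (T : bop H K) : bcomp (bid K) T = T.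
Proof. exact: bopP. Qed.

Lemma bcomp1r H K (T : bop H K) : bcomp T (bid H) = T.
Proof. exact: bopP. Qed.

Lemma bcomp0l H K L (T : bop H K) : bcomp (0 : bop K L) T = 0.
Proof. exact: bopP. Qed.

Lemma bcomp0r H K L (S : bop K L) : bcomp S (0 : bop H K) = 0.
Proof. by apply: bopP => x; exact: (bop0 S). Qed.

Lemma is_bopP H K (f : H -> K) : linear f ->
  (exists M : R, forall x, hnorm (f x) ^+ 2 <= M * hnorm x ^+ 2) ->
  f \in @bounded_op_pred R H K.
Proof.
move=> lf [M fM]; apply/asboolP; split => //; exists (Num.sqrt `|M|) => x.
rewrite -(@ler_pXn2r _ 2) ?nnegrE ?mulr_ge0 ?dotnorm_ge0 ?sqrtr_ge0 //.
rewrite exprMn (@sqr_sqrtr _ `|M|) //; have := fM x; have := ler_norm M.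
by have := sqr_ge0 (hnorm x); nra.
Qed.

Lemma hnormZ_real H (t : R) (x : H) : 0 <= t -> hnorm (t%:C%C *: x) = t * hnorm x.
Proof. by move=> t0; rewrite dotnormZ cabs_real. Qed.

Lemma opnorm_ub H K (T : bop H K) x : hnorm (T x) <= opnorm T * hnorm x.
Proof.
apply: (@supnorm_ub _ _ (fun x => hnorm (T x)) (fun x : H => hnorm x) _
  (fun t x => t%:C%C *: x)) => //; try by move=> *; exact: dotnorm_ge0.
- by move=> t y t0; rewrite bopZ hnormZ_real.
- by move=> t y t0; rewrite hnormZ_real.
- exact: bop_bounded.
Qed.

Lemma opnorm_le H K (T : bop H K) M : 0 <= M ->
  (forall x, hnorm (T x) <= M * hnorm x) -> opnorm T <= M.
Proof.
move=> M0 TM; apply: (@supnorm_le _ _ (fun x => hnorm (T x)) (fun x : H => hnorm x)) => //.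
by exists 0; rewrite /= dotnorm0.
Qed.

Lemma opnorm_ge0 H K (T : bop H K) : 0 <= opnorm T.
Proof.
apply: (@supnorm_ge0 _ _ (fun x => hnorm (T x)) (fun x : H => hnorm x)) => //;
  try by move=> *; exact: dotnorm_ge0.
- exact: bop_bounded.
- by exists 0; rewrite /= dotnorm0.
Qed.

Definition mxapp H K n (T : 'M[bop H K]_n) (x : 'I_n -> H) (i : 'I_n) : K :=
  \sum_j T i j (x j).

Definition vnorm2 H n (x : 'I_n -> H) : R := \sum_j hnorm (x j) ^+ 2.

Lemma vnorm2_ge0 H n (x : 'I_n -> H) : 0 <= vnorm2 x.
Proof. by apply: sumr_ge0 => i _; exact: sqr_ge0. Qed.

Lemma vnorm2Z H n t (x : 'I_n -> H) : 
  vnorm2 (fun j => t *: x j) = cabs t ^+ 2 * vnorm2 x.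
Proof. by rewrite /vnorm2 mulr_sumr; apply: eq_bigr => i _; rewrite dotnormZ exprMn. Qed.

Lemma mxappZ H K n (T : 'M[bop H K]_n) t x :
  mxapp T (fun j => t *: x j) = fun i => t *: mxapp T x i.
Proof.
by apply/funext => i; rewrite /mxapp scaler_sumr; apply: eq_bigr => j _; rewrite bopZ.
Qed.

Lemma sum_sqr_le (J : Type) (s : seq J) (a : J -> R) : (forall j, 0 <= a j) ->
  \sum_(j <- s) a j ^+ 2 <= (\sum_(j <- s) a j) ^+ 2.
Proof.
move=> a0; elim: s => [|j s IH]; first by rewrite !big_nil expr0n.
have : 0 <= \sum_(j <- s) a j by exact: sumr_ge0.
by rewrite !big_cons; have := a0 j; move: IH; set x := \sum_(_ <- _) _; nra.
Qed.

Lemma mxapp_bounded H K n (T : 'M[bop H K]_n) :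
  exists M, forall x, Num.sqrt (vnorm2 (mxapp T x)) <= M * Num.sqrt (vnorm2 x).
Proof.
pose M := \sum_i \sum_j opnorm (T i j).
have M0 i : 0 <= \sum_j opnorm (T i j) by apply: sumr_ge0 => j _; exact: opnorm_ge0.
have le1 (x : 'I_n -> H) j : hnorm (x j) <= Num.sqrt (vnorm2 x).
  rewrite -[leLHS]ger0_norm ?dotnorm_ge0 // -sqrtr_sqr ler_wsqrtr //.
  by rewrite /vnorm2 (bigD1 j) //= lerDl sumr_ge0 // => i _; exact: sqr_ge0.
exists M => x; set s := Num.sqrt (vnorm2 x).
have le2 i : hnorm (mxapp T x i) <= (\sum_j opnorm (T i j)) * s.
  apply: le_trans (dotnorm_sum _ _ _ _) _; rewrite mulr_suml; apply: ler_sum => j _.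
  by apply: le_trans (opnorm_ub _ _) _; rewrite ler_wpM2l ?opnorm_ge0 ?le1.
have s0 : 0 <= s by exact: sqrtr_ge0.
rewrite -(@ler_pXn2r _ 2) ?nnegrE ?sqrtr_ge0 ?mulr_ge0 ?sumr_ge0 //.
rewrite sqr_sqrtr ?vnorm2_ge0 //.
apply: (@le_trans _ _ (\sum_i ((\sum_j opnorm (T i j)) * s) ^+ 2)).
  apply: ler_sum => i _; rewrite ler_pXn2r ?nnegrE ?dotnorm_ge0 ?mulr_ge0 //.
by rewrite /M mulr_suml; apply: sum_sqr_le => i; rewrite mulr_ge0.
Qed.

Lemma opmx_set0 H n : [set x : 'I_n -> H | \sum_j hnorm (x j) ^+ 2 <= 1] !=set0.
Proof. by exists (fun=> 0); rewrite /= big1 // => i _; rewrite dotnorm0 expr0n. Qed.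

Lemma opmx_set1 H n (x : 'I_n -> H) :
  \sum_j hnorm (x j) ^+ 2 <= 1 <-> Num.sqrt (vnorm2 x) <= 1.
Proof.
suff -> : (Num.sqrt (vnorm2 x) <= 1) = (vnorm2 x <= 1) by [].
by rewrite -[LHS](@ler_pXn2r _ 2) ?nnegrE ?sqrtr_ge0 // sqr_sqrtr ?expr1n ?vnorm2_ge0.
Qed.

Lemma sqrt_vnorm2Z H n t (x : 'I_n -> H) : 0 <= t ->
  Num.sqrt (vnorm2 (fun j => t%:C%C *: x j)) = t * Num.sqrt (vnorm2 x).
Proof. by move=> t0; rewrite vnorm2Z cabs_real // sqrtrM ?sqr_ge0 // sqrtr_sqr ger0_norm. Qed.

Lemma opmxnorm_ge0 H K n (T : 'M[bop H K]_n) : 0 <= opmxnorm T.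
Proof.
apply: (@supnorm_ge0 _ _ (fun x => Num.sqrt (vnorm2 (mxapp T x)))
  (fun x => Num.sqrt (vnorm2 x))).
- by move=> x; exact: sqrtr_ge0.
- by move=> x; exact: sqrtr_ge0.
- by move=> y; refine (opmx_set1 y).
- exact: mxapp_bounded.
- exact: opmx_set0.
Qed.

Lemma opmxnorm_ub H K n (T : 'M[bop H K]_n) x :
  vnorm2 (mxapp T x) <= opmxnorm T ^+ 2 * vnorm2 x.
Proof.
rewrite -[leLHS]sqr_sqrtr ?vnorm2_ge0 // -[X in _ * X]sqr_sqrtr ?vnorm2_ge0 //.
rewrite -exprMn ler_pXn2r ?nnegrE ?mulr_ge0 ?sqrtr_ge0 ?opmxnorm_ge0 //.
apply: (@supnorm_ub _ _ (fun x => Num.sqrt (vnorm2 (mxapp T x)))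
  (fun x => Num.sqrt (vnorm2 x)) _ (fun t x j => t%:C%C *: x j)).
- by move=> y; exact: sqrtr_ge0.
- by move=> y; refine (opmx_set1 y).
- by move=> t y t0; rewrite mxappZ sqrt_vnorm2Z.
- by move=> t y t0; rewrite sqrt_vnorm2Z.
- exact: mxapp_bounded.
Qed.

Lemma opmxnorm_le H K n (T : 'M[bop H K]_n) M : 0 <= M ->
  (forall x, vnorm2 (mxapp T x) <= M ^+ 2 * vnorm2 x) -> opmxnorm T <= M.
Proof.
move=> M0 TM; apply: (@supnorm_le _ _ (fun x => Num.sqrt (vnorm2 (mxapp T x)))
  (fun x => Num.sqrt (vnorm2 x))) => //.
- by move=> y; refine (opmx_set1 y).
- exact: opmx_set0.
- move=> x; rewrite -(@ler_pXn2r _ 2) ?nnegrE ?mulr_ge0 ?sqrtr_ge0 //.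
  by rewrite exprMn !sqr_sqrtr ?vnorm2_ge0.
Qed.

Lemma opmxnorm1_ub H K (T : 'M[bop H K]_1) x : hnorm (T ord0 ord0 x) <= opmxnorm T * hnorm x.
Proof.
rewrite -(@ler_pXn2r _ 2) ?nnegrE ?mulr_ge0 ?dotnorm_ge0 ?opmxnorm_ge0 // exprMn.
by have := opmxnorm_ub T (fun=> x); rewrite /vnorm2 /mxapp !big_ord1.
Qed.

Lemma opmxnorm1_le H K (T : 'M[bop H K]_1) M : 0 <= M ->
  (forall x, hnorm (T ord0 ord0 x) <= M * hnorm x) -> opmxnorm T <= M.
Proof.
move=> M0 TM; apply: opmxnorm_le => // x; rewrite /vnorm2 /mxapp !big_ord1 -exprMn.
by rewrite ler_pXn2r ?nnegrE ?mulr_ge0 ?dotnorm_ge0.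
Qed.

Lemma orthogonal_of_minimal H (u v : H) :
  (forall t : R[i], hnorm u <= hnorm (u + t *: v)) -> hdot H u v = 0.
Proof.
move=> hmin; have [->|v0] := eqVneq v 0; first by rewrite linear0r.
have Nv : 0 < hnorm v ^+ 2 by rewrite -ltcR -dotE dnorm_gt0.
(* The minimiser of [t |-> |u + t v|]; at this value the square of the norm drops by
   [|c|^2 / |v|^2]. *)
pose c := hdot H u v; pose t := - c / (hnorm v ^+ 2)%:C%C.
have Nv0 : (hnorm v ^+ 2)%:C%C != 0 :> R[i] by rewrite -dotE dnorm_eq0.
have : hnorm u ^+ 2 <= hnorm (u + t *: v) ^+ 2.
  by rewrite ler_pXn2r ?nnegrE ?dotnorm_ge0.
have -> : hnorm (u + t *: v) ^+ 2 = hnorm u ^+ 2 - cabs c ^+ 2 / hnorm v ^+ 2.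
  apply: complexI; rewrite -dotE linearDl /= !linearDr /= !dotZl !dotZr !dotE.
  rewrite (dotC _ v u) -/c; have hc := conjCM_cabs c.
  have -> : t^* = - c^* / (hnorm v ^+ 2)%:C%C.
    by rewrite /t -fmorphV rmorphM rmorphN /= conjC_re.
  move: hc Nv0; rewrite /t; move: (cabs c ^+ 2) (hnorm u ^+ 2) (hnorm v ^+ 2) => a b e.
  by rewrite rmorphB fmorph_div /= => <- e0; field.
rewrite lerBrDl gerDr pmulr_lle0 ?invr_gt0 // => h.
by apply/eqP; rewrite -cabs_eq0 -sqrf_eq0 eq_le h sqr_ge0.
Qed.

Lemma parallelogram H (x y : H) :
  hnorm (x - y) ^+ 2 = 2 * (hnorm x ^+ 2 + hnorm y ^+ 2) - hnorm (x + y) ^+ 2.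
Proof.
apply: complexI; move: (dotE (hdot H) x) (dotE (hdot H) y).
move: (dotE (hdot H) (x - y)) (dotE (hdot H) (x + y)).
rewrite linearBl /= !linearBr /= linearDl /= !linearDr /=.
move: (hnorm x ^+ 2) (hnorm y ^+ 2) (hnorm (x - y) ^+ 2) (hnorm (x + y) ^+ 2) => a b c e.
rewrite !(rmorphB, rmorphM, rmorphD, rmorph_nat) /= => <- <- <- <-; ring.
Qed.

Lemma riesz H (f : H -> R[i]) : linear (f : H -> R[i]^o) ->
  (exists M, forall x, cabs (f x) <= M * hnorm x) ->
  exists y, forall x, f x = hdot H x y.
Proof.
move=> lf [M fM].
have f0 : f 0 = 0.
  by have := lf (-1) 0 0; rewrite scaler0 addr0 scaleN1r addNr.
have fD x y : f (x + y) = f x + f y by have := lf 1 x y; rewrite !scale1r.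
have fZ a x : f (a *: x) = a * f x by have := lf a x 0; rewrite !addr0 f0 addr0.
have fB x y : f (x - y) = f x - f y by rewrite fD -scaleN1r fZ mulN1r.
have [[z fz]|] := pselect (exists z, f z != 0); last first.
  move=> h; exists 0 => x; rewrite linear0r; apply/eqP/negPn/negP => fx.
  by apply: h; exists x.
(* The element of least norm in the affine hyperplane [f = 1] is orthogonal to the kernel of [f],
   hence represents [f] up to a scalar. *)
pose E := [set x | f x = 1]; pose S := [set hnorm x ^+ 2 | x in E].
have E0 : E ((f z)^-1 *: z) by rewrite /E /= fZ mulVf.
have hS : has_inf S.
  by split; [exists (hnorm ((f z)^-1 *: z) ^+ 2), ((f z)^-1 *: z)|exists 0 => _ [x _ <-]; exact: sqr_ge0].
have infE x : E x -> inf S <= hnorm x ^+ 2.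
  by move=> Ex; apply: ge_inf; [exact: hS.2|exists x].
have /choice[u uP] : forall n : nat, exists x, E x /\ hnorm x ^+ 2 < inf S + n.+1%:R^-1.
  move=> n; have n0 : 0 < n.+1%:R^-1 :> R by rewrite invr_gt0.
  by have [_ [x Ex <-] h] := inf_adherent n0 hS; exists x.
(* The midpoint stays in [E], so the parallelogram law makes every minimising sequence Cauchy. *)
have mid x y : E x -> E y -> hnorm (x - y) ^+ 2 <= 2 * (hnorm x ^+ 2 + hnorm y ^+ 2) - 4 * inf S.
  move=> Ex Ey; have : E (2^-1 *: (x + y)).
    by rewrite /E /= fZ fD Ex Ey -[1 + 1]/(2%:R) mulVf.
  move=> /infE; rewrite parallelogram dotnormZ cabsV cabs_nat.
  by rewrite exprMn; lra.
have [e e0|x xP] := @hilbert_complete _ H u.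
  have e4 : 0 < e ^+ 2 / 4 by rewrite divr_gt0 ?exprn_gt0.
  have [N hN] := archi_inv e4; exists N => m n Nm Nn.
  rewrite -(@ltr_pXn2r _ 2) ?nnegrE ?dotnorm_ge0 ?(ltW e0) //.
  apply: le_lt_trans (mid _ _ (uP m).1 (uP n).1) _.
  have le k : (N <= k)%N -> k.+1%:R^-1 <= N.+1%:R^-1 :> R.
    by move=> Nk; rewrite lef_pV2 ?posrE // ler_nat.
  have := le _ Nm; have := le _ Nn; have := (uP m).2; have := (uP n).2; move: hN.
  move: (e ^+ 2) (hnorm (u m) ^+ 2) (hnorm (u n) ^+ 2) (inf S) => e2 a b c.
  by move: (m.+1%:R^-1) (n.+1%:R^-1) (N.+1%:R^-1) => /= p q r; lra.
have Ex : E x.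
  rewrite /E /=; apply/eqP; rewrite -subr_eq0 -cabs_eq0 eq_le cabs_ge0 andbT.
  apply/ler_addgt0Pr => e e0; rewrite add0r.
  have M0 : 0 < `|M| + 1 by rewrite ltr_wpDl.
  have [N hN] := xP (e / (`|M| + 1)) (divr_gt0 e0 M0).
  have {hN} := hN N (leqnn N); rewrite ltr_pdivlMr // => hN.
  rewrite -(uP N).1 -fB; apply: le_trans (fM _) _; rewrite -dotnormB.
  have := dotnorm_ge0 (hdot H) (u N - x); have := ler_norm M; nra.
have xmin : hnorm x ^+ 2 <= inf S.
  apply/ler_addgt0Pr => e e0.
  have S0 : 0 <= inf S by apply: lb_le_inf hS.1 _ => _ [y _ <-]; exact: sqr_ge0.
  (* If [b] is the norm of a late [u n], then [b^2 < inf S + 1] and [2 b <= 1 + b^2], so replacing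
     [b] by [b + dl] with [dl <= 1] raises the square by at most [dl * (inf S + 3) <= e / 2]. *)
  pose dl := Num.min 1 (e / (2 * (inf S + 3))).
  have c0 : 0 < 2 * (inf S + 3) by lra.
  have d0 : 0 < dl by rewrite lt_min ltr01 divr_gt0.
  have d1 : dl <= 1 by rewrite ge_min lexx.
  have d2 : dl * (2 * (inf S + 3)) <= e by rewrite -ler_pdivlMr // ge_min lexx orbT.
  have [N1 h1] := xP dl d0; have [N2 h2] := archi_inv (divr_gt0 e0 (ltr0n _ 2)).
  have {}h1 := h1 _ (leq_maxl N1 N2); have [_ h3] := uP (maxn N1 N2).
  have h4 : (maxn N1 N2).+1%:R^-1 <= N2.+1%:R^-1 :> R.
    by rewrite lef_pV2 ?posrE // ler_nat ltnS leq_maxr.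
  have h5 : N2.+1%:R^-1 <= 1 :> R by rewrite invf_le1 ?ler1n.
  have := ler_dotnormB (hdot H) x (u (maxn N1 N2)); rewrite dotnormB => h6.
  have := dotnorm_ge0 (hdot H) x; move: h1 h2 h3 h4 h5 h6 => /=.
  set a := hnorm x; set b := hnorm (u _); set c := hnorm (_ - _).
  move=> h1 h2 h3 h4 h5 h6 a0.
  have : a ^+ 2 <= (b + dl) ^+ 2 by rewrite ler_pXn2r ?nnegrE //; lra.
  move: d0 d1 d2 h2 h3 h4 h5; clearbody dl a b c; clear.
  move: (N2.+1%:R^-1) ((maxn N1 N2).+1%:R^-1) (inf S) => p r J d0 d1 d2 h2 h3 h4 h5 h.
  have k1 : 0 <= dl * (J + 2 - 2 * b).
    by apply: mulr_ge0; [exact: ltW|have := sqr_ge0 (b - 1); lra].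
  have k2 : 0 <= dl * (1 - dl) by apply: mulr_ge0; [exact: ltW|lra].
  by move: e d2 h2 => e /= d2 h2; nra.
have xE y : E y -> hnorm x <= hnorm y.
  move=> /infE h; rewrite -(@ler_pXn2r _ 2) ?nnegrE ?dotnorm_ge0 //.
  exact: le_trans xmin h.
have ort h : f h = 0 -> hdot H x h = 0.
  move=> fh; apply: orthogonal_of_minimal => t; apply: xE.
  by rewrite /E /= fD fZ fh mulr0 addr0.
have x0 : hdot H x x != 0.
  by rewrite dnorm_eq0; apply/eqP => x0; move: Ex; rewrite /E /= x0 f0 => /eqP; rewrite eq_sym oner_eq0.
exists ((hdot H x x)^-1^* *: x) => y.
rewrite dotZr conjCK; have : f (y - f y *: x) = 0 by rewrite fB fZ Ex mulr1 subrr.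
move=> /ort /eqP; rewrite dotC conjC_eq0 linearBl /= dotZl subr_eq0 => /eqP ->.
by rewrite mulrC mulfK.
Qed.

Lemma dot_injr H (x y : H) : (forall z, hdot H z x = hdot H z y) -> x = y.
Proof. by move=> h; apply: (@dot_inj _ _ (hdot H)) => z; rewrite dotC h -dotC. Qed.

Lemma adjoint_exists H K (T : bop H K) : exists S, is_adjoint T S.
Proof.
have [M TM] := bop_bounded T.
have /choice[S SP] : forall y, exists z, forall x, hdot K (T x) y = hdot H x z.
  move=> y; apply: riesz.
    by move=> a u v /=; rewrite bopD bopZ linearDl /= dotZl.
  exists (M * hnorm y) => x; apply: le_trans (dot_CS _ _ _) _.
  by rewrite mulrAC ler_wpM2r ?dotnorm_ge0.
have Slin : linear S.
  move=> a u v; apply: dot_injr => x.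
  by rewrite linearDr /= dotZr -!SP linearDr /= dotZr.
have Sb : S \in @bounded_op_pred R K H.
  apply/asboolP; split => //; exists `|M| => y.
  have [->|Sy] := eqVneq (S y) 0; first by rewrite dotnorm0 mulr_ge0 ?dotnorm_ge0.
  have Sy0 : 0 < hnorm (S y).
    rewrite lt_neqAle dotnorm_ge0 andbT eq_sym; apply: contra_neq Sy => h.
    exact: (@dotnorm_eq0 _ _ (hdot H)).
  rewrite -(ler_pM2r Sy0) -expr2 -[leLHS]cabs_real ?sqr_ge0 // -dotE -SP.
  apply: le_trans (dot_CS _ _ _) _.
  rewrite [leRHS]mulrAC ler_wpM2r ?dotnorm_ge0 //; apply: le_trans (TM _) _.
  by rewrite ler_wpM2r ?dotnorm_ge0 ?ler_norm.
by exists (Bop Sb) => x y; rewrite SP.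
Qed.

Lemma is_adjoint_sym H K (T : bop H K) S : is_adjoint T S -> is_adjoint S T.
Proof. by move=> h x y; rewrite dotC -h -dotC. Qed.

Lemma adjoint_unique H K (T : bop H K) S S' :
  is_adjoint T S -> is_adjoint T S' -> S = S'.
Proof. by move=> h h'; apply: bopP => y; apply: dot_injr => x; rewrite -h -h'. Qed.

Lemma adjoint_inj H K (T T' : bop H K) S :
  is_adjoint T S -> is_adjoint T' S -> T = T'.
Proof. by move=> /is_adjoint_sym h /is_adjoint_sym; exact: adjoint_unique. Qed.

Lemma is_adjoint_comp H K L (S : bop K L) S' (T : bop H K) T' :
  is_adjoint S S' -> is_adjoint T T' -> is_adjoint (bcomp S T) (bcomp T' S').
Proof. by move=> hS hT x y /=; rewrite hS hT. Qed.

Lemma is_adjointZ H K a (T : bop H K) T' :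
  is_adjoint T T' -> is_adjoint (a *: T) (a^* *: T').
Proof. by move=> hT x y /=; rewrite dotZl hT dotZr conjCK. Qed.

Lemma is_adjoint0 H K : is_adjoint (0 : bop H K) 0.
Proof. by move=> x y; rewrite !bop0l linear0l linear0r. Qed.

Lemma is_adjoint_eq0 H K (T : bop H K) S : is_adjoint T S -> (T == 0) = (S == 0).
Proof.
move=> h; apply/eqP/eqP => h0; rewrite h0 in h.
  exact: adjoint_unique h (@is_adjoint0 _ _).
exact: adjoint_inj h (@is_adjoint0 _ _).
Qed.

Lemma adjoint_mul_eq0 H K (T : bop H K) S : is_adjoint T S -> bcomp S T = 0 -> T = 0.
Proof.
move=> h ST; apply: bopP => x; apply/(@dotnorm_eq0 _ _ (hdot K))/eqP.
rewrite -sqrf_eq0 -(inj_eq (@complexI R)) -dotE h.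
by rewrite -[S (T x)]/(bcomp S T x) ST linear0r.
Qed.

(** [P] maps every vector [P x + t (y - P y)] to [P x] and does not increase norms, so [P x] has
    least norm on this line and is orthogonal to [y - P y]: range and kernel are orthogonal. This
    stands in for preservation of adjoints, since an isometric homomorphism sends contractive
    idempotents to contractive idempotents. *)
Lemma contractive_idempotent H (P : bop H H) : bcomp P P = P ->
  (forall x, hnorm (P x) <= hnorm x) -> is_adjoint P P.
Proof.
move=> PP P1; have PPx x : P (P x) = P x by rewrite -[RHS](congr1 (fun T : bop H H => T x) PP).
have ort x y : hdot H (P x) (y - P y) = 0.
  apply: orthogonal_of_minimal => t; apply: le_trans (P1 _).
  by rewrite bopD bopZ bopB !PPx subrr scaler0 addr0.
move=> x y; have := ort x y; rewrite linearBr /= => /eqP; rewrite subr_eq0 => /eqP ->.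
have := ort y x; rewrite linearBr /= => /eqP; rewrite subr_eq0 => /eqP h.
by rewrite dotC -h -dotC.
Qed.

Definition rank1 H K (a : K) (b : H) (x : H) : K := hdot H x b *: a.

Lemma rank1_subproof H K (a : K) (b : H) : rank1 a b \in @bounded_op_pred R H K.
Proof.
apply/asboolP; split.
  by move=> t u v; rewrite /rank1 linearDl /= dotZl scalerDl scalerA.
exists (hnorm b * hnorm a) => x; rewrite /rank1 dotnormZ mulrAC.
by rewrite ler_wpM2r ?dotnorm_ge0 // mulrC dot_CS.
Qed.

Definition brank1 H K (a : K) (b : H) : bop H K := Bop (rank1_subproof a b).

End OperatorTheory.

(** * Normal functionals *)

Section PointwiseInitial.
Variables (S : choiceType) (I : Type) (C X : topologicalType) (f : S -> I -> C).
Local Notation W := (initial_topology (f : S -> {ptws I -> C})).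

(** Both w*-topologies have the shape [W]: [wstar] with the normal pairings as evaluations,
    [uda_wstar] with the pairings against the predual. *)
Lemma initial_eval_continuous i : continuous (fun x : W => f x i).
Proof.
move=> x; apply: (@continuous_comp _ _ _ (f : W -> {ptws I -> C}) (fun g => g i)).
  exact: initial_continuous.
exact: (@proj_continuous {classic I} (fun=> C) i).
Qed.

Lemma continuous_to_initial (g : X -> W) :
  (forall i, continuous (fun x => f (g x) i)) -> continuous g.
Proof.
move=> h; apply: continuous_comp_initial => x.
apply/cvg_sup => i A [_ [[B oB <-] Bfx] sBA].
by apply: filterS sBA _; apply: (h i x); exact: open_nbhs_nbhs.
Qed.

End PointwiseInitial.

Section NormalFunctionals.
Variable R : realType.
Implicit Types H K : hilbert R.

Lemma csum_cvgn (g : nat -> R[i]) c : is_csum g c ->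
  (series g : nat -> Cplx R) @ \oo --> (c : Cplx R).
Proof.
move=> gc; apply/cvgrPdist_lt => e e0.
(* Radii in [Cplx R] are complex numbers; positivity makes [e] equal to its real part. *)
have e0' : 0 < complex.Re e by move: e0; rewrite ltcE => /andP[].
have [s us hs] := gc _ e0'.
exists (\max_(i <- s) i).+1 => // n /= sn.
rewrite distrC cabsE.
have -> : e = (complex.Re e)%:C%C.
  by move: e0; rewrite ltcE => /andP[/eqP + _]; case: (e) => a b /= ->.
rewrite ltcR; apply: hs; first exact: iota_uniq.
move=> i is_; rewrite mem_index_iota /=; apply: leq_ltn_trans sn.
by rewrite (leq_bigmax_seq (F := id)).
Qed.

Lemma Cplx_hausdorff : hausdorff_space (Cplx R).
Proof. exact: norm_hausdorff. Qed.

Lemma sqsum_bounded H (x : sqsum H) :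
  exists M, fin_bounded (fun k => hnorm (sval x k) ^+ 2) M.
Proof.
case: x => x xc /=; exists (limn (series (fun k => hnorm (x k) ^+ 2))) => s us.
pose n := (\max_(i <- s) i).+1.
apply: (@le_trans _ _ (series (fun k => hnorm (x k) ^+ 2) n)); last first.
  apply: nondecreasing_cvgn_le => //; apply: nondecreasing_series => k _ _.
  exact: sqr_ge0.
rewrite /series /= (sum_seq_split _ us (iota_uniq _ _)).
  by rewrite lerDl sumr_ge0 // => i _; exact: sqr_ge0.
move=> i is_; rewrite mem_iota subn0 ltnS.
by rewrite (leq_bigmax_seq (F := id)).
Qed.

Lemma sqsum_of_bounded H (x : nat -> H) M :
  fin_bounded (fun k => hnorm (x k) ^+ 2) M ->
  cvgn (series (fun k => hnorm (x k) ^+ 2)).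
Proof.
move=> xM; apply: nondecreasing_is_cvgn.
  by apply: nondecreasing_series => k _ _; exact: sqr_ge0.
by exists M => _ [n _ <-]; exact: (xM _ (iota_uniq _ _)).
Qed.

Lemma pairing_summable H K (T : bop H K) (x : sqsum H) (y : sqsum K) :
  abs_summable (fun k => hdot K (T (sval x k)) (sval y k)).
Proof.
have [M xM] := sqsum_bounded x; have [N yN] := sqsum_bounded y.
have [B TB] := bop_bounded T.
have h1 := fin_boundedD (fin_boundedZ (sqr_ge0 B) xM) yN.
apply: abs_summableW h1 => k; apply: le_trans (dot_CS _ _ _) _.
have : hnorm (T (sval x k)) ^+ 2 <= B ^+ 2 * hnorm (sval x k) ^+ 2.
  rewrite -exprMn ler_pXn2r ?nnegrE ?dotnorm_ge0 //.
  exact: le_trans (dotnorm_ge0 _ _) (TB _).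
have := sqr_ge0 (hnorm (T (sval x k)) - hnorm (sval y k)).
have := sqr_ge0 (hnorm (T (sval x k)) + hnorm (sval y k)); nra.
Qed.

Lemma normal_pairingE H K (T : bop H K) (xy : sqsum H * sqsum K) :
  normal_pairing T xy = csum (fun k => hdot K (T (sval xy.1 k)) (sval xy.2 k)).
Proof.
apply: cvg_lim; first exact: Cplx_hausdorff.
exact/csum_cvgn/csumP/pairing_summable.
Qed.

Lemma sqsum1_subproof H (x : H) :
  cvgn (series (fun k : nat => hnorm (if k == 0%N then x else 0) ^+ 2)).
Proof.
apply: (@sqsum_of_bounded _ (fun k => if k == 0%N then x else 0) (hnorm x ^+ 2)) => s us.
case: (boolP (0%N \in s)) => s0.
  rewrite (bigD1_seq 0%N) //= big1 ?addr0 // => i /negPf ->.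
  by rewrite dotnorm0 expr0n.
rewrite big_seq big1 ?sqr_ge0 // => i is_; case: eqP => [i0|]; last by rewrite dotnorm0 expr0n.
by rewrite -i0 is_ in s0.
Qed.

Definition sqsum1 H (x : H) : sqsum H :=
  exist _ (fun k : nat => if k == 0%N then x else 0) (@sqsum1_subproof H x).

(** Vector functionals are the normal functionals with a single nonzero term. They suffice to cut
    out all the w*-closed spaces that are computed explicitly. *)
Lemma normal_pairing1 H K (T : bop H K) (x : H) (y : K) :
  normal_pairing T (sqsum1 x, sqsum1 y) = hdot K (T x) y.
Proof.
rewrite normal_pairingE; apply: csumE => /=.
have -> : hdot K (T x) y = \sum_(k <- [:: 0%N])
    hdot K (T (if k == 0%N then x else 0)) (if k == 0%N then y else 0).
  by rewrite big_seq1.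
apply: is_csum_fin => // k; rewrite inE => /negPf ->.
by rewrite linear0r.
Qed.

(** The zero set of a vector functional is a w*-closed subspace. Information about the elements of a
    w*-closed span is always extracted in this way. *)
Lemma wspan_dot0 H K (M : set (bop H K)) (x : H) (y : K) T :
  (forall S, M S -> hdot K (S x) y = 0) -> wspan M T -> hdot K (T x) y = 0.
Proof.
move=> h MT; rewrite -normal_pairing1.
pose F := fun S : wstar H K => normal_pairing S (sqsum1 x, sqsum1 y) : Cplx R.
have cF : continuous F by exact: initial_eval_continuous.
have clF : closed (F @^-1` [set 0]).
  apply: closed_comp => [S _|]; first exact: cF.
  exact/accessible_closed_set1/hausdorff_accessible/Cplx_hausdorff.
suff sub : (lin_span M : set (wstar H K)) `<=` F @^-1` [set 0].
  by have := closure_subset sub MT; rewrite -((closure_id _).1 clF).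
move=> _ [n [a [s [Ms ->]]]]; rewrite /F /= normal_pairing1 bop_suml linear_sumlz.
by rewrite big1 // => k _; rewrite bopZl /= dotZl h // mulr0.
Qed.

Lemma sub_lin_span H K (M : set (bop H K)) : M `<=` lin_span M.
Proof.
move=> T MT; exists 1%N, (fun=> 1), (fun=> T); split => //.
by rewrite big_ord1 scale1r.
Qed.

Lemma sub_wspan H K (M : set (bop H K)) : M `<=` wspan M.
Proof. by move=> T /sub_lin_span h; apply: subset_closure. Qed.

Lemma wspan_of_dot0 H K (M : set (bop H K)) (P : set (H * K)) :
  M = [set T | forall p, P p -> hdot K (T p.1) p.2 = 0] -> wspan M = M.
Proof.
move=> ME; rewrite eqEsubset; split; last exact: sub_wspan.
move=> T MT; rewrite ME => -[x y] Pxy /=; apply: wspan_dot0 MT => S.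
by rewrite {1}ME => /(_ _ Pxy).
Qed.

Lemma closed_of_dot0 H K (M : set (bop H K)) (P : set (H * K)) :
  M = [set T | forall p, P p -> hdot K (T p.1) p.2 = 0] ->
  closed (M : set (wstar H K)).
Proof.
move=> /wspan_of_dot0 h T MT; rewrite -h.
by apply: closure_subset MT; exact: sub_lin_span.
Qed.

End NormalFunctionals.

(** * The algebra of a disjoint union of two-element chains *)

Section L2Single.
Variables (R : realType) (I : eqType) (V : hilbert R).

Definition single_fun (a : I) (v : V) (i : I) : V := if i == a then v else 0.

Lemma single_subproof a v : single_fun a v \in @l2_pred R I V.
Proof.
apply/asboolP; exists (hnorm v ^+ 2) => s us; rewrite /single_fun.
have [sa|sa] := boolP (a \in s).
  rewrite (bigD1_seq a) //= eqxx big1 ?addr0 // => i /negPf ->.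
  by rewrite dotnorm0 expr0n.
rewrite big_seq big1 ?sqr_ge0 // => i is_; case: eqP => [ia|]; last by rewrite dotnorm0 expr0n.
by rewrite -ia is_ in sa.
Qed.

Definition l2single a v : l2hilbert I V := L2 (single_subproof a v).

Lemma l2singleE a v i : l2_val (l2single a v) i = if i == a then v else 0.
Proof. by []. Qed.

Lemma l2single_dotr (x : l2hilbert I V) a v :
  hdot _ x (l2single a v) = hdot V (l2_val x a) v.
Proof.
apply: csumE.
have -> : hdot V (l2_val x a) v =
    \sum_(i <- [:: a]) hdot V (l2_val x i) (single_fun a v i).
  by rewrite big_seq1 /single_fun eqxx.
apply: is_csum_fin => // i; rewrite inE => /negPf ia.
by rewrite l2singleE ia linear0r.
Qed.

Lemma l2single_norm a v : hnorm (l2single a v) = hnorm v.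
Proof.
apply/eqP; rewrite -(@eqrXn2 _ 2) ?dotnorm_ge0 // !dotnorm_sqr.
by rewrite l2single_dotr l2singleE eqxx.
Qed.

End L2Single.

Section SequenceSpace.
Variable R : realType.

Definition ell2 : hilbert R := @l2hilbert R nat (chilbert R).
Definition ecoord (x : ell2) (i : nat) : R[i] := l2_val x i.
Definition be (k : nat) : ell2 := @l2single R nat (chilbert R) k (1 : R[i]).

Lemma ecoordD x y i : ecoord (x + y) i = ecoord x i + ecoord y i. Proof. by []. Qed.
Lemma ecoordZ a x i : ecoord (a *: x) i = a * ecoord x i. Proof. by []. Qed.
Lemma ecoord0 i : ecoord 0 i = 0. Proof. by []. Qed.

Lemma ecoord_sum (J : Type) (s : seq J) (P : pred J) (F : J -> ell2) i :
  ecoord (\sum_(j <- s | P j) F j) i = \sum_(j <- s | P j) ecoord (F j) i.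
Proof. by rewrite /ecoord l2_sum. Qed.

Lemma ecoord_inj x y : (forall i, ecoord x i = ecoord y i) -> x = y.
Proof. exact: (@l2ext R nat (chilbert R) x y). Qed.

Lemma ecoord_be k i : ecoord (be k) i = (i == k)%:R.
Proof. by rewrite /ecoord l2singleE; case: eqP. Qed.

Lemma ecoordE x i : ecoord x i = hdot _ x (be i).
Proof. by rewrite l2single_dotr /= /cdot /= rmorph1 mulr1. Qed.

Lemma be_norm k : hnorm (be k) = 1.
Proof. by rewrite l2single_norm chnormE cabs1. Qed.

Lemma ecoord_norm x i : cabs (ecoord x i) <= hnorm x.
Proof. by have := l2norm_coord x i; rewrite chnormE. Qed.

Lemma ecoord_fin_bounded x : fin_bounded (fun i => cabs (ecoord x i) ^+ 2) (hnorm x ^+ 2).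
Proof. by have := l2norm_fin_bounded x; under eq_fun do rewrite chnormE. Qed.

Lemma ecoord_norm_le x M : fin_bounded (fun i => cabs (ecoord x i) ^+ 2) M ->
  hnorm x ^+ 2 <= M.
Proof.
by move=> h; apply: l2norm_sqr_le; under eq_fun do rewrite chnormE.
Qed.

Lemma ell2_dotE x y : is_csum (fun i => ecoord x i * (ecoord y i)^*) (hdot _ x y).
Proof. exact: (@l2dotP R nat (chilbert R) x y). Qed.

Lemma bop_of_coords (K : hilbert R) (F : K -> nat -> R[i]) (M : R) :
  (forall i a u v, F (a *: u + v) i = a * F u i + F v i) ->
  (forall x, fin_bounded (fun i => cabs (F x i) ^+ 2) (M * hnorm x ^+ 2)) ->
  exists T : bop K ell2, forall x i, ecoord (T x) i = F x i.
Proof.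
move=> Flin FM.
have Fl2 x : (F x : nat -> chilbert R) \in @l2_pred R nat (chilbert R).
  apply/asboolP; exists (M * hnorm x ^+ 2).
  by under eq_fun do rewrite chnormE; exact: FM.
pose f x : ell2 := L2 (Fl2 x).
have fb : f \in @bounded_op_pred R K ell2.
  apply: is_bopP; first by move=> a u v; apply: ecoord_inj => i; rewrite ecoordD ecoordZ; exact: Flin.
  by exists M => x; apply: ecoord_norm_le; exact: FM.
by exists (Bop fb).
Qed.

Definition ecoef (T : bop ell2 ell2) (i j : nat) : R[i] := ecoord (T (be j)) i.

Lemma ecoefD S T i j : ecoef (S + T) i j = ecoef S i j + ecoef T i j. Proof. by []. Qed.
Lemma ecoefZ a T i j : ecoef (a *: T) i j = a * ecoef T i j. Proof. by []. Qed.
Lemma ecoef0 i j : ecoef 0 i j = 0. Proof. by []. Qed.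

Lemma ecoefE T i j : ecoef T i j = hdot _ (T (be j)) (be i).
Proof. exact: ecoordE. Qed.

Lemma coef_adjoint T S i j : is_adjoint T S -> ecoef S i j = (ecoef T j i)^*.
Proof. by move=> /is_adjoint_sym h; rewrite !ecoefE h -dotC. Qed.

Lemma coef_le T i j : cabs (ecoef T i j) <= opnorm T.
Proof.
apply: le_trans (ecoord_norm _ _) _; apply: le_trans (opnorm_ub _ _) _.
by rewrite be_norm mulr1.
Qed.

Lemma coef_id i j : ecoef (bid _) i j = (i == j)%:R.
Proof. by rewrite /ecoef ecoord_be. Qed.

(** Adjoints replace a density argument: the [i]-th coordinate of [T x] is [<x, T* e_i>], and the
    coordinates of [T* e_i] are conjugates of coefficients of [T]. *)
Lemma coef_inj S T : (forall i j, ecoef S i j = ecoef T i j) -> S = T.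
Proof.
move=> h; have [S' hS] := adjoint_exists S; have [T' hT] := adjoint_exists T.
have ST i : S' (be i) = T' (be i).
  by apply: ecoord_inj => j; rewrite -![ecoord _ _]/(ecoef _ _ _) (coef_adjoint _ _ hS) (coef_adjoint _ _ hT) h.
by apply: bopP => x; apply: ecoord_inj => i; rewrite !ecoordE hS hT ST.
Qed.

Lemma ecoord_row2 T i j x : (forall k, k != i -> k != j -> ecoef T i k = 0) -> i != j ->
  ecoord (T x) i = ecoef T i i * ecoord x i + ecoef T i j * ecoord x j.
Proof.
move=> h ij; have [S hS] := adjoint_exists T.
have -> : ecoef T i j * ecoord x j = hdot _ x ((ecoef T i j)^* *: be j).
  by rewrite dotZr conjCK -ecoordE.
rewrite ecoordE hS ecoordE -[in ecoef T i i](conjCK (ecoef T i i)) -dotZr -linearDr /=.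
congr (l2dot _ _); apply: ecoord_inj => k.
rewrite -[ecoord _ _]/(ecoef _ _ _) (coef_adjoint _ _ hS) ecoordD !ecoordZ !ecoord_be.
have [->|ki] := eqVneq k i; first by rewrite (negPf ij) mulr1 mulr0 addr0.
have [->|kj] := eqVneq k j; first by rewrite mulr0 mulr1 add0r.
by rewrite h // conjC0 !mulr0 addr0.
Qed.

(* The order relation of the direct sum of copies of the two-element chain: *)
(* [i] and [i.+1] form a chain when [i] has parity [b].                     *)
Definition chain2 (b : bool) (i j : nat) := (i == j) || ((j == i.+1) && (odd i == b)).

Lemma chain2_refl b i : chain2 b i i. Proof. by rewrite /chain2 eqxx. Qed.

Lemma chain2_antisym b i j : chain2 b i j -> chain2 b j i -> i = j.
Proof.
case/orP => [/eqP //|/andP[/eqP -> _]] /orP[/eqP //|/andP[]].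
by rewrite -[X in X == _]addn0 -[X in _ == X]addn2 eqn_add2l.
Qed.

Lemma chain2S b i : chain2 b i i.+1 = (odd i == b).
Proof. by rewrite /chain2 eqxx; case: eqP => // /n_Sn. Qed.

(** Two strict steps never compose, because consecutive indices have opposite parity. *)
Lemma chain2_trans b i k j : chain2 b i k -> chain2 b k j -> chain2 b i j.
Proof.
case/orP => [/eqP -> //|/andP[/eqP -> /eqP ob]] /orP[/eqP <-|/andP[_]].
  by rewrite chain2S ob.
by rewrite /= ob; case: b {ob}.
Qed.

(** For [b = false] the chains are [{0,1}], [{2,3}], ..., which gives A. For [b = true] they are
    [{1,2}], [{3,4}], ... and 0 is isolated, which gives B. *)
Definition pattern (b : bool) : {pred bop ell2 ell2} :=
  fun T => `[< forall i j, ~~ chain2 b i j -> ecoef T i j = 0 >].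

Lemma pattern_submod_closed b : submod_closed (pattern b).
Proof.
split; first by apply/asboolP => i j _; rewrite ecoef0.
move=> a S T /asboolP hS /asboolP hT; apply/asboolP => i j ij.
by rewrite ecoefD ecoefZ hS // hT // mulr0 addr0.
Qed.

HB.instance Definition _ b :=
  GRing.isSubmodClosed.Build R[i] (bop ell2 ell2) (pattern b)
    (pattern_submod_closed b).

Lemma pattern_id b : bid ell2 \in pattern b.
Proof.
apply/asboolP => i j; rewrite coef_id; case: eqP => // ->.
by rewrite chain2_refl.
Qed.

Lemma pattern_coord b T i x : T \in pattern b ->
  ecoord (T x) i = ecoef T i i * ecoord x i + ecoef T i i.+1 * ecoord x i.+1.
Proof.
move=> /asboolP hT; apply: ecoord_row2; last by rewrite neq_ltn ltnSn.
move=> k ki kSi; apply: hT; rewrite /chain2 eq_sym (negPf ki) /=.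
by rewrite (negPf kSi).
Qed.

Lemma pattern_comp b S T : S \in pattern b -> T \in pattern b -> bcomp S T \in pattern b.
Proof.
move=> hS hT; apply/asboolP => i j ij.
rewrite /ecoef /= (pattern_coord _ _ hS) -![ecoord (T _) _]/(ecoef _ _ _).
move: hS hT => /asboolP hS /asboolP hT; rewrite hT // mulr0 add0r.
have [Si|Si] := boolP (chain2 b i i.+1); last by rewrite hS // mul0r.
have [Sj|Sj] := boolP (chain2 b i.+1 j); last by rewrite hT // mulr0.
by rewrite (chain2_trans Si Sj) in ij.
Qed.

Record palg (b : bool) := Palg {
  palg_op :> bop ell2 ell2;
  palg_opP : palg_op \in pattern b }.

End SequenceSpace.

HB.instance Definition _ R b := [isSub for @palg_op R b].
HB.instance Definition _ R b := [Choice of palg R b by <:].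
HB.instance Definition _ R b := [SubChoice_isSubLmodule of palg R b by <:].

Section PatternAlgebra.
Variables (R : realType) (b : bool).
Local Notation A := (palg R b).
Implicit Types S T : A.

Lemma palgP S T : palg_op S = palg_op T -> S = T. Proof. exact: val_inj. Qed.

Definition palg_one : A := Palg (pattern_id R b).
Definition palg_mul S T : A := Palg (pattern_comp (palg_opP S) (palg_opP T)).

Lemma palg_mulA : associative palg_mul.
Proof. by move=> S T U; apply: palgP; exact: bcompA. Qed.
Lemma palg_mul1l : left_id palg_one palg_mul.
Proof. by move=> S; apply: palgP; exact: bcomp1l. Qed.
Lemma palg_mul1r : right_id palg_one palg_mul.
Proof. by move=> S; apply: palgP; exact: bcomp1r. Qed.
Lemma palg_mulDl : left_distributive palg_mul +%R.
Proof. by move=> S T U; apply: palgP; exact: bcompDl. Qed.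
Lemma palg_mulDr : right_distributive palg_mul +%R.
Proof. by move=> S T U; apply: palgP; exact: bcompDr. Qed.
Lemma palg_one_neq0 : palg_one != 0.
Proof.
apply/eqP => h; have := congr1 (fun T : A => ecoef T 0 0) h.
by rewrite coef_id ecoef0 => /eqP; rewrite oner_eq0.
Qed.

HB.instance Definition _ := GRing.Zmodule_isNzRing.Build A
  palg_mulA palg_mul1l palg_mul1r palg_mulDl palg_mulDr palg_one_neq0.

Lemma palg_scaleAl a S T : a *: (S * T) = (a *: S) * T.
Proof. by apply: palgP; symmetry; exact: bcompZl. Qed.

HB.instance Definition _ := GRing.Lmodule_isLalgebra.Build R[i] A palg_scaleAl.

Lemma palg_scaleAr a S T : a *: (S * T) = S * (a *: T).
Proof. by apply: palgP; symmetry; exact: bcompZr. Qed.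

HB.instance Definition _ := GRing.Lalgebra_isAlgebra.Build R[i] A palg_scaleAr.

Lemma palg_opM S T : palg_op (S * T) = bcomp S T. Proof. by []. Qed.
Lemma palg_op_linear : linear (@palg_op R b). Proof. by []. Qed.

HB.instance Definition _ := GRing.isLinear.Build R[i] A (bop (ell2 R) (ell2 R)) _
  (@palg_op R b) palg_op_linear.

Lemma palg_coef0 T i j : ~~ chain2 b i j -> ecoef T i j = 0.
Proof. by have /asboolP h := palg_opP T; exact: h. Qed.

End PatternAlgebra.

(** * Double sums and finite vectors *)

Section Reindexing.
Variables (R : realType) (I J : eqType) (phi : J -> I) (psi : I -> option J).
Hypothesis phiK : pcancel phi psi.
Hypothesis psiK : forall i j, psi i = Some j -> phi j = i.

(** [phi] embeds [J] into [I] and [psi] is its partial inverse. This serves for the diagonal and the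
    superdiagonal inside the set of matrix positions, and for embeddings of one order into
    another. *)
Lemma sum_pmap (V : nmodType) (g : I -> V) (t : seq I) :
  (forall i, psi i = None -> g i = 0) ->
  \sum_(i <- t) g i = \sum_(j <- pmap psi t) g (phi j).
Proof.
move=> g0; elim: t => [|i t IH]; first by rewrite !big_nil.
rewrite big_cons /= IH; case E : (psi i) => [j|] /=; last by rewrite g0 // add0r.
by rewrite big_cons (psiK E).
Qed.

Lemma uniq_pmap (t : seq I) : uniq t -> uniq (pmap psi t).
Proof.
elim: t => //= i t IH /andP[it /IH ut]; case E : (psi i) => [j|] //=.
rewrite ut andbT mem_pmap; apply: contra it => /mapP[k kt /esym Ek].
by rewrite -(psiK E) (psiK Ek).
Qed.

Lemma fin_bounded_reindex (p : I -> R) M :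
  (forall i, psi i = None -> p i = 0) -> fin_bounded (p \o phi) M ->
  fin_bounded p M.
Proof. by move=> p0 pM s us; rewrite sum_pmap //; apply: pM; exact: uniq_pmap. Qed.

Lemma is_csum_reindex (g : I -> R[i]) c :
  (forall i, psi i = None -> g i = 0) -> is_csum (g \o phi) c -> is_csum g c.
Proof.
move=> g0 gc e e0; have [s us hs] := gc e e0.
exists (map phi s); first by rewrite map_inj_uniq //; exact: pcan_inj phiK.
move=> t ut st; rewrite sum_pmap //; apply: hs; first exact: uniq_pmap.
by move=> j js; rewrite mem_pmap -[Some j]phiK map_f //; apply: st; exact: map_f.
Qed.

End Reindexing.

Lemma fin_bounded_inj (R : realType) (I J : eqType) (phi : J -> I) (p : I -> R) M :
  injective phi -> fin_bounded p M -> fin_bounded (p \o phi) M.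
Proof.
move=> phii pM s us; have := pM (map phi s); rewrite map_inj_uniq // big_map.
exact.
Qed.

Section CsumAlgebra.
Variables (R : realType) (I : eqType).
Implicit Types g h : I -> R[i].

Lemma is_csum0 : is_csum (fun _ : I => 0 : R[i]) 0.
Proof.
by have := @is_csum_fin R I (fun=> 0) [::] isT (fun _ _ => erefl); rewrite big_nil.
Qed.

Lemma is_csum_sum (J : Type) (s : seq J) (P : pred J) (F : J -> I -> R[i]) c :
  (forall j, is_csum (F j) (c j)) ->
  is_csum (fun i => \sum_(j <- s | P j) F j i) (\sum_(j <- s | P j) c j).
Proof.
move=> h; elim: s => [|j s IH].
  by rewrite big_nil; under eq_fun do rewrite big_nil; exact: is_csum0.
rewrite big_cons; under eq_fun do rewrite big_cons.
by case: (P j) => //; exact: is_csumD.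
Qed.

Lemma is_csumB g h c c' : is_csum g c -> is_csum h c' ->
  is_csum (fun i => g i - h i) (c - c').
Proof.
move=> gc hc; have := is_csumD gc (is_csumZ (-1) hc).
by under eq_fun do rewrite mulN1r; rewrite mulN1r.
Qed.

Lemma is_csum_fin_bounded_cabs (p : I -> R) M g : (forall i, cabs (g i) <= p i) ->
  fin_bounded p M -> is_csum g (csum g).
Proof. by move=> gp pM; apply: csumP; exact: abs_summableW gp pM. Qed.

End CsumAlgebra.

Section Fubini.
Variables (R : realType) (K I : eqType) (F : K -> I -> R[i]) (N : K -> R) (M : R).
Hypothesis FN : forall k, fin_bounded (fun i => cabs (F k i)) (N k).
Hypothesis NM : fin_bounded N M.

Let ck i := csum (F ^~ i).
Let ci k := csum (F k).

Lemma fubini_term k i : cabs (F k i) <= N k.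
Proof. exact: (fin_bounded_term i (FN k)). Qed.

Lemma fubini_ck i : is_csum (F ^~ i) (ck i).
Proof. exact: is_csum_fin_bounded_cabs (fubini_term ^~ i) NM. Qed.

Lemma fubini_ci k : is_csum (F k) (ci k).
Proof. exact: is_csum_fin_bounded_cabs (fun i => lexx _) (FN k). Qed.

Lemma fubini_ci_le k : cabs (ci k) <= N k.
Proof. exact: is_csum_le (fun i => lexx _) (FN k) (fubini_ci k). Qed.

(** Multiplying each sum over [k] by a number of modulus 1 that makes it nonnegative turns the
    finite sum of moduli into one unordered sum over [k], whose term at [k] is at most [N k]. The
    predicate [P] allows the same bound for the rows outside a finite set. *)
Lemma fubini_tail (P : pred K) (e : R) (t : seq I) : uniq t ->
  (forall s, uniq s -> \sum_(k <- s | P k) N k <= e) ->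
  \sum_(i <- t) cabs (csum (fun k => if P k then F k i else 0)) <= e.
Proof.
move=> ut Ne; pose G k i := if P k then F k i else 0.
have GP i : is_csum (G ^~ i) (csum (G ^~ i)).
  apply: is_csum_fin_bounded_cabs NM => k; rewrite /G; case: (P k) => //.
    exact: fubini_term.
  by rewrite cabs0; apply: le_trans (cabs_ge0 _) (fubini_term k i).
pose th i := (cphase (csum (G ^~ i)))^*.
have h1 := is_csum_sum t xpredT (fun i => is_csumZ (th i) (GP i)).
have pe : fin_bounded (fun k => if P k then N k else 0) e.
  by move=> s us; rewrite -big_mkcond; exact: Ne.
have h2 := is_csum_le _ pe h1.
have E : \sum_(i <- t) th i * csum (G ^~ i) = (\sum_(i <- t) cabs (csum (G ^~ i)))%:C%C.
  by rewrite rmorph_sum; apply: eq_bigr => i _; rewrite /th conj_phaseM.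
have S0 : 0 <= \sum_(i <- t) cabs (csum (G ^~ i)).
  by apply: sumr_ge0 => i _; exact: cabs_ge0.
rewrite -[leLHS](cabs_real S0) -E; apply: h2 => k; rewrite /G; case: (P k); last first.
  by rewrite big1 ?cabs0 // => i _; rewrite mulr0.
apply: le_trans (cabs_sum _ _ _) (le_trans _ (FN k ut)).
by apply: ler_sum => i _; rewrite cabsM cabsJ cabs_phase mul1r.
Qed.

Lemma fubini_summable : fin_bounded (fun i => cabs (ck i)) M.
Proof. by move=> t ut; apply: (@fubini_tail xpredT) => // s us; exact: NM. Qed.

Lemma fubini : is_csum ck (csum ci).
Proof.
have ciP : is_csum ci (csum ci) by exact: is_csum_fin_bounded_cabs fubini_ci_le NM.
have ckP : is_csum ck (csum ck) := is_csum_fin_bounded_cabs (fun i => lexx _) fubini_summable.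
suff <- : csum ck = csum ci by [].
apply/eqP; rewrite -subr_eq0 -cabs_eq0 eq_le cabs_ge0 andbT.
apply/ler_addgt0Pr => e e0; rewrite add0r.
have e2 : 0 < e / 2 by rewrite divr_gt0.
have [s us hs] := psum_cauchy_tail NM e2; have [s' us' hs'] := ciP _ e2.
(* Containing [s], the set [t] leaves out rows whose total contribution is at most [e / 2];
   containing [s'], its row sums add up to the iterated sum within [e / 2]. *)
pose t := undup (s ++ s'); have ut : uniq t by exact: undup_uniq.
have {}hs' : cabs (\sum_(k <- t) ci k - csum ci) < e / 2.
  by apply: hs' => // k ks; rewrite mem_undup mem_cat ks orbT.
have hck : forall i, is_csum (fun k => if k \notin t then F k i else 0)
    (ck i - \sum_(k <- t) F k i).
  move=> i; have hfin : is_csum (fun k => if k \in t then F k i else 0) (\sum_(k <- t) F k i).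
    have -> : \sum_(k <- t) F k i = \sum_(k <- t) (if k \in t then F k i else 0).
      by rewrite big_seq [RHS]big_seq; apply: eq_bigr => k ->.
    by apply: is_csum_fin => // k /negPf ->.
  have := is_csumB (fubini_ck i) hfin; congr is_csum; apply/funext => k.
  by case: (k \in t) => /=; rewrite ?subrr ?subr0.
have hT := is_csumB ckP (is_csum_sum t xpredT fubini_ci).
have : cabs (csum ck - \sum_(k <- t) ci k) <= e / 2.
  apply: is_csum_le (fun i => lexx _) _ hT => r ur /=.
  under eq_bigr do rewrite -(csumE (hck _)).
  apply: fubini_tail => // q uq; rewrite -big_filter; apply/ltW/hs; first exact: filter_uniq.
  by move=> k; rewrite mem_filter mem_undup mem_cat negb_or => /andP[/andP[]].
move: hs'; have -> : csum ck - csum ci = (csum ck - \sum_(k <- t) ci k) + (\sum_(k <- t) ci k - csum ci).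
  by rewrite addrA subrK.
by move=> h1 h2; apply: le_trans (cabsD _ _) _; lra.
Qed.

End Fubini.

Section FiniteVectors.
Variable R : realType.
Local Notation H := (ell2 R).

Lemma dotnorm_le_dual (V : hilbert R) (w : V) M : 0 <= M ->
  (forall y, cabs (hdot V w y) <= M * hnorm y) -> hnorm w <= M.
Proof.
move=> M0 /(_ w); rewrite dotE cabs_real ?sqr_ge0 // expr2.
have [-> //|w0] := eqVneq (hnorm w) 0.
by rewrite ler_pM2r // lt_neqAle eq_sym w0 dotnorm_ge0.
Qed.

Definition vec n (c : 'I_n -> R[i]) : H := \sum_i c i *: be R i.

Lemma ecoord_vec n (c : 'I_n -> R[i]) k :
  ecoord (vec c) k = \sum_(i < n) c i * (k == i :> nat)%:R.
Proof.
by rewrite ecoord_sum; apply: eq_bigr => i _; rewrite ecoordZ ecoord_be.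
Qed.

Lemma ecoord_vec_ord n (c : 'I_n -> R[i]) (i : 'I_n) : ecoord (vec c) i = c i.
Proof.
rewrite ecoord_vec (bigD1 i) //= eqxx mulr1 big1 ?addr0 // => j ji.
by rewrite (inj_eq val_inj) eq_sym (negPf ji) mulr0.
Qed.

Lemma bessel n (x : H) : \sum_(i < n) cabs (ecoord x i) ^+ 2 <= hnorm x ^+ 2.
Proof.
have := ecoord_fin_bounded x (iota_uniq 0 n).
by rewrite -{1}(subn0 n) big_mkord.
Qed.

Lemma vec_norm n (c : 'I_n -> R[i]) : hnorm (vec c) ^+ 2 = \sum_i cabs (c i) ^+ 2.
Proof.
apply/eqP; rewrite eq_le; apply/andP; split; last first.
  apply: le_trans (bessel n (vec c)); apply: ler_sum => i _.
  by rewrite ecoord_vec_ord.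
apply: ecoord_norm_le => s us.
rewrite (bigID (fun i => (i < n)%N)) /= [X in _ + X]big1 ?addr0; last first.
  move=> k; rewrite -leqNgt => nk; rewrite ecoord_vec big1 ?cabs0 ?expr0n // => i _.
  by rewrite gtn_eqF ?mulr0 // (leq_trans (ltn_ord i)).
rewrite -big_filter.
apply: (@le_trans _ _ (\sum_(i <- iota 0 n) cabs (ecoord (vec c) i) ^+ 2)).
  have st : {subset [seq i <- s | (i < n)%N] <= iota 0 n}.
    by move=> i; rewrite mem_filter mem_iota => /andP[->].
  rewrite (sum_seq_split _ (filter_uniq _ us) (iota_uniq 0 n) st).
  by rewrite lerDl sumr_ge0 // => i _; exact: sqr_ge0.
rewrite -{1}(subn0 n) big_mkord.
by apply: ler_sum => i _; rewrite ecoord_vec_ord.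
Qed.

Lemma vec_dot n (c : 'I_n -> R[i]) y :
  hdot H (vec c) y = \sum_i c i * (hdot H y (be R i))^*.
Proof. by rewrite dot_suml; apply: eq_bigr => i _; rewrite dotZl -dotC. Qed.

(** A scalar matrix of any size acts on the first [n] coordinates of the same space, so that blocks
    of all sizes fit into one [l2] direct sum with constant fibre. *)
Definition fmx n (c : 'I_n -> 'I_n -> R[i]) : bop H H :=
  \sum_i \sum_j c i j *: brank1 (be R i) (be R j).

Lemma fmxE n (c : 'I_n -> 'I_n -> R[i]) z :
  fmx c z = vec (fun i => \sum_j c i j * ecoord z j).
Proof.
rewrite /fmx bop_suml; apply: eq_bigr => i _.
rewrite bop_suml scaler_suml; apply: eq_bigr => j _.
by rewrite bopZl /= /rank1 -ecoordE scalerA.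
Qed.

End FiniteVectors.

(** * The predual *)

Section Predual.
Variables (R : realType) (b : bool).
Local Notation A := (palg R b).
Local Notation H := (ell2 R).
Local Notation E := (nat * nat)%type.

Definition predual_pred : {pred E -> (R[i])^o} :=
  fun x => `[< abs_summable (x : E -> R[i]) /\ forall e, ~~ chain2 b e.1 e.2 -> x e = 0 >].

Lemma predual_submod_closed : submod_closed predual_pred.
Proof.
split.
  apply/asboolP; split => //; exists 0 => s us.
  by rewrite big1 // => e _; rewrite cabs0.
move=> a x y /asboolP[[M xM] x0] /asboolP[[N yN] y0]; apply/asboolP; split.
  have h := fin_boundedD (fin_boundedZ (cabs_ge0 a) xM) yN.
  apply: abs_summableW h => e.
  by apply: le_trans (cabsD _ _) _; rewrite -cabsM.
by move=> e he; rewrite -[LHS]/(a * x e + y e) x0 // y0 // mulr0 addr0.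
Qed.

HB.instance Definition _ :=
  GRing.isSubmodClosed.Build R[i] (E -> (R[i])^o) predual_pred predual_submod_closed.

Record predual := Predual {
  predual_val :> E -> (R[i])^o; predual_valP : predual_val \in predual_pred }.

HB.instance Definition _ := [isSub for predual_val].
HB.instance Definition _ := [Choice of predual by <:].
HB.instance Definition _ := [SubChoice_isSubLmodule of predual by <:].

Implicit Types (x y : predual) (T S : A).

Definition pcoef x e : R[i] := predual_val x e.

Lemma pcoefD x y e : pcoef (x + y) e = pcoef x e + pcoef y e. Proof. by []. Qed.
Lemma pcoefZ a x e : pcoef (a *: x) e = a * pcoef x e. Proof. by []. Qed.
Lemma pcoefN x e : pcoef (- x) e = - pcoef x e. Proof. by []. Qed.
Lemma pcoef_zero e : pcoef 0 e = 0. Proof. by []. Qed.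

Lemma pcoef_inj x y : (forall e, pcoef x e = pcoef y e) -> x = y.
Proof. by move=> h; apply/val_inj/funext. Qed.

Lemma pcoef_out x e : ~~ chain2 b e.1 e.2 -> pcoef x e = 0.
Proof. by have /asboolP[_] := predual_valP x; exact. Qed.

Definition norm1 x : R := psum (fun e => cabs (pcoef x e)).

Lemma norm1_fin_bounded x : fin_bounded (fun e => cabs (pcoef x e)) (norm1 x).
Proof. by have /asboolP[[M xM] _] := predual_valP x; exact: psum_fin_bounded xM. Qed.

Lemma norm1_ge0 x : 0 <= norm1 x.
Proof. exact: psum_ge0 (norm1_fin_bounded x). Qed.

Lemma norm1_le x M : fin_bounded (fun e => cabs (pcoef x e)) M -> norm1 x <= M.
Proof. exact: psum_le. Qed.

Lemma predual_exists (f : E -> R[i]) M : fin_bounded (fun e => cabs (f e)) M ->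
  (forall e, ~~ chain2 b e.1 e.2 -> f e = 0) ->
  exists x : predual, forall e, pcoef x e = f e.
Proof.
move=> fM f0; have fP : (f : E -> (R[i])^o) \in predual_pred.
  by apply/asboolP; split => //; exists M.
by exists (Predual fP).
Qed.

Definition pair T x : R[i] := csum (fun e => ecoef T e.1 e.2 * pcoef x e).

Lemma pairP T x : is_csum (fun e => ecoef T e.1 e.2 * pcoef x e) (pair T x).
Proof.
apply: is_csum_fin_bounded_cabs (fin_boundedZ (opnorm_ge0 T) (norm1_fin_bounded x)) => e.
by rewrite cabsM ler_wpM2r ?cabs_ge0 ?coef_le.
Qed.

Lemma pairE T x c : is_csum (fun e => ecoef T e.1 e.2 * pcoef x e) c -> pair T x = c.
Proof. exact: csumE. Qed.

Lemma pair_linear_l x : linear (pair ^~ x : A -> (R[i])^o).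
Proof.
move=> a S T; have := is_csumD (is_csumZ a (pairP S x)) (pairP T x).
move=> /csumE <-; congr csum; apply/funext => e.
by rewrite ecoefD ecoefZ mulrDl mulrA.
Qed.

Lemma pair_linear_r T : linear (pair T : predual -> (R[i])^o).
Proof.
move=> a x y; have := is_csumD (is_csumZ a (pairP T x)) (pairP T y).
move=> /csumE <-; congr csum; apply/funext => e.
by rewrite pcoefD pcoefZ mulrDr mulrCA.
Qed.

Lemma pair_le T x : cabs (pair T x) <= opnorm T * norm1 x.
Proof.
apply: is_csum_le (fin_boundedZ (opnorm_ge0 T) (norm1_fin_bounded x)) (pairP T x) => e.
by rewrite cabsM ler_wpM2r ?cabs_ge0 ?coef_le.
Qed.

(** A row has at most two entries and a coordinate occurs in at most two rows, so boundedness of the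
    coefficients already gives a bounded operator. This is the origin of the factor 2 in the
    comparison of norms below. *)
Lemma palg_of_coef (a : nat -> nat -> R[i]) (C : R) : 0 <= C ->
  (forall i j, cabs (a i j) <= C) ->
  exists T, (forall i j, chain2 b i j -> ecoef T i j = a i j) /\ opnorm T <= 2 * C.
Proof.
move=> C0 aC; pose F (x : H) i := a i i * ecoord x i +
  (if odd i == b then a i i.+1 * ecoord x i.+1 else 0).
have Fb (x : H) : fin_bounded (fun i => cabs (F x i) ^+ 2) ((2 * C) ^+ 2 * hnorm x ^+ 2).
  have h1 := ecoord_fin_bounded x.
  have h2 := fin_bounded_inj succn_inj h1.
  have h3 := fin_boundedZ (mulr_ge0 (ler0n _ 2) (sqr_ge0 C)) (fin_boundedD h1 h2).
  have -> : (2 * C) ^+ 2 * hnorm x ^+ 2 = 2 * C ^+ 2 * (hnorm x ^+ 2 + hnorm x ^+ 2) by ring.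
  apply: fin_boundedW h3 => i /=.
  have k1 : cabs (F x i) <= C * (cabs (ecoord x i) + cabs (ecoord x i.+1)).
    apply: le_trans (cabsD _ _) _; rewrite mulrDr cabsM.
    apply: lerD; first by rewrite ler_wpM2r ?cabs_ge0.
    case: ifP => _; last by rewrite cabs0 mulr_ge0 ?cabs_ge0.
    by rewrite cabsM ler_wpM2r ?cabs_ge0.
  apply: (@le_trans _ _ ((C * (cabs (ecoord x i) + cabs (ecoord x i.+1))) ^+ 2)).
    by rewrite ler_pXn2r ?nnegrE ?cabs_ge0 ?mulr_ge0 ?addr_ge0 ?cabs_ge0.
  move: (cabs _) (cabs _) => u v; rewrite -subr_ge0.
  rewrite (_ : _ - _ = C ^+ 2 * (u - v) ^+ 2); last by ring.
  by rewrite mulr_ge0 ?sqr_ge0.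
have [T TE] : exists T : bop H H, forall (x : H) i, ecoord (T x) i = F x i.
  apply: (bop_of_coords _ Fb) => i c u v; rewrite /F !ecoordD !ecoordZ.
  by case: ifP => _; ring.
have cT i j : ecoef T i j = a i i * (i == j)%:R + (if odd i == b then a i i.+1 * (i.+1 == j)%:R else 0).
  by rewrite /ecoef TE /F !ecoord_be.
have TP : T \in pattern b.
  apply/asboolP => i j; rewrite negb_or negb_and cT => /andP[/negPf -> h].
  rewrite mulr0 add0r; case: ifP => // ib; move: h.
  by rewrite ib orbF eq_sym => /negPf ->; rewrite mulr0.
exists (Palg TP); split.
  move=> i j /orP[/eqP <-|/andP[/eqP -> ib]] /=; rewrite cT eqxx.
    by rewrite mulr1 gtn_eqF // mulr0; case: ifP; rewrite addr0.
  by rewrite ib mulr1 ltn_eqF // mulr0 add0r.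
apply: opnorm_le => [|x]; first by rewrite mulr_ge0.
rewrite -(@ler_pXn2r _ 2) ?nnegrE ?mulr_ge0 ?dotnorm_ge0 // exprMn.
by apply: ecoord_norm_le => /=; under eq_fun do rewrite TE; exact: Fb.
Qed.

(** The operator whose coefficients are the conjugate phases of [x] turns the pairing into the sum
    of the moduli. *)
Lemma norm1_attained x : exists T, opnorm T <= 2 /\ pair T x = (norm1 x)%:C%C.
Proof.
have [T [TE T2]] := @palg_of_coef (fun i j => (cphase (pcoef x (i, j)))^*) 1 ler01
  (fun i j => eq_ind_r (fun t => t <= 1) (lexx 1) (etrans (cabsJ _) (cabs_phase _))).
exists T; split; first by rewrite mulr1 in T2.
apply: pairE; have := is_csum_psum (fun e => cabs_ge0 (pcoef x e)) (norm1_fin_bounded x).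
congr is_csum; apply/funext => -[i j] /=.
have [ij|ij] := boolP (chain2 b i j); first by rewrite TE // conj_phaseM.
by rewrite pcoef_out // cabs0 mulr0.
Qed.

Definition blockIndex : eqType := {n : nat & 'M[A]_n}.

Definition fnorm (f : blockIndex) : R := opmxnorm (map_mx (@palg_op R b) (tagged f)).

(* For [f = 0] the factor [(fnorm f)^-1] is [0], and so is the block. *)
Definition block x (f : blockIndex) : bop H H :=
  (fnorm f)^-1%:C%C *: fmx (fun i j => pair (tagged f i j) x).

Lemma vnorm2_scalar n (c : 'I_n -> R[i]) (y : H) : hnorm y = 1 ->
  vnorm2 (fun j => c j *: y) = \sum_j cabs (c j) ^+ 2.
Proof. by move=> y1; apply: eq_bigr => j _; rewrite dotnormZ y1 mulr1. Qed.

(** The scalar matrix is a compression of [M]: apply [M] to the vector with entries [z_j e_l] and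
    read off the [k]-th coordinates. *)
Lemma coef_block_le n (M : 'M[A]_n) k l (z : H) :
  hnorm (fmx (fun i j => ecoef (M i j) k l) z) <=
    opmxnorm (map_mx (@palg_op R b) M) * hnorm z.
Proof.
rewrite -(@ler_pXn2r _ 2) ?nnegrE ?mulr_ge0 ?opmxnorm_ge0 ?dotnorm_ge0 // exprMn.
rewrite fmxE vec_norm.
have h := opmxnorm_ub (map_mx (@palg_op R b) M) (fun j => ecoord z j *: be R l).
apply: le_trans (le_trans h _); last first.
  by rewrite vnorm2_scalar ?be_norm // ler_wpM2l ?sqr_ge0 ?bessel.
apply: ler_sum => i _; rewrite ler_pXn2r ?nnegrE ?cabs_ge0 ?dotnorm_ge0 //.
apply: le_trans (ecoord_norm _ k); rewrite le_eqVlt; apply/orP; left; apply/eqP; congr cabs.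
rewrite /mxapp ecoord_sum; apply: eq_bigr => j _.
by rewrite mxE bopZ ecoordZ mulrC.
Qed.

(** Up to the factor [1 / |f|], a block is the sum over positions [e] of [x_e] times the matrix of
    coefficients of [f] at [e]. By [coef_block_le] each of these matrices has norm at most [|f|],
    which bounds the block by the [l^1]-norm of [x]. *)
Lemma block_dot x f (z y : H) :
  is_csum (fun e => (fnorm f)^-1%:C%C * (pcoef x e *
      hdot H (fmx (fun i j => ecoef (tagged f i j) e.1 e.2) z) y))
    (hdot H (block x f z) y).
Proof.
have -> : hdot H (block x f z) y = (fnorm f)^-1%:C%C *
    \sum_(i < tag f) \sum_(j < tag f) (ecoord z j * (hdot H y (be R i))^*) * pair (tagged f i j) x.
  rewrite bopZl /= dotZl fmxE vec_dot; congr (_ * _).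
  apply: eq_bigr => i _; rewrite mulr_suml; apply: eq_bigr => j _.
  by ring.
apply: is_csumZ.
have := is_csum_sum (index_enum _) xpredT (fun i : 'I_(tag f) => is_csum_sum (index_enum _) xpredT
  (fun j : 'I_(tag f) => is_csumZ (ecoord z j * (hdot H y (be R i))^*) (pairP (tagged f i j) x))).
congr is_csum; apply/funext => e; rewrite fmxE vec_dot mulr_sumr.
apply: eq_bigr => i _; rewrite mulr_suml mulr_sumr; apply: eq_bigr => j _.
by ring.
Qed.

Lemma block_bounded x f (z : H) : hnorm (block x f z) <= norm1 x * hnorm z.
Proof.
apply: dotnorm_le_dual => [|y]; first by rewrite mulr_ge0 ?norm1_ge0 ?dotnorm_ge0.
rewrite -mulrA mulrC.
apply: is_csum_le (fin_boundedZ (mulr_ge0 (dotnorm_ge0 _ _) (dotnorm_ge0 _ _))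
  (norm1_fin_bounded x)) (block_dot x f z y) => e.
rewrite !cabsM mulrCA [leRHS]mulrC ler_wpM2l ?cabs_ge0 //.
rewrite cabs_real ?invr_ge0 ?opmxnorm_ge0 //.
apply: (@le_trans _ _ ((fnorm f)^-1 * (fnorm f * hnorm z * hnorm y))).
  rewrite ler_wpM2l ?invr_ge0 ?opmxnorm_ge0 //; apply: le_trans (dot_CS _ _ _) _.
  by rewrite ler_wpM2r ?dotnorm_ge0 // coef_block_le.
have [->|f0] := eqVneq (fnorm f) 0.
  by rewrite invr0 !mul0r mulr_ge0 ?dotnorm_ge0.
by rewrite !mulrA mulVf // mul1r.
Qed.

End Predual.

(** * Block diagonal operators and matrix norms *)

Section BlockDiagonal.
Variables (R : realType) (I : eqType) (V : hilbert R).

Definition bdiag_fun (D : I -> bop V V) (z : l2 I V) (i : I) : V := D i (l2_val z i).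

Implicit Types D : I -> bop V V.

Lemma bdiag_fun_l2 D : (exists C, forall i v, hnorm (D i v) <= C * hnorm v) ->
  forall z, bdiag_fun D z \in @l2_pred R I V.
Proof.
move=> [C DC] z; apply/asboolP; exists (C ^+ 2 * hnorm (z : l2hilbert I V) ^+ 2).
apply: fin_boundedW (fin_boundedZ (sqr_ge0 C) (l2norm_fin_bounded z)) => i.
rewrite -exprMn ler_pXn2r ?nnegrE ?dotnorm_ge0 //.
  exact: DC.
exact: le_trans (dotnorm_ge0 _ _) (DC i (l2_val z i)).
Qed.

Definition bdiag_app D hD (z : l2hilbert I V) : l2hilbert I V := L2 (@bdiag_fun_l2 D hD z).

Lemma bdiag_norm D hD C : 0 <= C -> (forall i v, hnorm (D i v) <= C * hnorm v) ->
  forall z, hnorm (@bdiag_app D hD z) <= C * hnorm z.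
Proof.
move=> C0 DC z; rewrite -(@ler_pXn2r _ 2) ?nnegrE ?mulr_ge0 ?dotnorm_ge0 // exprMn.
apply: l2norm_sqr_le.
apply: fin_boundedW (fin_boundedZ (sqr_ge0 C) (l2norm_fin_bounded z)) => i.
by rewrite -exprMn ler_pXn2r ?nnegrE ?mulr_ge0 ?dotnorm_ge0 // DC.
Qed.

Lemma bdiag_subproof D hD : @bdiag_app D hD \in @bounded_op_pred R (l2hilbert I V) (l2hilbert I V).
Proof.
apply/asboolP; split; last first.
  have [C DC] := hD; exists `|C|; apply: bdiag_norm => // i v.
  by apply: le_trans (DC i v) _; rewrite ler_wpM2r ?dotnorm_ge0 ?ler_norm.
by move=> a u v; apply: l2ext => i; exact: (bop_linear (D i) a (l2_val u i) (l2_val v i)).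
Qed.

Definition bdiag D hD : bop (l2hilbert I V) (l2hilbert I V) := Bop (@bdiag_subproof D hD).

(** An inequality checked in each fibre [i] can be summed over [i], although the vectors carry a
    second, finite index; this bounds matrices of block diagonal operators block by block. *)
Lemma l2_sumsq_le m k (w : 'I_k -> l2hilbert I V) (z : 'I_m -> l2hilbert I V) :
  (forall i, vnorm2 (fun j => l2_val (w j) i) <= vnorm2 (fun j => l2_val (z j) i)) ->
  vnorm2 w <= vnorm2 z.
Proof.
move=> h.
have hz : fin_bounded (fun i => vnorm2 (fun j => l2_val (z j) i)) (vnorm2 z).
  move=> s us; rewrite exchange_big /=; apply: ler_sum => j _.
  exact: (l2norm_fin_bounded (z j)).
have hw : is_csum (fun i => (vnorm2 (fun j => l2_val (w j) i))%:C%C) (vnorm2 w)%:C%C.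
  have := is_csum_sum (index_enum _) xpredT (fun j => l2dotP (w j) (w j)).
  congr is_csum; last by rewrite rmorph_sum; apply: eq_bigr => j _; exact: dotE.
  by apply/funext => i; rewrite rmorph_sum; apply: eq_bigr => j _; exact: dotE.
rewrite -[leLHS]cabs_real ?vnorm2_ge0 //; apply: is_csum_le hz hw => i.
by rewrite cabs_real ?vnorm2_ge0.
Qed.

End BlockDiagonal.

Section OpnormTriangle.
Variables (R : realType) (H K : hilbert R).
Implicit Types S T : bop H K.

Lemma opnormD S T : opnorm (S + T) <= opnorm S + opnorm T.
Proof.
apply: opnorm_le => [|x]; first by rewrite addr_ge0 ?opnorm_ge0.
rewrite mulrDl; apply: le_trans (dotnormD _ _ _) _.
by rewrite lerD ?opnorm_ub.
Qed.

Lemma opnormN T : opnorm (- T) = opnorm T.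
Proof.
have le (U : bop H K) : opnorm (- U) <= opnorm U.
  apply: opnorm_le => [|x]; first exact: opnorm_ge0.
  by rewrite bopNl dotnormN opnorm_ub.
by apply/eqP; rewrite eq_le le /=; have := le (- T); rewrite opprK.
Qed.

Lemma opnorm_eq0 T : opnorm T <= 0 -> T = 0.
Proof.
move=> h; apply: bopP => x; apply/(@dotnorm_eq0 _ _ (hdot K))/eqP.
rewrite eq_le dotnorm_ge0 andbT; apply: le_trans (opnorm_ub _ _) _.
by rewrite mulr_le0_ge0 ?dotnorm_ge0.
Qed.

Lemma opmxnorm_entry n (T : 'M[bop H K]_n) i j v :
  hnorm (T i j v) <= opmxnorm T * hnorm v.
Proof.
rewrite -(@ler_pXn2r _ 2) ?nnegrE ?mulr_ge0 ?dotnorm_ge0 ?opmxnorm_ge0 // exprMn.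
have := opmxnorm_ub T (fun k => if k == j then v else 0).
have -> : vnorm2 (fun k : 'I_n => if k == j then v else 0) = hnorm v ^+ 2.
  rewrite /vnorm2 (bigD1 j) //= eqxx big1 ?addr0 // => k /negPf ->.
  by rewrite dotnorm0 expr0n.
apply: le_trans; rewrite /vnorm2 (bigD1 i) //=.
have -> : mxapp T (fun k => if k == j then v else 0) i = T i j v.
  rewrite /mxapp (bigD1 j) //= eqxx big1 ?addr0 // => k /negPf ->.
  by rewrite bop0.
by rewrite lerDl sumr_ge0 // => k _; exact: sqr_ge0.
Qed.

End OpnormTriangle.

Section ScalarMatrixNorm.
Variables (R : realType) (I : finType) (a : I -> I -> R[i]).

Definition snorm2 (z : I -> R[i]) : R := \sum_i cabs (z i) ^+ 2.
Definition sapp (z : I -> R[i]) (i : I) : R[i] := \sum_j a i j * z j.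

Lemma snorm2_ge0 z : 0 <= snorm2 z.
Proof. by apply: sumr_ge0 => i _; exact: sqr_ge0. Qed.

Lemma scalar_set1 (z : I -> R[i]) :
  \sum_j complex.Re `|z j| ^+ 2 <= 1 <-> Num.sqrt (snorm2 z) <= 1.
Proof.
suff -> : (Num.sqrt (snorm2 z) <= 1) = (snorm2 z <= 1) by [].
by rewrite -[LHS](@ler_pXn2r _ 2) ?nnegrE ?sqrtr_ge0 // sqr_sqrtr ?expr1n ?snorm2_ge0.
Qed.

Lemma scalar_set0 : [set z : I -> R[i] | \sum_j complex.Re `|z j| ^+ 2 <= 1] !=set0.
Proof. by exists (fun=> 0); rewrite /mkset big1 // => i _; rewrite normr0 expr0n. Qed.

Lemma scalar_mxnorm_le M : 0 <= M ->
  (forall z, snorm2 (sapp z) <= M ^+ 2 * snorm2 z) -> scalar_mxnorm a <= M.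
Proof.
move=> M0 aM; apply: (@supnorm_le _ _ (fun z => Num.sqrt (snorm2 (sapp z)))
  (fun z => Num.sqrt (snorm2 z))) => //.
- by move=> z; refine (scalar_set1 z).
- exact: scalar_set0.
- move=> x; rewrite -(@ler_pXn2r _ 2) ?nnegrE ?mulr_ge0 ?sqrtr_ge0 //.
  by rewrite exprMn !sqr_sqrtr ?snorm2_ge0.
Qed.

Lemma sapp_bounded :
  exists M, forall z, Num.sqrt (snorm2 (sapp z)) <= M * Num.sqrt (snorm2 z).
Proof.
have row0 i : 0 <= \sum_j cabs (a i j) by apply: sumr_ge0 => j _; exact: cabs_ge0.
exists (\sum_i \sum_j cabs (a i j)) => z; set s := Num.sqrt (snorm2 z).
have le1 j : cabs (z j) <= s.
  rewrite -[leLHS]ger0_norm ?cabs_ge0 // -sqrtr_sqr ler_wsqrtr //.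
  by rewrite /snorm2 (bigD1 j) //= lerDl sumr_ge0 // => i _; exact: sqr_ge0.
have s0 : 0 <= s by exact: sqrtr_ge0.
rewrite -(@ler_pXn2r _ 2) ?nnegrE ?sqrtr_ge0 ?mulr_ge0 ?sumr_ge0 //.
rewrite sqr_sqrtr ?snorm2_ge0 // mulr_suml.
apply: (@le_trans _ _ (\sum_i ((\sum_j cabs (a i j)) * s) ^+ 2)).
  apply: ler_sum => i _; rewrite ler_pXn2r ?nnegrE ?cabs_ge0 ?mulr_ge0 //.
  apply: le_trans (cabs_sum _ _ _) _; rewrite mulr_suml; apply: ler_sum => j _.
  by rewrite cabsM ler_wpM2l ?cabs_ge0.
by apply: sum_sqr_le => i; rewrite mulr_ge0.
Qed.

Lemma sqrt_snorm2Z t (z : I -> R[i]) : 0 <= t ->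
  Num.sqrt (snorm2 (fun j => t%:C%C * z j)) = t * Num.sqrt (snorm2 z).
Proof.
move=> t0; have -> : snorm2 (fun j => t%:C%C * z j) = t ^+ 2 * snorm2 z.
  by rewrite /snorm2 mulr_sumr; apply: eq_bigr => i _; rewrite cabsM cabs_real // exprMn.
by rewrite sqrtrM ?sqr_ge0 // sqrtr_sqr ger0_norm.
Qed.

Lemma scalar_mxnorm_ge0 : 0 <= scalar_mxnorm a.
Proof.
apply: (@supnorm_ge0 _ _ (fun z => Num.sqrt (snorm2 (sapp z)))
  (fun z => Num.sqrt (snorm2 z))).
- by move=> y; exact: sqrtr_ge0.
- by move=> y; exact: sqrtr_ge0.
- by move=> y; refine (scalar_set1 y).
- exact: sapp_bounded.
- exact: scalar_set0.
Qed.

Lemma scalar_mxnorm_ub z : snorm2 (sapp z) <= scalar_mxnorm a ^+ 2 * snorm2 z.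
Proof.
have n0 := scalar_mxnorm_ge0.
rewrite -[leLHS]sqr_sqrtr ?snorm2_ge0 // -[X in _ * X]sqr_sqrtr ?snorm2_ge0 //.
rewrite -exprMn ler_pXn2r ?nnegrE ?mulr_ge0 ?sqrtr_ge0 //.
apply: (@supnorm_ub _ _ (fun z => Num.sqrt (snorm2 (sapp z)))
  (fun z => Num.sqrt (snorm2 z)) _ (fun t z j => t%:C%C * z j)).
- by move=> y; exact: sqrtr_ge0.
- by move=> y; refine (scalar_set1 y).
- move=> t y t0; rewrite -sqrt_snorm2Z //; congr (Num.sqrt (snorm2 _)).
  by apply/funext => i; rewrite /sapp mulr_sumr; apply: eq_bigr => j _; rewrite mulrCA.
- by move=> t y t0; rewrite sqrt_snorm2Z.
- exact: sapp_bounded.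
Qed.

End ScalarMatrixNorm.

(** * The predual as a concrete operator space *)

Section PredualOperatorSpace.
Variables (R : realType) (b : bool).
Local Notation A := (palg R b).
Local Notation X := (predual R b).
Local Notation H := (ell2 R).
Local Notation K := (l2hilbert (blockIndex R b) H).
Local Notation op := (@palg_op R b).
Implicit Types (x y : X) (T S : A).

Lemma block_linear f a x y : block (a *: x + y) f = a *: block x f + block y f.
Proof.
rewrite /block /fmx; apply: bopP => z; rewrite bopDl !bopZl !bop_suml.
rewrite scalerA mulrC -scalerA -scalerDr; congr (_ *: _).
rewrite scaler_sumr -big_split; apply: eq_bigr => i _ /=.
rewrite !bop_suml scaler_sumr -big_split; apply: eq_bigr => j _ /=.
transitivity ((a * pair (tagged f i j) x + pair (tagged f i j) y) *:
    rank1 (be R i) (be R j) z); last by rewrite scalerDl -scalerA.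
exact: (congr1 (fun c => c *: rank1 (be R i) (be R j) z)
  (pair_linear_r (tagged f i j) a x y)).
Qed.

Lemma block_ex x : exists C, forall f (v : H), hnorm (block x f v) <= C * hnorm v.
Proof. by exists (norm1 x); exact: block_bounded. Qed.

Definition uop x : bop K K := bdiag (block_ex x).

Lemma uopE x (z : K) f : l2_val (uop x z) f = block x f (l2_val z f).
Proof. by []. Qed.

Lemma uop_linear : linear uop.
Proof.
move=> a x y; apply: bopP => z; apply: l2ext => f.
by rewrite uopE block_linear.
Qed.

HB.instance Definition _ := GRing.isLinear.Build R[i] X (bop K K) _ uop uop_linear.

Lemma opnorm_uop_le x : opnorm (uop x) <= norm1 x.
Proof.
apply: opnorm_le; first exact: norm1_ge0.
by apply: bdiag_norm; [exact: norm1_ge0|exact: block_bounded].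
Qed.

Lemma pair0 x : pair (0 : A) x = 0.
Proof. by apply: pairE; under eq_fun do rewrite ecoef0 mul0r; exact: is_csum0. Qed.

Lemma fnorm_eq0 n (a : 'M[A]_n) i j : opmxnorm (map_mx op a) = 0 -> a i j = 0.
Proof.
move=> h; apply: palgP; apply: bopP => v; apply/(@dotnorm_eq0 _ _ (hdot H))/eqP.
rewrite eq_le dotnorm_ge0 andbT.
by have := opmxnorm_entry (map_mx op a) i j v; rewrite mxE h mul0r.
Qed.

Lemma sum_blockE m n (a : 'M[A]_n) (x : 'I_m -> X) (z : 'I_m -> H) :
  \sum_l block (x l) (existT _ n a : blockIndex R b) (z l) =
  (opmxnorm (map_mx op a))^-1%:C%C *:
    vec (fun i => \sum_l \sum_j pair (a i j) (x l) * ecoord (z l) j).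
Proof.
rewrite /block /= -/(fnorm _) -scaler_sumr; congr (_ *: _).
apply: ecoord_inj => k; rewrite ecoord_sum ecoord_vec.
under eq_bigr do rewrite fmxE ecoord_vec.
by rewrite exchange_big; apply: eq_bigr => i _; rewrite mulr_suml.
Qed.

(** Among the blocks of [uop] there is the one indexed by [a] itself, with entries
    [<a_ij, x> / |a|]. Evaluating [map_mx uop x] on vectors supported in this block bounds the
    matrix of all pairings. For [|a| = 0] the block carries no information, but then [a = 0]. *)
Lemma pair_mx_le n m (a : 'M[A]_n) (x : 'M[X]_m) (z : 'I_n * 'I_m -> R[i]) :
  snorm2 (sapp (fun p q : 'I_n * 'I_m => pair (a p.1 q.1) (x p.2 q.2)) z) <=
  (opmxnorm (map_mx op a) * opmxnorm (map_mx uop x)) ^+ 2 * snorm2 z.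
Proof.
set N := opmxnorm (map_mx op a); have [N0|N0] := eqVneq N 0.
  rewrite N0 mul0r expr0n mul0r /snorm2 big1 // => p _.
  rewrite /sapp big1 ?cabs0 ?expr0n // => q _.
  by rewrite fnorm_eq0 // pair0 mul0r.
pose f : blockIndex R b := existT _ n a.
(* The scalar vector [z], cut into [m] pieces of length [n], each placed in the fibre of [f]. *)
pose zeta (l : 'I_m) : K := l2single f (vec (fun j => z (j, l))).
have hz : vnorm2 zeta = snorm2 z.
  rewrite /vnorm2 /snorm2.
  under eq_bigr do rewrite l2single_norm vec_norm.
  by rewrite exchange_big pair_bigA; apply: eq_bigr => -[].
have := opmxnorm_ub (map_mx uop x) zeta; rewrite hz => h.
rewrite exprMn -mulrA -ler_pdivrMl; last by rewrite exprn_gt0 // lt_neqAle eq_sym N0 opmxnorm_ge0.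
apply: le_trans h.
have -> : snorm2 (sapp (fun p q => pair (a p.1 q.1) (x p.2 q.2)) z) =
    \sum_k \sum_i cabs (\sum_l \sum_j pair (a i j) (x k l) * z (j, l)) ^+ 2.
  rewrite exchange_big pair_bigA; apply: eq_bigr => -[i k] _ /=; congr (cabs _ ^+ 2).
  by rewrite exchange_big pair_bigA; apply: eq_bigr => -[].
rewrite mulr_sumr; apply: ler_sum => k _.
apply: le_trans (_ : hnorm (l2_val (mxapp (map_mx uop x) zeta k) f) ^+ 2 <= _); last first.
  by rewrite ler_pXn2r ?nnegrE ?dotnorm_ge0 ?l2norm_coord.
have -> : l2_val (mxapp (map_mx uop x) zeta k) f =
    \sum_l block (x k l) f (vec (fun j => z (j, l))).
  rewrite /mxapp l2_sum; apply: eq_bigr => l _.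
  by rewrite mxE uopE l2singleE eqxx.
rewrite sum_blockE dotnormZ exprMn vec_norm cabs_real ?invr_ge0 ?opmxnorm_ge0 // exprVn.
rewrite le_eqVlt; apply/orP; left; apply/eqP; congr (_ * _).
apply: eq_bigr => i _; congr (cabs _ ^+ 2); apply: eq_bigr => l _.
by apply: eq_bigr => j _; rewrite ecoord_vec_ord.
Qed.

Lemma sum_ord1_pair (V : nmodType) (g : 'I_1 * 'I_1 -> V) :
  \sum_p g p = g (ord0, ord0).
Proof. by apply: big_pred1 => -[i j]; rewrite !ord1. Qed.

Lemma pair_le_opmxnorm T x :
  cabs (pair T x) <= opmxnorm (map_mx op (const_mx T : 'M[_]_1)) * opmxnorm (map_mx uop (const_mx x : 'M[_]_1)).
Proof.
rewrite -(@ler_pXn2r _ 2) ?nnegrE ?mulr_ge0 ?cabs_ge0 ?opmxnorm_ge0 //.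
have := pair_mx_le (const_mx T : 'M[_]_1) (const_mx x : 'M[_]_1) (fun=> 1).
by rewrite /snorm2 /sapp !sum_ord1_pair /= !mxE cabs1 expr1n !mulr1.
Qed.

Lemma opmxnorm_const (L M : hilbert R) (T : bop L M) :
  opmxnorm (const_mx T : 'M[_]_1) = opnorm T.
Proof.
apply/eqP; rewrite eq_le; apply/andP; split.
  by apply: opmxnorm1_le => [|z]; rewrite ?opnorm_ge0 // mxE opnorm_ub.
apply: opnorm_le => [|z]; first exact: opmxnorm_ge0.
by have := opmxnorm1_ub (const_mx T : 'M[_]_1) z; rewrite mxE.
Qed.

(** Together with [opnorm_uop_le] this makes the operator norm equivalent to the [l^1]-norm, so that
    the range of [uop] is closed because [l^1] is complete. *)
Lemma norm1_le_uop x : norm1 x <= 2 * opnorm (uop x).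
Proof.
have [T [T2 Tx]] := norm1_attained x.
have := pair_le_opmxnorm T x; rewrite !map_const_mx !opmxnorm_const Tx.
rewrite cabs_real ?norm1_ge0 // => /le_trans; apply.
by rewrite ler_wpM2r ?opnorm_ge0.
Qed.

Lemma uop_inj : injective uop.
Proof.
move=> x y xy; apply/eqP; rewrite -subr_eq0; apply/eqP/pcoef_inj => e.
apply/eqP; rewrite -cabs_eq0 eq_le cabs_ge0 andbT.
apply: le_trans (fin_bounded_term e (norm1_fin_bounded (x - y))) _.
apply: le_trans (norm1_le_uop _) _; rewrite linearB /= xy subrr.
rewrite mulr_ge0_le0 //; apply: opnorm_le => // z.
by rewrite bop0l dotnorm0 mul0r.
Qed.

Lemma norm1_complete (u : nat -> X) :
  (forall e : R, 0 < e -> exists N, forall m n, (N <= m)%N -> (N <= n)%N ->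
     norm1 (u m - u n) <= e) ->
  exists x, forall e : R, 0 < e -> exists N, forall n, (N <= n)%N -> norm1 (u n - x) <= e.
Proof.
move=> uC.
have /choice[l lP] : forall i, exists l : R[i], forall e : R, 0 < e ->
    exists N, forall n, (N <= n)%N -> cabs (pcoef (u n) i - l) < e.
  move=> i; have [e e0|l hl] := @hilbert_complete _ (chilbert R) (fun n => pcoef (u n) i).
    have [N uN] := uC (e / 2) (divr_gt0 e0 (ltr0n _ 2)); exists N => m n Nm Nn.
    rewrite chnormE; apply: (@le_lt_trans _ _ (e / 2)); last by lra.
    exact: le_trans (fin_bounded_term i (norm1_fin_bounded (u m - u n))) (uN m n Nm Nn).
  by exists l => e /hl[N hN]; exists N => n /hN; rewrite chnormE.
have lim1 m i : (fun n => cabs (pcoef (u m) i - pcoef (u n) i)) @ \oo --> cabs (pcoef (u m) i - l i).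
  apply/cvgrPdist_lt => e e0; have [N hN] := lP i e e0.
  exists N => // n /= /hN; apply: le_lt_trans.
  have := dotnorm_dist (hdot (chilbert R)) (pcoef (u m) i - l i) (pcoef (u m) i - pcoef (u n) i).
  by rewrite !chnormE (_ : _ - _ - _ = pcoef (u n) i - l i) //; ring.
have bnd e : 0 < e -> exists N, forall m, (N <= m)%N ->
    fin_bounded (fun i => cabs (pcoef (u m) i - l i)) e.
  move=> e0; have [N uN] := uC e e0; exists N => m Nm.
  apply: fin_bounded_limit (lim1 m); exists N => // n /= Nn s us.
  exact: le_trans (norm1_fin_bounded (u m - u n) us) (uN m n Nm Nn).
have [N hN] := bnd 1 ltr01.
(* As for [l2], the limit is reached as [u N] minus a summable difference. Off the order it vanishes
   because every [u n] does. *)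
have [y yE] : exists y : X, forall e, pcoef y e = pcoef (u N) e - l e.
  apply: predual_exists (hN N (leqnn N)) _ => e he; rewrite pcoef_out // sub0r.
  apply/eqP; rewrite oppr_eq0 -cabs_eq0 eq_le cabs_ge0 andbT.
  apply/ler_addgt0Pr => d d0; rewrite add0r; have [k hk] := lP e d d0.
  by have := hk k (leqnn k); rewrite pcoef_out // sub0r cabsN => /ltW.
exists (u N - y) => e e0; have [k hk] := bnd e e0; exists k => n kn.
apply: norm1_le => s us; apply: le_trans (hk n kn s us).
by apply: ler_sum => i _; rewrite pcoefD pcoefN pcoefD pcoefN yE subKr.
Qed.

Lemma uop_norm_closed : norm_closed (range uop).
Proof.
move=> T hT.
have /choice[u uP] : forall n : nat, exists x, opnorm (T - uop x) < n.+1%:R^-1.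
  by move=> n; have [|_ [x _ <-] h] := hT n.+1%:R^-1; [rewrite invr_gt0|exists x].
have uB m n : norm1 (u m - u n) <= 2 * (m.+1%:R^-1 + n.+1%:R^-1).
  apply: le_trans (norm1_le_uop _) _; rewrite ler_wpM2l // linearB /=.
  have -> : uop (u m) - uop (u n) = - (T - uop (u m)) + (T - uop (u n)).
    by rewrite opprB addrA subrK.
  by apply: le_trans (opnormD _ _) _; rewrite opnormN lerD // ltW.
have le N k : (N <= k)%N -> k.+1%:R^-1 <= N.+1%:R^-1 :> R.
  by move=> Nk; rewrite lef_pV2 ?posrE // ler_nat.
have [e e0|x xP] := @norm1_complete u.
  have [N hN] := archi_inv (divr_gt0 e0 (ltr0n R 4)); exists N => m n Nm Nn.
  apply: le_trans (uB m n) _; have := le _ _ Nm; have := le _ _ Nn.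
  by move: hN; move: (_^-1) (m.+1%:R^-1) (n.+1%:R^-1) => p q r; lra.
exists x => //; symmetry; apply/eqP; rewrite -subr_eq0; apply/eqP/opnorm_eq0.
apply/ler_addgt0Pr => e e0; rewrite add0r.
have [N1 h1] := xP (e / 2) (divr_gt0 e0 (ltr0n _ 2)).
have [N2 h2] := archi_inv (divr_gt0 e0 (ltr0n R 2)).
pose n := maxn N1 N2; have {}h1 := h1 n (leq_maxl _ _).
have -> : T - uop x = (T - uop (u n)) + uop (u n - x).
  by rewrite linearB /= addrA subrK.
apply: le_trans (opnormD _ _) _.
have := opnorm_uop_le (u n - x); have := uP n; have := le _ _ (leq_maxr N1 N2).
move: h1 h2; rewrite -/n.
move: (n.+1%:R^-1) (N2.+1%:R^-1) (opnorm _) (opnorm _) (norm1 _) => p q r s t.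
by move: (e : R) => d; lra.
Qed.

Definition predual_norm n (x : 'M[X]_n) : R := opmxnorm (map_mx uop x).

Lemma predual_concrete : exists L (u : {linear X -> bop L L}),
  [/\ injective u, norm_closed (range u) &
      forall n (x : 'M[X]_n), opmxnorm (map_mx u x) = predual_norm x].
Proof. by exists K, uop; split => //; [exact: uop_inj|exact: uop_norm_closed]. Qed.

Definition predual_space : operator_space R := OperatorSpace predual_concrete.

End PredualOperatorSpace.

(** * The dual operator algebra *)

Section DualAlgebra.
Variables (R : realType) (b : bool).
Local Notation A := (palg R b).
Local Notation X := (predual R b).
Local Notation H := (ell2 R).
Local Notation K := (l2hilbert (blockIndex R b) H).
Local Notation op := (@palg_op R b).
Implicit Types (T S : A).

Lemma sum_indicator_le (I : eqType) (e : I) (s : seq I) : uniq s ->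
  \sum_(i <- s) (i == e)%:R <= 1 :> R.
Proof.
move=> us; have [es|es] := boolP (e \in s).
  by rewrite (bigD1_seq e) //= eqxx big1 ?addr0 // => i /negPf ->.
by rewrite big_seq big1 ?ler01 // => i; case: eqP => // ->; rewrite (negPf es).
Qed.

(** The factor [chain2] makes the unit vector zero at a position outside the order, so that it is
    available for all positions and full square matrices of unit vectors can be formed. *)
Lemma delta_exists (e : nat * nat) : exists x : X,
  forall e', pcoef x e' = ((e' == e) && chain2 b e.1 e.2)%:R.
Proof.
apply: (@predual_exists _ _ _ 1) => [s us|e' he]; last first.
  by case: eqP he => //= -> /negPf ->.
apply: (@le_trans _ _ (\sum_(e' <- s) (e' == e)%:R)).
  apply: ler_sum => e' _; case: (e' == e) => /=; last by rewrite cabs0.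
  by rewrite cabs_nat ler_nat leq_b1.
exact: sum_indicator_le.
Qed.

Definition delta e : X := sval (cid (delta_exists e)).

Lemma pcoef_delta e e' : pcoef (delta e) e' = ((e' == e) && chain2 b e.1 e.2)%:R.
Proof. exact: (svalP (cid (delta_exists e))). Qed.

Lemma norm1_delta e : norm1 (delta e) <= 1.
Proof.
apply: norm1_le => s us.
apply: (@le_trans _ _ (\sum_(e' <- s) (e' == e)%:R)).
  apply: ler_sum => e' _; rewrite pcoef_delta; case: (e' == e) => /=; last by rewrite cabs0.
  by rewrite cabs_nat ler_nat leq_b1.
exact: sum_indicator_le.
Qed.

Lemma pair_delta T e : pair T (delta e) = ecoef T e.1 e.2.
Proof.
apply: pairE; rewrite -[X in is_csum _ X](big_seq1 (GRing.add : Monoid.law 0) e (fun e => ecoef T e.1 e.2)).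
have -> : \sum_(e' <- [:: e]) ecoef T e'.1 e'.2 =
    \sum_(e' <- [:: e]) ecoef T e'.1 e'.2 * pcoef (delta e) e'.
  rewrite !big_seq1 pcoef_delta eqxx /=.
  by have [h|h] := boolP (chain2 b e.1 e.2); rewrite ?mulr1 // palg_coef0 ?mul0r.
by apply: is_csum_fin => // e'; rewrite inE pcoef_delta => /negPf ->; rewrite mulr0.
Qed.

Lemma palg_ext S T : (forall i j, chain2 b i j -> ecoef S i j = ecoef T i j) -> S = T.
Proof.
move=> h; apply: palgP; apply: coef_inj => i j.
have [ij|ij] := boolP (chain2 b i j); first exact: h.
by rewrite !palg_coef0.
Qed.

Lemma pair_bounded T : @bounded_functionals R (predual_space R b) (pair T).
Proof.
split; first exact: pair_linear_r.
exists (opmxnorm (map_mx op (const_mx T : 'M[_]_1))) => x.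
exact: pair_le_opmxnorm.
Qed.

Lemma predual_dense (x : X) e : 0 < e -> exists s : seq (nat * nat),
  norm1 (x - \sum_(i <- s) pcoef x i *: delta i) <= e.
Proof.
move=> e0; have [s us hs] := psum_cauchy_tail (norm1_fin_bounded x) e0.
exists s; apply: norm1_le => t ut.
have E i : pcoef (x - \sum_(j <- s) pcoef x j *: delta j) i = if i \in s then 0 else pcoef x i.
  rewrite pcoefD pcoefN.
  have -> : pcoef (\sum_(j <- s) pcoef x j *: delta j) i =
      \sum_(j <- s) pcoef x j * ((i == j) && chain2 b j.1 j.2)%:R.
    elim/big_rec2: _ => [|j y z _ <-]; first by rewrite pcoef_zero.
    by rewrite pcoefD pcoefZ pcoef_delta.
  case: ifP => is_.
    rewrite (bigD1_seq i) //= eqxx /= big1 ?addr0 => [|j ji]; last by rewrite eq_sym (negPf ji) mulr0.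
    have [h|h] := boolP (chain2 b i.1 i.2); first by rewrite mulr1 subrr.
    by rewrite pcoef_out // mul0r subrr.
  rewrite big_seq big1 ?subr0 // => j js; case: eqP => [ij|]; last by rewrite mulr0.
  by rewrite ij js in is_.
move: E; move: (x - _) => y E.
rewrite (bigID (fun i => i \notin s)) /= [X in _ + X]big1 ?addr0 => [|i]; last first.
  by rewrite negbK -/(pcoef y i) E => ->; rewrite cabs0.
rewrite -big_filter.
have ft i : i \in [seq i <- t | i \notin s] -> i \notin s.
  by rewrite mem_filter => /andP[].
apply: le_trans (ltW (hs _ (filter_uniq _ ut) ft)).
rewrite big_seq [leRHS]big_seq; apply: ler_sum => i.
by rewrite mem_filter => /andP[is_ _]; rewrite -/(pcoef y i) E (negPf is_).
Qed.

Lemma pair_bij : set_bij setT (@bounded_functionals R (predual_space R b)) (@pair R b).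
Proof.
split.
- by move=> T _; exact: pair_bounded.
- move=> S T _ _ ST; apply: palg_ext => i j _.
  by rewrite -!(pair_delta _ (i, j)) ST.
move=> f [flin [M fM]].
have f0 : f 0 = 0 by have := flin (-1) 0 0; rewrite scaler0 addr0 scaleN1r addNr.
have fD x y : f (x + y) = f x + f y by have := flin 1 x y; rewrite !scale1r.
have fZ a x : f (a *: x) = a * f x by have := flin a x 0; rewrite !addr0 f0 addr0.
have fb x : cabs (f x) <= `|M| * norm1 x.
  apply: le_trans (fM x) _; apply: (@le_trans _ _ (`|M| * os_norm (const_mx x : 'M[predual_space R b]_1))).
    rewrite ler_wpM2r ?ler_norm //; exact: opmxnorm_ge0.
  rewrite ler_wpM2l // /= /predual_norm map_const_mx opmxnorm_const.
  exact: opnorm_uop_le.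
(* The coefficients of [T] are forced by the values of [f] on unit vectors; agreement elsewhere
   follows because finitely supported elements are dense. *)
have [T [TE _]] : exists T : A, (forall i j, chain2 b i j -> ecoef T i j = f (delta (i, j))) /\ opnorm T <= 2 * `|M|.
  apply: palg_of_coef => // i j; apply: le_trans (fb _) _.
  by rewrite ler_piMr ?norm1_delta.
exists T => //; apply/funext => x; apply/eqP; rewrite -subr_eq0 -cabs_eq0.
rewrite eq_le cabs_ge0 andbT; apply/ler_addgt0Pr => e e0; rewrite add0r.
pose C := opnorm T + `|M| + 1.
have C0 : 0 < C by have := opnorm_ge0 T; have := normr_ge0 M; rewrite /C; lra.
have [s hs] := predual_dense x (divr_gt0 e0 C0).
set y := \sum_(i <- s) _ in hs.
have Ey : pair T y = f y.
  rewrite /y; elim/big_rec: _ => [|i z _ IH].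
    by rewrite f0; apply: pairE; under eq_fun do rewrite pcoef_zero mulr0; exact: is_csum0.
  rewrite fD fZ -[LHS]/(pair T (_ *: _ + _)) pair_linear_r IH; congr (_ * _ + _).
  rewrite pair_delta; have [h|h] := boolP (chain2 b i.1 i.2).
    by rewrite TE // -surjective_pairing.
  rewrite palg_coef0 //; have -> : delta i = 0; last by rewrite f0.
  by apply: pcoef_inj => e'; rewrite pcoef_delta (negPf h) andbF pcoef_zero.
have pB : pair T (x - y) = pair T x - pair T y.
  by rewrite addrC -scaleN1r pair_linear_r -[_ *: _]/(-1 * _) mulN1r addrC.
have fB : f (x - y) = f x - f y by rewrite fD -scaleN1r fZ mulN1r.
have -> : pair T x - f x = pair T (x - y) - f (x - y) by rewrite pB fB Ey; ring.
apply: le_trans (cabsD _ _) _; rewrite cabsN.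
apply: le_trans (lerD (pair_le T (x - y)) (fb (x - y))) _.
rewrite -mulrDl; apply: (@le_trans _ _ (C * norm1 (x - y))).
  by rewrite ler_wpM2r ?norm1_ge0 // /C lerDl.
by rewrite mulrC -ler_pdivlMr.
Qed.

(** Pairing an operator with this matrix returns its upper left [m] by [m] corner. *)
Definition test_mx m : 'M[X]_m := \matrix_(k, l) delta (k : nat, l : nat).

(** In the block indexed by [a] the test matrix acts as the [m]-truncation of [a / |a|], with the
    two tensor factors exchanged, hence as a contraction. *)
Lemma test_mx_norm m : os_norm (test_mx m : 'M[predual_space R b]_m) <= 1.
Proof.
apply: opmxnorm_le => // zeta; rewrite expr1n mul1r; apply: l2_sumsq_le => -[n a].
have E k : l2_val (mxapp (map_mx (@uop R b) (test_mx m)) zeta k) (existT _ n a : blockIndex R b) =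
    (opmxnorm (map_mx op a))^-1%:C%C *: vec (fun i => \sum_(l < m) \sum_(j < n)
      ecoef (a i j) k l * ecoord (l2_val (zeta l) (existT _ n a : blockIndex R b)) j).
  rewrite /mxapp l2_sum.
  under eq_bigr do rewrite !mxE uopE.
  rewrite sum_blockE; congr (_ *: vec _); apply/funext => i.
  by apply: eq_bigr => l _; apply: eq_bigr => j _; rewrite pair_delta.
set N := opmxnorm _ in E.
pose g l : H := l2_val (zeta l) (existT _ n a : blockIndex R b).
rewrite -[leRHS]/(vnorm2 g).
(* The exchange of tensor factors: [zeta] is regrouped by the matrix index [j], and the test index
   [l] becomes a coordinate of [ell2]. *)
pose eta (j : 'I_n) : H := vec (fun l => ecoord (g l) j).
have eta_le : vnorm2 eta <= vnorm2 g.
  rewrite /vnorm2; under eq_bigr do rewrite vec_norm.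
  by rewrite exchange_big; apply: ler_sum => l _; exact: bessel.
rewrite /vnorm2; under eq_bigr do rewrite E dotnormZ exprMn vec_norm.
rewrite -mulr_sumr exchange_big /=.
have h := opmxnorm_ub (map_mx op a) eta; rewrite -/N in h.
have N0 : 0 <= N by exact: opmxnorm_ge0.
have {}h : \sum_(i < n) \sum_(k < m) cabs (\sum_(l < m) \sum_(j < n) ecoef (a i j) k l * ecoord (g l) j) ^+ 2 <= N ^+ 2 * vnorm2 g.
  apply: le_trans (le_trans h _); last by rewrite ler_wpM2l ?sqr_ge0.
  apply: ler_sum => i _; apply: le_trans (bessel m (mxapp (map_mx op a) eta i)).
  rewrite le_eqVlt; apply/orP; left; apply/eqP; apply: eq_bigr => k _; congr (cabs _ ^+ 2).
  rewrite /mxapp ecoord_sum exchange_big; apply: eq_bigr => j _.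
  rewrite mxE bop_sumr ecoord_sum; apply: eq_bigr => l _.
  by rewrite bopZ ecoordZ mulrC.
rewrite cabs_real ?invr_ge0 //.
have [N00|N00] := eqVneq N 0; first by rewrite N00 invr0 expr0n mul0r; exact: (vnorm2_ge0 g).
have Np : 0 < N by rewrite lt_neqAle eq_sym N00.
by rewrite exprVn ler_pdivrMl ?exprn_gt0.
Qed.

Lemma dual_mxnorm_set n (a : 'M[A]_n) m (x : 'M[X]_m) :
  os_norm (x : 'M[predual_space R b]_m) <= 1 ->
  scalar_mxnorm (fun p q : 'I_n * 'I_m => pair (a p.1 q.1) (x p.2 q.2)) <= opmxnorm (map_mx op a).
Proof.
move=> x1; apply: scalar_mxnorm_le => [|z]; first exact: opmxnorm_ge0.
apply: le_trans (pair_mx_le a x z) _; rewrite ler_wpM2r ?snorm2_ge0 //.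
rewrite ler_pXn2r ?nnegrE ?mulr_ge0 ?opmxnorm_ge0 //.
by rewrite ler_piMr ?opmxnorm_ge0.
Qed.

Lemma vnorm2_coord_le n (w : 'I_n -> H) M :
  (forall m, \sum_i \sum_(k < m) cabs (ecoord (w i) k) ^+ 2 <= M) -> vnorm2 w <= M.
Proof.
move=> h.
have hw : is_csum (fun k => (\sum_i cabs (ecoord (w i) k) ^+ 2)%:C%C) (vnorm2 w)%:C%C.
  have := is_csum_sum (index_enum _) xpredT (fun i => ell2_dotE (w i) (w i)).
  congr is_csum; last by rewrite rmorph_sum; apply: eq_bigr => j _; exact: dotE.
  by apply/funext => k; rewrite rmorph_sum; apply: eq_bigr => j _; exact: conjCM_cabs.
have fb : fin_bounded (fun k => \sum_i cabs (ecoord (w i) k) ^+ 2) M.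
  move=> s us; pose m := (\max_(i <- s) i).+1; apply: le_trans (h m).
  rewrite [leRHS]exchange_big /= -(big_mkord xpredT (fun k => \sum_i cabs (ecoord (w i) k) ^+ 2)).
  rewrite (sum_seq_split _ us (iota_uniq _ _)).
    by rewrite lerDl sumr_ge0 // => k _; apply: sumr_ge0 => i _; exact: sqr_ge0.
  by move=> i is_; rewrite mem_iota subn0 ltnS (leq_bigmax_seq (F := id)).
rewrite -[leLHS]cabs_real ?vnorm2_ge0 //; apply: is_csum_le fb hw => k.
by rewrite cabs_real // sumr_ge0 // => i _; exact: sqr_ge0.
Qed.

Lemma ecoord_truncated T (z : H) k m : (k.+1 < m)%N ->
  ecoord (T z) k = \sum_(l < m) ecoef T k l * ecoord z l.
Proof.
move=> km; rewrite (pattern_coord _ _ (palg_opP T)).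
have k0 : (k < m)%N := ltnW km.
rewrite (bigD1 (Ordinal k0)) //= (bigD1 (Ordinal km)) /=; last first.
  by apply/eqP => /(congr1 val) /= /eqP; rewrite gtn_eqF.
rewrite big1 ?addr0 // => l /andP[l1 l2]; rewrite palg_coef0 ?mul0r //.
rewrite negb_or negb_and; apply/andP; split.
  by apply: contra l1 => /eqP h; apply/eqP/val_inj.
by apply/orP; left; apply: contra l2 => /eqP h; apply/eqP/val_inj.
Qed.

(** The bound from above is [pair_mx_le]. From below, the test matrices are admissible and recover
    all truncations of [a], which determine its norm. *)
Lemma pair_isometry n (a : 'M[A]_n) :
  @dual_mxnorm R (predual_space R b) n (map_mx (@pair R b) a) = opmxnorm (map_mx op a).
Proof.
rewrite /dual_mxnorm; set S := (X in sup X).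
have ubS r : S r -> r <= opmxnorm (map_mx op a).
  move=> [m [x [x1 ->]]]; have := dual_mxnorm_set a x1; congr (scalar_mxnorm _ <= _).
  by apply/funext => p; apply/funext => q; rewrite mxE.
have testS m : S (scalar_mxnorm (fun p q : 'I_n * 'I_m => ecoef (a p.1 q.1) p.2 q.2)).
  exists m, (test_mx m); split; first exact: test_mx_norm.
  congr scalar_mxnorm; apply/funext => p; apply/funext => q.
  by rewrite !mxE pair_delta.
have test_le m : scalar_mxnorm (fun p q : 'I_n * 'I_m => ecoef (a p.1 q.1) p.2 q.2) <= sup S.
  by apply: ub_le_sup (testS m); exists (opmxnorm (map_mx op a)) => r /ubS.
apply/eqP; rewrite eq_le; apply/andP; split.
  by apply: ge_sup => [|r /ubS //]; exists (scalar_mxnorm (fun p q : 'I_n * 'I_0 => ecoef (a p.1 q.1) p.2 q.2)); exact: testS.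
apply: opmxnorm_le => [|xi].
  exact: le_trans (scalar_mxnorm_ge0 _) (test_le 0%N).
apply: vnorm2_coord_le => m.
(* The first [m] output coordinates involve input coordinates up to [m], since row [k] reaches
   column [k.+1]; the input is therefore truncated at [m.+1]. *)
pose z (q : 'I_n * 'I_m.+1) := ecoord (xi q.1) q.2.
have hz : snorm2 z <= vnorm2 xi.
  rewrite /snorm2 -(pair_bigA _ (fun j l => cabs (ecoord (xi j) (nat_of_ord l)) ^+ 2)) /=.
  by apply: ler_sum => j _; exact: bessel.
have h := scalar_mxnorm_ub (fun p q : 'I_n * 'I_m.+1 => ecoef (a p.1 q.1) p.2 q.2) z.
apply: le_trans (_ : _ <= snorm2 (sapp (fun p q : 'I_n * 'I_m.+1 => ecoef (a p.1 q.1) p.2 q.2) z)) _.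
  rewrite /snorm2 -(pair_bigA _ (fun i (k : 'I_m.+1) => cabs (sapp
    (fun p q : 'I_n * 'I_m.+1 => ecoef (a p.1 q.1) p.2 q.2) z (i, k)) ^+ 2)) /=.
  apply: ler_sum => i _; rewrite [leRHS]big_ord_recr /= -[leLHS]addr0 lerD ?sqr_ge0 //.
  rewrite le_eqVlt; apply/orP; left; apply/eqP; apply: eq_bigr => k _; congr (cabs _ ^+ 2).
  rewrite /mxapp ecoord_sum /sapp.
  rewrite -(pair_bigA _ (fun j (l : 'I_m.+1) => ecoef (a i j) k l * ecoord (xi j) l)) /=.
  apply: eq_bigr => j _; rewrite mxE; apply: ecoord_truncated.
  by rewrite ltnS.
apply: le_trans h _; apply: ler_pM => //; rewrite ?sqr_ge0 ?snorm2_ge0 //.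
rewrite ler_pXn2r ?nnegrE ?scalar_mxnorm_ge0 //.
exact: le_trans (scalar_mxnorm_ge0 _) (test_le m.+1).
Qed.

Lemma palg_norm_closed : norm_closed (range op).
Proof.
move=> T hT; suff TP : T \in pattern b by exists (Palg TP).
apply/asboolP => i j ij; apply/eqP; rewrite -cabs_eq0 eq_le cabs_ge0 andbT.
apply/ler_addgt0Pr => e e0; rewrite add0r; have [_ [S _ <-] h] := hT e e0.
have -> : ecoef T i j = ecoef (T - S) i j.
  by rewrite [RHS]ecoefD -scaleN1r ecoefZ palg_coef0 // mulr0 addr0.
exact: le_trans (coef_le _ _ _) (ltW h).
Qed.

Definition palg_norm n (a : 'M[A]_n) : R := opmxnorm (map_mx op a).

Lemma palg_concrete : exists L (u : {linear A -> bop L L}),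
  [/\ injective u /\ norm_closed (range u), u 1 = bid L,
      (forall S T, u (S * T) = bcomp (u S) (u T)) &
      forall n (a : 'M[A]_n), opmxnorm (map_mx u a) = palg_norm a].
Proof.
exists H, op; split => //; split; last exact: palg_norm_closed.
by move=> S T; exact: palgP.
Qed.

Definition palg_uda : unital_dual_algebra R :=
  @UnitalDualAlgebra R A palg_norm palg_concrete (predual_space R b) (@pair R b)
    (@pair_linear_l R b) pair_bij pair_isometry.

End DualAlgebra.

(** * Representations and corners *)

Section IdentityRepresentation.
Variables (R : realType) (b : bool).
Local Notation A := (palg R b).
Local Notation X := (predual R b).
Local Notation H := (ell2 R).
Local Notation op := (@palg_op R b).

Definition diag_pos (e : nat * nat) : option nat := if e.1 == e.2 then Some e.1 else None.
Definition next_pos (e : nat * nat) : option nat := if e.2 == e.1.+1 then Some e.1 else None.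

Lemma diag_posK : pcancel (fun i => (i, i)) diag_pos.
Proof. by move=> i; rewrite /diag_pos eqxx. Qed.

Lemma diag_posP e i : diag_pos e = Some i -> (i, i) = e.
Proof. by case: e => j k; rewrite /diag_pos /=; case: eqP => // -> [->]. Qed.

Lemma next_posK : pcancel (fun i => (i, i.+1)) next_pos.
Proof. by move=> i; rewrite /next_pos eqxx. Qed.

Lemma next_posP e i : next_pos e = Some i -> (i, i.+1) = e.
Proof. by case: e => j k; rewrite /next_pos /=; case: eqP => // -> [->]. Qed.

Lemma cabs_conjM_le (u v : R[i]) : cabs (u * v^*) <= 2^-1 * (cabs u ^+ 2 + cabs v ^+ 2).
Proof.
rewrite cabsM cabsJ; have := sqr_ge0 (cabs u - cabs v).
by move: (cabs u) (cabs v) => p q; lra.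
Qed.

(** The element of the predual that represents [T |-> <T x, y>]. Over all positions the products of
    coordinates need not be summable; on the order only the diagonal and part of the superdiagonal
    remain, where [2 |u v| <= |u|^2 + |v|^2] suffices. *)
Definition rank_one_coef (x y : H) (e : nat * nat) : R[i] :=
  if chain2 b e.1 e.2 then ecoord x e.2 * (ecoord y e.1)^* else 0.

Lemma rank_one_coef_bounded (x y : H) :
  fin_bounded (fun e => cabs (rank_one_coef x y e)) (hnorm x ^+ 2 + hnorm y ^+ 2).
Proof.
pose g (e : nat * nat) := 2^-1 * (cabs (ecoord x e.2) ^+ 2 + cabs (ecoord y e.1) ^+ 2).
have hx := ecoord_fin_bounded x; have hy := ecoord_fin_bounded y.
have half : 0 <= 2^-1 :> R by [].
have h1 : fin_bounded (fun e => if diag_pos e is Some _ then g e else 0)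
    (2^-1 * (hnorm x ^+ 2 + hnorm y ^+ 2)).
  apply: (fin_bounded_reindex diag_posP) => [e -> //|].
  apply: fin_boundedW (fin_boundedZ half (fin_boundedD hx hy)) => i.
  by rewrite /= diag_posK.
have h2 : fin_bounded (fun e => if next_pos e is Some _ then g e else 0)
    (2^-1 * (hnorm x ^+ 2 + hnorm y ^+ 2)).
  apply: (fin_bounded_reindex next_posP) => [e -> //|].
  apply: fin_boundedW (fin_boundedZ half (fin_boundedD (fin_bounded_inj succn_inj hx) hy)) => i.
  by rewrite /= next_posK.
have -> : hnorm x ^+ 2 + hnorm y ^+ 2 = 2^-1 * (hnorm x ^+ 2 + hnorm y ^+ 2) +
    2^-1 * (hnorm x ^+ 2 + hnorm y ^+ 2) by field.
apply: fin_boundedW (fin_boundedD h1 h2) => e.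
have g0 : 0 <= g e by rewrite /g mulr_ge0 // addr_ge0 ?sqr_ge0.
rewrite /rank_one_coef /chain2 /diag_pos /next_pos.
case: (e.1 == e.2) => /=.
  apply: le_trans (cabs_conjM_le _ _) _; rewrite lerDl.
  by case: ifP.
rewrite add0r; case: (e.2 == e.1.+1) => /=; last by rewrite cabs0.
by case: ifP => _; [exact: cabs_conjM_le|rewrite cabs0].
Qed.

Lemma rank_one_coefP (T : A) (x y : H) :
  is_csum (fun e => ecoef T e.1 e.2 * rank_one_coef x y e) (hdot H (T x) y).
Proof.
have hx := ecoord_fin_bounded x; have hy := ecoord_fin_bounded y.
have half : 0 <= 2^-1 :> R by [].
pose g1 i := ecoef T i i * (ecoord x i * (ecoord y i)^*).
pose g2 i := ecoef T i i.+1 * (ecoord x i.+1 * (ecoord y i)^*).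
have gb (u v : R[i]) i j : cabs (ecoef T i j * (u * v^*)) <=
    opnorm T * (2^-1 * (cabs u ^+ 2 + cabs v ^+ 2)).
  rewrite cabsM; apply: ler_pM; rewrite ?cabs_ge0 ?coef_le //.
  exact: cabs_conjM_le.
have c1 : is_csum g1 (csum g1).
  apply: is_csum_fin_bounded_cabs (fin_boundedZ (opnorm_ge0 T) (fin_boundedZ half (fin_boundedD hx hy))) => i.
  exact: gb.
have c2 : is_csum g2 (csum g2).
  apply: is_csum_fin_bounded_cabs (fin_boundedZ (opnorm_ge0 T) (fin_boundedZ half (fin_boundedD (fin_bounded_inj succn_inj hx) hy))) => i.
  exact: gb.
have -> : hdot H (T x) y = csum g1 + csum g2.
  apply: is_csum_unique (ell2_dotE _ _) _; have := is_csumD c1 c2.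
  congr is_csum; apply/funext => i; rewrite (pattern_coord _ _ (palg_opP T)) /g1 /g2.
  by ring.
pose G e := ecoef T e.1 e.2 * (ecoord x e.2 * (ecoord y e.1)^*).
have d1 : is_csum (fun e => if diag_pos e is Some _ then G e else 0) (csum g1).
  apply: (is_csum_reindex diag_posK diag_posP) => [e -> //|].
  by move: c1; congr is_csum; apply/funext => i; rewrite /= diag_posK.
have d2 : is_csum (fun e => if next_pos e is Some _ then G e else 0) (csum g2).
  apply: (is_csum_reindex next_posK next_posP) => [e -> //|].
  by move: c2; congr is_csum; apply/funext => i; rewrite /= next_posK.
have := is_csumD d1 d2; congr is_csum; apply/funext => e.
rewrite /rank_one_coef; case: ifP => [|/negbT h]; last first.
  by rewrite /G palg_coef0 // !mul0r; case: diag_pos; case: next_pos; rewrite addr0.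
case/orP => [/eqP h|/andP[/eqP h _]]; rewrite /diag_pos /next_pos h eqxx.
  by rewrite ltn_eqF // addr0 /G h.
by rewrite ltn_eqF // add0r /G h.
Qed.

(** The coefficient families of the vector functionals are added over [k], and [fubini] exchanges
    this sum with the one over positions. It is the w*-continuity of the identity representation. *)
Lemma normal_pairing_predual (xy : sqsum H * sqsum H) :
  exists x : X, forall T : A, normal_pairing (op T) xy = pair T x.
Proof.
have [Mx xM] := sqsum_bounded xy.1; have [My yM] := sqsum_bounded xy.2.
pose N k := hnorm (sval xy.1 k) ^+ 2 + hnorm (sval xy.2 k) ^+ 2.
pose F k e := rank_one_coef (sval xy.1 k) (sval xy.2 k) e.
have FN k : fin_bounded (fun e => cabs (F k e)) (N k) by exact: rank_one_coef_bounded.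
have NM : fin_bounded N (Mx + My) by exact: fin_boundedD.
have [x xE] : exists x : X, forall e, pcoef x e = csum (F ^~ e).
  apply: predual_exists (fubini_summable FN NM) _ => e he.
  by apply: csumE; under eq_fun do rewrite /F /rank_one_coef (negPf he); exact: is_csum0.
exists x => T; rewrite normal_pairingE; symmetry; apply: pairE.
pose G k e := ecoef T e.1 e.2 * F k e.
have GN k : fin_bounded (fun e => cabs (G k e)) (opnorm T * N k).
  apply: fin_boundedW (fin_boundedZ (opnorm_ge0 T) (FN k)) => e.
  by rewrite cabsM ler_wpM2r ?cabs_ge0 ?coef_le.
have := fubini GN (fin_boundedZ (opnorm_ge0 T) NM).
congr is_csum; last by congr csum; apply/funext => k; exact/csumE/rank_one_coefP.
apply/funext => e; rewrite xE; apply: csumE; apply: is_csumZ.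
exact: is_csum_fin_bounded_cabs (fubini_term FN ^~ e) NM.
Qed.

(** These vector functionals cut out the algebra, which is thereby w*-closed. *)
Definition off_pattern : set (H * H) :=
  [set p | exists i j, ~~ chain2 b i j /\ p = (be R j, be R i)].

Lemma range_palg_op : range op = [set T | forall p, off_pattern p -> hdot H (T p.1) p.2 = 0].
Proof.
rewrite eqEsubset; split.
  by move=> _ [T _ <-] _ [i [j [ij ->]]] /=; rewrite -ecoefE palg_coef0.
move=> T hT; suff TP : T \in pattern b by exists (Palg TP).
by apply/asboolP => i j ij; rewrite ecoefE; apply: (hT (be R j, be R i)); exists i, j.
Qed.

Lemma palg_op_normal_rep : @normal_rep R (palg_uda R b) H op.
Proof.
split => //.
- apply: continuous_to_initial => xy.
  have [x hx] := normal_pairing_predual xy.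
  rewrite (_ : (fun T => _) = (fun T : uda_wstar (palg_uda R b) => pair T x : Cplx R)); last exact/funext.
  exact: (@initial_eval_continuous (uda_alg (palg_uda R b)) _ (Cplx R)
    (@uda_pair R (palg_uda R b)) x).
split.
- split; first by exists 0.
  by move=> a _ _ [S _ <-] [T _ <-]; exists (a *: S + T).
- by exists 1.
- by move=> _ _ [S _ <-] [T _ <-]; exists (S * T).
exact: closed_of_dot0 range_palg_op.
Qed.

End IdentityRepresentation.

(** * Compressions along order embeddings *)

Section Corners.
Variables (R : realType) (b b' : bool) (sigma : nat -> nat) (tau : nat -> option nat).
Hypothesis sigmaK : pcancel sigma tau.
Hypothesis tauK : forall i j, tau i = Some j -> sigma j = i.
Hypothesis chainE : forall i j, chain2 b' i j = chain2 b (sigma i) (sigma j).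
Local Notation H := (ell2 R).

Lemma push_exists : exists V : bop H H, forall x i,
  ecoord (V x) i = if tau i is Some j then ecoord x j else 0.
Proof.
apply: (@bop_of_coords R H (fun x i => if tau i is Some j then ecoord x j else 0) 1) => [i a u v|x].
  by case: (tau i) => [j|]; rewrite ?ecoordD ?ecoordZ // mulr0 addr0.
rewrite mul1r; apply: (fin_bounded_reindex tauK) => [i ->|]; first by rewrite cabs0 expr0n.
apply: fin_boundedW (ecoord_fin_bounded x) => i /=.
by rewrite sigmaK.
Qed.

Lemma pull_exists : exists W : bop H H, forall x i, ecoord (W x) i = ecoord x (sigma i).
Proof.
apply: (@bop_of_coords R H (fun x i => ecoord x (sigma i)) 1) => [i a u v|x].
  by rewrite ecoordD ecoordZ.
rewrite mul1r; exact: fin_bounded_inj (pcan_inj sigmaK) (ecoord_fin_bounded x).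
Qed.

(** The isometry [V : e_i |-> e_(sigma i)] has range projection [p = V W] with [W] its adjoint.
    Since [sigma] preserves and reflects the order, conjugation by [V] carries the algebra of [b']
    onto the corner at [p]. *)
Lemma delta_sub_of_embedding : delta_sub (palg_uda R b') (palg_uda R b).
Proof.
have [V VE] := push_exists; have [W WE] := pull_exists.
have VW : is_adjoint V W.
  move=> x y; apply: is_csum_unique (ell2_dotE _ _) _.
  apply: (is_csum_reindex sigmaK tauK) => [i ti|]; first by rewrite VE ti mul0r.
  have := ell2_dotE x (W y); congr is_csum; apply/funext => i /=.
  by rewrite VE sigmaK WE.
pose p := bcomp V W.
have pE x i : ecoord (p x) i = if tau i is Some j then ecoord x i else 0.
  by rewrite VE; case E : (tau i) => [j|//]; rewrite WE (tauK E).
have WV x : W (V x) = x by apply: ecoord_inj => i; rewrite WE VE sigmaK.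
have pV x : p (V x) = V x by rewrite /p /= WV.
have pproj : is_projection p.
  split; first by apply: bopP => x; rewrite /p /= WV.
  exact: is_adjoint_comp VW (is_adjoint_sym VW).
have pA : p \in pattern b.
  apply/asboolP => i j ij; rewrite /ecoef pE; case: (tau i) => // k.
  rewrite ecoord_be; case: eqP ij => // ->; by rewrite chain2_refl.
pose L := fix_hilbert p.
have fixL (y : L) : p (fix_val y) = fix_val y by have /eqP := fix_valP y.
have Vfix x : V x \in fix_pred p by apply/eqP; exact: pV.
pose u (x : H) : L := Fixspace (Vfix x).
have ub : u \in @bounded_op_pred R H L.
  have [M VM] := bop_bounded V; apply/asboolP; split; last by exists M.
  by move=> a x y; apply: val_inj; exact: (bop_linear V).
pose U : bop H L := Bop ub.
have wb : (fun y : L => W (fix_val y)) \in @bounded_op_pred R L H.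
  have [M WM] := bop_bounded W; apply/asboolP; split; last first.
    by exists M => y; exact: WM.
  by move=> a x y; exact: (bop_linear W a (fix_val x) (fix_val y)).
pose U' : bop L H := Bop wb.
have UU' : is_adjoint U U' by move=> x y; exact: VW.
have U'U x : U' (U x) = x by exact: WV.
have UU'1 y : U (U' y) = y by apply: val_inj; rewrite /= -[RHS]fixL.
pose BB := range (@palg_op R b'); pose CC := corner (range (@palg_op R b)) (p := p).
(* [U] is [V] regarded as a unitary onto [p(H)]; a unitary equivalence is a TRO equivalence through
   the line spanned by the unitary. *)
pose M := [set c *: U | c in [set: R[i]]].
have adjM (Z : bop L H) : adjoints M Z <-> exists c, Z = c *: U'.
  split; first by move=> [_ [c _ <-] h]; exists c^*; apply: adjoint_unique h (is_adjointZ c UU').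
  by move=> [c ->]; exists (c^* *: U); [exists c^*|have := is_adjointZ c^* UU'; rewrite conjCK].
have in_BB (T : bop H H) : T \in pattern b' -> BB T by move=> h; exists (Palg h).
have BC T : BB T -> CC (bcomp U (bcomp T U')).
  move=> [S _ <-]; have aP : bcomp V (bcomp (palg_op S) W) \in pattern b.
    apply/asboolP => k l kl; rewrite /ecoef /= VE.
    case Ek : (tau k) => [i|//]; case El : (tau l) => [j|]; last first.
      have -> : W (be R l) = 0.
        apply: ecoord_inj => m; rewrite WE ecoord_be ecoord0; case: eqP => // h.
        by rewrite -h sigmaK in El.
      by rewrite bop0 ecoord0.
    have -> : W (be R l) = be R j.
      apply: ecoord_inj => m; rewrite WE !ecoord_be -(tauK El).
      by rewrite (inj_eq (pcan_inj sigmaK)).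
    by apply: palg_coef0; rewrite chainE (tauK Ek) (tauK El).
  by exists (bcomp V (bcomp (palg_op S) W)); [exists (Palg aP)|move=> x; symmetry; exact: (pV (palg_op S (W (fix_val x))))].
(* Describing the corner by vanishing matrix coefficients shows that it is w*-closed, so that taking
   w*-closed spans changes nothing. *)
have CB (S : bop L L) : (forall i j, ~~ chain2 b' i j -> hdot L (S (U (be R j))) (U (be R i)) = 0) <-> CC S.
  split=> [h|[_ [a _ <-] hS] i j ij].
    have -> : S = bcomp U (bcomp (bcomp U' (bcomp S U)) U').
      by apply: bopP => y; symmetry; exact: (etrans (UU'1 _) (congr1 (S : L -> L) (UU'1 y))).
    apply: BC; apply: in_BB; apply/asboolP => i j ij.
    by rewrite ecoefE; have := is_adjoint_sym UU' (S (U (be R j))) (be R i); rewrite h.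
  have -> : hdot L (S (U (be R j))) (U (be R i)) = hdot H (p (a (V (be R j)))) (V (be R i)).
    exact: (congr1 (fun v => hdot H v (V (be R i))) (hS (U (be R j)))).
  rewrite (pproj.2 _ _) pV.
  have VB k : V (be R k) = be R (sigma k).
    apply: ecoord_inj => m; rewrite VE ecoord_be; case E : (tau m) => [n|].
      by rewrite ecoord_be -(tauK E) (inj_eq (pcan_inj sigmaK)).
    by case: eqP => // h; rewrite h sigmaK in E.
  by rewrite !VB -ecoefE palg_coef0 // -chainE.
have BBsub : is_subspace BB.
  split; first by exists 0.
  by move=> a _ _ [S _ <-] [T _ <-]; exists (a *: S + T).
have BBZ c T : BB T -> BB (c *: T).
  by move=> hT; have := BBsub.2 c _ _ hT BBsub.1; rewrite addr0.
have CBB (S : bop L L) : CC S -> BB (bcomp U' (bcomp S U)).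
  move=> /CB hS; apply: in_BB; apply/asboolP => i j ij.
  by rewrite ecoefE; have := is_adjoint_sym UU' (S (U (be R j))) (be R i); rewrite hS.
have E1 : triple_prod (adjoints M) CC M = BB.
  rewrite eqEsubset; split.
    move=> _ [x [S [z [/adjM[c ->] hS [d _ <-] ->]]]].
    by rewrite bcompZr bcompZl bcompZr; do 2 apply: (BBZ); exact: CBB.
  move=> T hT; exists U', (bcomp U (bcomp T U')), U; split.
  - by apply/adjM; exists 1; rewrite scale1r.
  - exact: BC.
  - by exists 1 => //; rewrite scale1r.
  - by apply: bopP => x; symmetry; exact: (etrans (U'U _) (congr1 (T : H -> H) (U'U x))).
have E2 : triple_prod M BB (adjoints M) = CC.
  rewrite eqEsubset; split.
    move=> _ [x [T [z [[c _ <-] hT /adjM[d ->] ->]]]].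
    have -> : bcomp (c *: U) (bcomp T (d *: U')) = bcomp U (bcomp (c *: (d *: T)) U').
      apply: bopP => y; transitivity (c *: (d *: U (T (U' y)))).
        exact: (congr1 (fun v => c *: v) (etrans (congr1 (U : H -> L) (bopZ T d (U' y))) (bopZ U d _))).
      exact/esym/(etrans (bopZ U c _) (congr1 (fun v => c *: v) (bopZ U d _))).
    by apply: BC; do 2 apply: (BBZ).
  move=> S hS; exists U, (bcomp U' (bcomp S U)), U'; split.
  - by exists 1 => //; rewrite scale1r.
  - exact: CBB.
  - by apply/adjM; exists 1; rewrite scale1r.
  - by apply: bopP => y; symmetry; exact: (etrans (UU'1 _) (congr1 (S : L -> L) (UU'1 y))).
have wB : wspan BB = BB by exact: wspan_of_dot0 (range_palg_op R b').
have wC : wspan CC = CC.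
  pose P : set (L * L) := [set q | exists i j, ~~ chain2 b' i j /\ q = (U (be R j), U (be R i))].
  apply: (@wspan_of_dot0 _ _ _ _ P); rewrite eqEsubset; split=> S hS.
    by move=> _ [i [j [ij ->]]] /=; move: i j ij; apply/CB.
  by apply/CB => i j ij; apply: (hS (U (be R j), U (be R i))); exists i, j.
exists H, H, (@palg_op R b), (@palg_op R b'); split.
- exact: palg_op_normal_rep.
- exact: palg_op_normal_rep.
exists p; split => //; first by exists (Palg pA).
exists M; split; last by rewrite E2 wC.
  split; first split.
  - by exists 0 => //; rewrite scale0r.
  - by move=> a _ _ [c _ <-] [d _ <-]; exists (a * c + d) => //; rewrite scalerDl scalerA.
  move=> _ _ _ m2' [c1 _ <-] [c2 _ <-] [c3 _ <-] h.
  have -> : m2' = c2^* *: U' by exact: adjoint_unique h (is_adjointZ c2 UU').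
  exists (c1 * (c2^* * c3)) => //.
  rewrite bcompZl bcompZr; rewrite !bcompZl !bcompZr !scalerA.
  rewrite mulrCA [c2^* * _]mulrC; congr (_ *: _); apply: bopP => x; symmetry; exact: (congr1 (U : H -> L) (U'U x)).
by rewrite E1 wB.
Qed.

End Corners.

(** * Failure of equivalence *)

Section MatrixUnits.
Variables (R : realType) (b : bool).
Local Notation A := (palg R b).
Local Notation H := (ell2 R).
Local Notation E i j := (brank1 (be R i) (be R j)).

Lemma ecoef_unit i j k l : ecoef (E i j) k l = ((k == i) && (l == j))%:R.
Proof.
have -> : ecoef (E i j) k l = ecoord (hdot H (be R l) (be R j) *: be R i) k by [].
by rewrite ecoordZ -ecoordE !ecoord_be [j == l]eq_sym -natrM mulnb andbC.
Qed.

Lemma unit_pattern i j : chain2 b i j -> E i j \in pattern b.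
Proof.
move=> ij; apply/asboolP => k l kl; rewrite ecoef_unit.
by case: eqP kl => //= ->; case: eqP => //= ->; rewrite ij.
Qed.

Definition punit i j (ij : chain2 b i j) : A := Palg (unit_pattern ij).
Definition pdiag k : A := punit (chain2_refl b k).

Lemma unit_corner (T : bop H H) k l :
  bcomp (E k k) (bcomp T (E l l)) = ecoef T k l *: E k l.
Proof.
apply: bopP => x; rewrite bopZl /= /rank1 bopZ dotZl -ecoefE scalerA.
by rewrite mulrC.
Qed.

Lemma pdiag_corner (T : A) k l : pdiag k * T * pdiag l = T -> T != 0 -> chain2 b k l.
Proof.
move=> h T0; apply: contraT => kl; case/eqP: T0; rewrite -h; apply: palgP.
by rewrite /= -bcompA unit_corner palg_coef0 // scale0r.
Qed.

Lemma punitM i j k l (ij : chain2 b i j) (kl : chain2 b k l) (il : chain2 b i l) :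
  punit ij * punit kl = (j == k)%:R *: punit il.
Proof.
apply: palgP; apply: bopP => x.
transitivity (hdot H (hdot H x (be R l) *: be R k) (be R j) *: be R i) => //.
by rewrite dotZl -[hdot H (be R k) _]ecoordE ecoord_be mulrC -scalerA.
Qed.

Lemma punit_neq0 i j (ij : chain2 b i j) : punit ij != 0.
Proof.
apply/eqP => /(congr1 (fun T : A => ecoef T i j)); rewrite ecoef_unit ecoef0 !eqxx.
by move/eqP; rewrite oner_eq0.
Qed.

Lemma pdiag_norm k : opnorm (pdiag k) <= 1.
Proof.
apply: opnorm_le => // x; rewrite /= /rank1 dotnormZ be_norm mulr1 mul1r -ecoordE.
exact: ecoord_norm.
Qed.

Lemma pdiagM k : pdiag k * pdiag k = pdiag k.
Proof. by rewrite (punitM _ _ (chain2_refl b k)) eqxx scale1r. Qed.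

Lemma pdiagMl k l (kl : chain2 b k l) : pdiag k * punit kl = punit kl.
Proof. by rewrite (punitM _ _ kl) eqxx scale1r. Qed.

Lemma pdiagMr k l (kl : chain2 b k l) : punit kl * pdiag l = punit kl.
Proof. by rewrite (punitM _ _ kl) eqxx scale1r. Qed.

Lemma punit_pdiag0 k l (kl : chain2 b k l) : k != l -> punit kl * pdiag k = 0.
Proof. by move=> h; rewrite (punitM _ _ (chain2_refl b k)) eq_sym (negPf h) scale0r. Qed.

Lemma pdiag_punit0 k l (kl : chain2 b k l) : k != l -> pdiag l * punit kl = 0.
Proof. by move=> h; rewrite (punitM _ _ (chain2_refl b l)) eq_sym (negPf h) scale0r. Qed.

(** Being contractive, [p] is self-adjoint, and antisymmetry of the order makes it diagonal. A
    nonzero diagonal entry, at [k] say, equals 1, whence [p E_kk p = E_kk]; minimality then makes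
    [E_kk] a multiple of [p], with factor 1. *)
Lemma minimal_idempotent (p : A) : p * p = p -> opnorm p <= 1 -> p != 0 ->
  (forall a : A, exists c, p * a * p = c *: p) -> exists k, p = pdiag k.
Proof.
move=> pp p1 p0 pmin.
have pp' : bcomp (palg_op p) (palg_op p) = palg_op p by rewrite -palg_opM pp.
have padj : is_adjoint (palg_op p) (palg_op p).
  apply: contractive_idempotent => // x; apply: le_trans (opnorm_ub _ _) _.
  by rewrite ler_piMl ?dotnorm_ge0.
have off i j : i != j -> ecoef p i j = 0.
  move=> ij; have [cij|cij] := boolP (chain2 b i j); last exact: palg_coef0.
  rewrite (coef_adjoint _ _ padj) palg_coef0 ?conjC0 //.
  by apply: contra ij => cji; rewrite (chain2_antisym cij cji).
have pbe k : palg_op p (be R k) = ecoef p k k *: be R k.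
  apply: ecoord_inj => i; rewrite ecoordZ ecoord_be.
  case: eqP => [->|/eqP ik]; first by rewrite mulr1.
  by rewrite mulr0; exact: off.
have [k pk] : exists k, ecoef p k k != 0.
  apply: contrapT => hk; case/eqP: p0; apply: palgP; apply: coef_inj => i j.
  rewrite ecoef0; have [<-|ij] := eqVneq i j; last exact: off.
  by apply/eqP/negPn/negP => h; apply: hk; exists i.
have pk1 : ecoef p k k = 1.
  have := congr1 (fun T : bop H H => ecoef T k k) pp'.
  rewrite {1}/ecoef /= pbe bopZ ecoordZ -[ecoord _ _]/(ecoef p k k) => h.
  by apply: (mulfI pk); rewrite mulr1.
have [c hc] := pmin (pdiag k).
have pkp : p * pdiag k * p = pdiag k.
  apply: palgP; apply: bopP => x; rewrite /= /rank1 bopZ pbe pk1 scale1r.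
  by rewrite padj pbe pk1 scale1r.
exists k; rewrite pkp in hc.
have := congr1 (fun T : A => ecoef T k k) hc.
by rewrite ecoef_unit !eqxx /= ecoefZ pk1 mulr1 => c1; rewrite hc -c1 scale1r.
Qed.

End MatrixUnits.

(** * Matrix units in an arbitrary normal representation *)

Section NormalRepresentations.
Variables (R : realType) (b : bool) (L : hilbert R) (alpha : {linear palg_uda R b -> bop L L}).
Hypothesis ralpha : normal_rep alpha.
Local Notation A := (palg R b).

Lemma repM (S T : A) : alpha (S * T) = bcomp (alpha S) (alpha T).
Proof. by case: ralpha => h _ _ _; exact: h. Qed.

Lemma rep_opnorm (T : A) : opnorm (alpha T) = opnorm (palg_op T).
Proof.
case: ralpha => _ /(_ 1%N (const_mx T)) + _ _.
by rewrite /= /palg_norm !map_const_mx !opmxnorm_const.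
Qed.

Lemma rep_eq0 (T : A) : alpha T = 0 -> T = 0.
Proof.
move=> h; apply: palgP; apply: opnorm_eq0; rewrite -rep_opnorm h.
by apply: opnorm_le => // x; rewrite bop0l dotnorm0 mul0r.
Qed.

Lemma rep_inj (S T : A) : alpha S = alpha T -> S = T.
Proof.
move=> h; apply/eqP; rewrite -subr_eq0; apply/eqP/rep_eq0.
by rewrite [LHS](linearB alpha) h subrr.
Qed.

Lemma rep_pdiag_adjoint k : is_adjoint (alpha (pdiag R b k)) (alpha (pdiag R b k)).
Proof.
apply: contractive_idempotent; first by rewrite -repM pdiagM.
move=> x; apply: le_trans (opnorm_ub _ _) _; rewrite rep_opnorm.
by rewrite ler_piMl ?dotnorm_ge0 // pdiag_norm.
Qed.

(** Pulled back along the injective [alpha], the two relations place a nonzero element in the corner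
    between [E_kk] and [E_ll], which is zero unless [k] is below [l]. The order is thus visible in
    every representation. *)
Lemma rep_corner_chain (S : bop L L) k l : range alpha S -> S != 0 ->
  bcomp (alpha (pdiag R b k)) S = S -> bcomp S (alpha (pdiag R b l)) = S ->
  chain2 b k l.
Proof.
move=> [T _ <-] T0 hk hl; apply: (@pdiag_corner R b T).
  by apply: rep_inj; rewrite !repM hk hl.
by apply: contra_neq T0 => ->; rewrite linear0.
Qed.

(** The adjoint of a represented strict matrix unit would lie in the opposite corner of the algebra,
    against antisymmetry. *)
Lemma rep_not_selfadjoint : ~ is_selfadjoint (range alpha).
Proof.
(* Read as a number, [b] is the lower index of the first two-element chain: 0 for [false], 1 for
   [true]. *)
move=> sa; have kl : chain2 b b b.+1 by rewrite chain2S oddb.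
pose T := alpha (punit R kl); have [S TS] := adjoint_exists T.
have Sr : range alpha S by apply: sa; exists T => //; exists (punit R kl).
have T0 : T != 0 by apply: contra_neq (punit_neq0 R kl); exact: rep_eq0.
have S0 : S != 0 by rewrite -(is_adjoint_eq0 TS).
have h1 : bcomp (alpha (pdiag R b b.+1)) S = S.
  refine (adjoint_unique _ TS); rewrite /T -{1}(pdiagMr R kl) repM.
  exact: is_adjoint_comp TS (rep_pdiag_adjoint _).
have h2 : bcomp S (alpha (pdiag R b b)) = S.
  refine (adjoint_unique _ TS); rewrite /T -{1}(pdiagMl R kl) repM.
  exact: is_adjoint_comp (rep_pdiag_adjoint _) TS.
have := chain2_antisym kl (rep_corner_chain Sr S0 h1 h2).
by move/n_Sn.
Qed.

(** A projection is contractive, and [alpha] is isometric and injective, so the preimage is a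
    contractive minimal idempotent of the algebra, to which [minimal_idempotent] applies. *)
Lemma rep_projection (e : bop L L) : range alpha e -> bcomp e e = e ->
  is_adjoint e e -> e != 0 ->
  (forall a, range alpha a -> exists c, bcomp e (bcomp a e) = c *: e) ->
  exists k, e = alpha (pdiag R b k).
Proof.
move=> [p _ <-] pp padj p0 pmin.
have [k ->] : exists k, (p : A) = pdiag R b k; last by exists k.
apply: minimal_idempotent.
- by apply: rep_inj; rewrite repM pp.
- rewrite -rep_opnorm; apply: opnorm_le => // x; rewrite mul1r.
  have [->|h] := eqVneq (hnorm (alpha p x)) 0; first exact: dotnorm_ge0.
  have hp : 0 < hnorm (alpha p x) by rewrite lt_neqAle eq_sym h dotnorm_ge0.
  rewrite -(ler_pM2l hp) -expr2 -[leLHS]cabs_real ?sqr_ge0 // -dotE padj.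
  have -> : alpha p (alpha p x) = alpha p x by rewrite -[in RHS]pp.
  by apply: le_trans (dot_CS _ _ _) _; rewrite mulrC.
- by apply: contra_neq p0 => ->; rewrite linear0.
move=> a; have [|c hc] := pmin (alpha a); first by exists a.
exists c; apply: rep_inj; rewrite !repM -bcompA hc.
exact/esym/linearZ.
Qed.

End NormalRepresentations.

(** * Minimal central projections under a TRO equivalence *)

Section TROEquivalence.
Variables (R : realType) (H K : hilbert R).
Variables (AA : set (bop H H)) (BB : set (bop K K)) (M : set (bop H K)).
Hypothesis algA : unital_wclosed_algebra AA.
Hypothesis algB : unital_wclosed_algebra BB.
Hypothesis AE : AA = wspan (triple_prod (adjoints M) BB M).
Hypothesis BE : BB = wspan (triple_prod M AA (adjoints M)).
Variable z : bop K K.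
Hypothesis Bz : BB z.
Hypothesis zz : bcomp z z = z.
Hypothesis zadj : is_adjoint z z.
Hypothesis z0 : z != 0.
Hypothesis zl : forall t, BB t -> exists c, bcomp z t = c *: z.
Hypothesis zr : forall t, BB t -> exists c, bcomp t z = c *: z.

Lemma algZ (L : hilbert R) (CC : set (bop L L)) : unital_wclosed_algebra CC ->
  forall c T, CC T -> CC (c *: T).
Proof. by move=> [[C0 CD] _ _ _] c T hT; have := CD c T 0 hT C0; rewrite addr0. Qed.

Lemma TRO_mul_adj (m n : bop H K) (n' : bop K H) : M m -> M n -> is_adjoint n n' -> BB (bcomp m n').
Proof.
move=> Mm Mn nn'; rewrite BE; apply: sub_wspan; exists m, (bid H), n'; split => //.
- by case: algA.
- by exists n.
- by rewrite bcomp1l.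
Qed.

Lemma TRO_adj_mul (m n : bop H K) (m' : bop K H) t : M m -> M n -> is_adjoint m m' -> BB t ->
  AA (bcomp m' (bcomp t n)).
Proof.
move=> Mm Mn mm' Bt; rewrite AE; apply: sub_wspan; exists m', t, n; split => //.
by exists m.
Qed.

(** If [z] annihilated [M], the vector functionals [t |-> <t x, z y>] would vanish on the products
    that span [BB], hence at [z], and [z = z z] would be zero. *)
Lemma TRO_z_meets : exists m, M m /\ bcomp z m != 0.
Proof.
apply: contrapT => hM; case/eqP: z0.
have zM m : M m -> bcomp z m = 0.
  by move=> Mm; apply/eqP/negPn/negP => h; apply: hM; exists m.
apply: bopP => x; apply: (@dot_eq0 _ _ (hdot K)) => y.
have -> : hdot K (z x) y = hdot K (z x) (z y) by rewrite -zadj -{1}zz.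
have : wspan (triple_prod M AA (adjoints M)) z by rewrite -BE.
apply: wspan_dot0 => _ [m [a [n' [Mm _ _ ->]]]].
by rewrite -zadj -[z _]/(bcomp z m (a (n' x))) zM // bop0l linear0l.
Qed.

(* [m* z m] is a positive multiple of a projection since [z BB z = C z]. *)
Lemma TRO_projection (m : bop H K) (m' : bop K H) : M m -> is_adjoint m m' -> bcomp z m != 0 ->
  exists e : bop H H, [/\ AA e, bcomp e e = e, is_adjoint e e & e != 0] /\
    [/\ bcomp (bcomp z m) e = bcomp z m,
        exists c, e = c *: bcomp m' (bcomp z m) &
        forall a, AA a -> exists c, bcomp e (bcomp a e) = c *: e].
Proof.
move=> Mm mm' zm0; have [l hl] := zl (TRO_mul_adj Mm Mm mm').
pose c := bcomp m' (bcomp z m).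
have zmadj : is_adjoint (bcomp z m) (bcomp m' z) := is_adjoint_comp zadj mm'.
have cE : c = bcomp (bcomp m' z) (bcomp z m) by rewrite /c -bcompA (bcompA z) zz.
have cadj : is_adjoint c c.
  rewrite cE; exact: is_adjoint_comp (is_adjoint_sym zmadj) zmadj.
have c0 : c != 0.
  by apply: contra_neq zm0 => h; apply: adjoint_mul_eq0 zmadj _; rewrite -cE.
have zmc : bcomp (bcomp z m) c = l *: bcomp z m.
  by rewrite /c -bcompA (bcompA m) (bcompA z) hl bcompZl bcompA zz.
have cc : bcomp c c = l *: c.
  by rewrite {1}cE -bcompA zmc bcompZr -cE.
have l0 : l != 0.
  by apply: contra_neq c0 => h; apply: adjoint_mul_eq0 cadj _; rewrite cc h scale0r.
have lr : l^* = l.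
  have := is_adjoint_comp cadj cadj; rewrite cc => h.
  have := adjoint_unique (is_adjointZ l cadj) h => /eqP.
  by rewrite -subr_eq0 -scalerBl scaler_eq0 (negPf c0) orbF subr_eq0 => /eqP.
have Ac : AA c by apply: (TRO_adj_mul Mm Mm mm' Bz).
exists (l^-1 *: c); split; split.
- exact: algZ algA _ _ Ac.
- by rewrite bcompZl bcompZr cc !scalerA -mulrA mulVf // mulr1.
- have := is_adjointZ l^-1 cadj; suff -> : (l^-1)^* = l^-1 by [].
  by apply: (mulfI l0); rewrite -{1}lr -rmorphM mulfV // rmorph1.
- by rewrite scaler_eq0 invr_eq0 (negPf l0).
- by rewrite bcompZr zmc scalerA mulVf // scale1r.
- by exists l^-1.
(* Minimality of [e]: the product [e a e] contains [z m a m' z], and [m a m'] lies in [BB], so this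
   factor is a multiple of [z]. *)
move=> a Aa.
have Bt : BB (bcomp m (bcomp a m')).
  by rewrite BE; apply: sub_wspan; exists m, a, m'; split => //; exists m.
have [k hk] := zl Bt; exists (l^-1 * k).
have hz : bcomp z (bcomp m (bcomp a (bcomp m' (bcomp z m)))) = k *: bcomp z m.
  have -> : bcomp m (bcomp a (bcomp m' (bcomp z m))) = bcomp (bcomp m (bcomp a m')) (bcomp z m).
    by rewrite !bcompA.
  by rewrite bcompA hk bcompZl bcompA zz.
rewrite bcompZl !bcompZr scalerA.
have -> : bcomp c (bcomp a c) = k *: c.
  by rewrite {1}cE -!bcompA (bcompA z z) zz hz bcompZr -/c.
by rewrite !scalerA; congr (_ *: _); ring.
Qed.

Section Block.
Variables (m : bop H K) (m' : bop K H) (e : bop H H).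
Hypothesis Mm : M m.
Hypothesis mm' : is_adjoint m m'.
Hypothesis eadj : is_adjoint e e.
Hypothesis eE : exists c, e = c *: bcomp m' (bcomp z m).
Hypothesis block : forall n, M n -> bcomp (bcomp m' (bcomp z n)) e = bcomp m' (bcomp z n).

(** On a spanning product [n' s q] the factor [z m n' s] collapses to a multiple of [z], so
    [e n' s q] is a multiple of [m' z q], which [e] fixes from the right by [block]. The other side
    follows by taking adjoints. Together the two equations say that [e] commutes with [AA]. *)
Lemma TRO_corner t : AA t ->
  bcomp (bcomp e t) e = bcomp e t /\ bcomp e (bcomp t e) = bcomp t e.
Proof.
move=> At; have [c ec] := eE.
have h t' : triple_prod (adjoints M) BB M t' ->
    bcomp (bcomp e t') e = bcomp e t' /\ bcomp e (bcomp t' e) = bcomp t' e.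
  move=> [n' [s [q [[n Mn nn'] Bs Mq ->]]]]; split.
    have B1 : BB (bcomp (bcomp m n') s).
      by case: algB => _ _ hB _; apply: hB => //; exact: TRO_mul_adj nn'.
    have [k hk] := zl B1.
    have -> : bcomp e (bcomp n' (bcomp s q)) = (c * k) *: bcomp m' (bcomp z q).
      rewrite ec bcompZl -bcompA.
      have -> : bcomp (bcomp z m) (bcomp n' (bcomp s q)) = bcomp (bcomp z (bcomp (bcomp m n') s)) q.
        by rewrite !bcompA.
      by rewrite hk bcompZl bcompZr scalerA.
    by rewrite bcompZl block.
  have B1 : BB (bcomp s (bcomp q m')).
    by case: algB => _ _ hB _; apply: hB => //; exact: TRO_mul_adj mm'.
  have [k hk] := zr B1.
  have -> : bcomp (bcomp n' (bcomp s q)) e = (c * k) *: bcomp n' (bcomp z m).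
    rewrite ec bcompZr.
    have -> : bcomp (bcomp n' (bcomp s q)) (bcomp m' (bcomp z m)) =
        bcomp n' (bcomp (bcomp (bcomp s (bcomp q m')) z) m) by rewrite !bcompA.
    by rewrite hk bcompZl bcompZr scalerA.
  rewrite bcompZr; congr (_ *: _).
  have sn := is_adjoint_comp (is_adjoint_sym mm') (is_adjoint_comp zadj nn').
  have := is_adjoint_comp sn eadj; rewrite block // => h1.
  by have := adjoint_unique h1 sn; rewrite -!bcompA.
have Wt : wspan (triple_prod (adjoints M) BB M) t by rewrite -AE.
(* The relations [e t (e - 1) = 0] and [(e - 1) t e = 0] are stated through vector functionals in
   order to pass to the w*-closed span. *)
have c1 x y : hdot H (t (e x - x)) (e y) = 0.
  apply: wspan_dot0 Wt => S /h[hS _]; rewrite bopB linearBl /= -!eadj.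
  by rewrite -[e (S (e x))]/(bcomp (bcomp e S) e x) hS subrr.
have c2 x y : hdot H (t (e x)) (e y - y) = 0.
  apply: wspan_dot0 Wt => S /h[_ hS]; rewrite linearBr /= -eadj.
  by rewrite -[e (S (e x))]/(bcomp e (bcomp S e) x) hS subrr.
split; apply: bopP => x; apply: (@dot_inj _ _ (hdot H)) => y.
  have := c1 x y; rewrite bopB linearBl /= -!eadj => /eqP.
  by rewrite subr_eq0 => /eqP.
have := c2 x y; rewrite linearBr /= -eadj => /eqP.
by rewrite subr_eq0 => /eqP.
Qed.

End Block.

End TROEquivalence.

(** * Comparison of the two algebras *)

Section NonEquivalence.
Variable R : realType.

(** For [b = true] the index 0 is comparable only to itself, so row and column 0 of an element
    contain nothing but the entry at [(0, 0)]. *)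
Lemma rep_pdiag0_mul (L : hilbert R) (beta : {linear palg_uda R true -> bop L L}) :
  normal_rep beta -> forall t, range beta t ->
  (exists c, bcomp (beta (pdiag R true 0)) t = c *: beta (pdiag R true 0)) /\
  (exists c, bcomp t (beta (pdiag R true 0)) = c *: beta (pdiag R true 0)).
Proof.
move=> rb _ [T _ <-]; pose z : palg R true := pdiag R true 0.
have hl : z * (T : palg R true) = ecoef (palg_op T) 0 0 *: z.
  apply: palg_ext => i j ij; rewrite ecoefZ ecoef_unit.
  have -> : ecoef (palg_op (z * (T : palg R true))) i j = ecoef (palg_op T) 0 j * (i == 0%N)%:R.
    transitivity (ecoord (hdot _ (palg_op T (be R j)) (be R 0) *: be R 0) i) => //.
    by rewrite ecoordZ -ecoordE ecoord_be.
  case: eqP ij => [->|_] ij; last by rewrite !mulr0.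
  by move: ij; rewrite /chain2 /= andbF orbF eq_sym => /eqP ->; rewrite eqxx.
have hr : (T : palg R true) * z = ecoef (palg_op T) 0 0 *: z.
  apply: palg_ext => i j ij; rewrite ecoefZ ecoef_unit.
  have -> : ecoef (palg_op ((T : palg R true) * z)) i j = ecoef (palg_op T) i 0 * (j == 0%N)%:R.
    transitivity (ecoord (palg_op T (hdot _ (be R j) (be R 0) *: be R 0)) i) => //.
    by rewrite bopZ ecoordZ -ecoordE ecoord_be mulrC eq_sym.
  case: (j =P 0%N) ij => [->|_] ij; last by rewrite andbF !mulr0.
  have -> : i = 0%N by move: ij; rewrite /chain2 orbF => /eqP.
  by rewrite eqxx.
split; exists (ecoef (palg_op T) 0 0).
  by rewrite -(repM rb) [X in beta X]hl; exact: linearZ.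
by rewrite -(repM rb) [X in beta X]hr; exact: linearZ.
Qed.

Lemma not_delta_equiv : ~ delta_equiv (palg_uda R false) (palg_uda R true).
Proof.
move=> [H [K [alpha [beta [ra rb [M [_ AE BE]]]]]]].
have algA : unital_wclosed_algebra (range alpha) by case: ra.
have algB : unital_wclosed_algebra (range beta) by case: rb.
pose z := beta (pdiag R true 0).
have Bz : range beta z by exists (pdiag R true 0).
have zz : bcomp z z = z by rewrite /z -(repM rb) pdiagM.
have zadj : is_adjoint z z by exact: rep_pdiag_adjoint.
have z0 : z != 0 by apply: contra_neq (punit_neq0 R (chain2_refl true 0)); exact: rep_eq0.
have zl t : range beta t -> exists c, bcomp z t = c *: z by case/(rep_pdiag0_mul rb).
have zr t : range beta t -> exists c, bcomp t z = c *: z by case/(rep_pdiag0_mul rb).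
have [m [Mm zm0]] := TRO_z_meets BE Bz zz zadj z0.
have [m' mm'] := adjoint_exists m.
have proj n n' := @TRO_projection R H K _ _ M algA AE BE z Bz zz zadj zl n n'.
have [e [[Ae ee eadj e0] [ze [c ec] emin]]] := proj m m' Mm mm' zm0.
have [k ek] := rep_projection ra Ae ee eadj e0 emin.
(* A nonzero [m' z n] is fixed by [e] from the left and by the projection [f] of [n] from the right,
   which puts [k] below [l]. Its adjoint [n' z m] gives the opposite relation, hence [f = e]. *)
have blk n : M n -> bcomp (bcomp m' (bcomp z n)) e = bcomp m' (bcomp z n).
  move=> Mn; have [n' nn'] := adjoint_exists n.
  have [->|s0] := eqVneq (bcomp m' (bcomp z n)) 0; first by rewrite bcomp0l.
  have zn0 : bcomp z n != 0 by apply: contra_neq s0 => ->; rewrite bcomp0r.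
  have [f [[Af ff fadj f0] [zf [d fd] fmin]]] := proj n n' Mn nn' zn0.
  have [l fl] := rep_projection ra Af ff fadj f0 fmin.
  have sadj := is_adjoint_comp (is_adjoint_sym mm') (is_adjoint_comp zadj nn').
  have sf : bcomp (bcomp m' (bcomp z n)) f = bcomp m' (bcomp z n).
    by rewrite -bcompA zf.
  have s'e : bcomp (bcomp n' (bcomp z m)) e = bcomp n' (bcomp z m).
    by rewrite -bcompA ze.
  have sadj' : is_adjoint (bcomp m' (bcomp z n)) (bcomp n' (bcomp z m)).
    by move: sadj; rewrite -bcompA.
  have es : bcomp e (bcomp m' (bcomp z n)) = bcomp m' (bcomp z n).
    have h := is_adjoint_comp (is_adjoint_sym sadj') eadj; rewrite s'e in h.
    exact: adjoint_unique h (is_adjoint_sym sadj').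
  have fs' : bcomp f (bcomp n' (bcomp z m)) = bcomp n' (bcomp z m).
    have h := is_adjoint_comp sadj' fadj; rewrite sf in h.
    exact: adjoint_unique h sadj'.
  have kl : chain2 false k l.
    apply: (rep_corner_chain ra (TRO_adj_mul AE Mm Mn mm' Bz) s0); rewrite -?ek -?fl //.
  have lk : chain2 false l k.
    apply: (rep_corner_chain ra (TRO_adj_mul AE Mn Mm nn' Bz)); rewrite -?ek -?fl //.
    by rewrite -(is_adjoint_eq0 sadj').
  by rewrite ek (chain2_antisym kl lk) -fl.
have corner t := @TRO_corner R H K _ _ M algA algB AE BE z zadj zl zr m m' e Mm mm' eadj (ex_intro _ c ec) blk t.
(* For [b = false] no index is isolated: an even [k] lies below [k.+1], an odd one above its
   predecessor. *)
have [j [kj|jk] jk0] : exists2 j, chain2 false k j \/ chain2 false j k & k != j.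
  case ok : (odd k); last by exists k.+1; [left; rewrite chain2S ok|rewrite neq_ltn ltnSn].
  case: k ok {ek} => // k ok; exists k; last by rewrite neq_ltn ltnSn orbT.
  by right; rewrite chain2S; move: ok => /= /negbTE ->.
(* Multiplication by [E_kk] fixes the strict unit on one side and kills it on the other, whereas
   [corner] equates the results. *)
- have [h _] := corner (alpha (punit R kj)) (ex_intro2 _ _ (punit R kj) I erefl).
  rewrite ek -!(repM ra) pdiagMl in h.
  by have /eqP := etrans (esym (rep_inj ra h)) (punit_pdiag0 R kj jk0); rewrite (negPf (punit_neq0 _ _)).
- have [_ h] := corner (alpha (punit R jk)) (ex_intro2 _ _ (punit R jk) I erefl).
  rewrite ek -!(repM ra) pdiagMr in h; rewrite eq_sym in jk0.
  by have /eqP := etrans (esym (rep_inj ra h)) (pdiag_punit0 R jk jk0); rewrite (negPf (punit_neq0 _ _)).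
Qed.

(** The isolated index 0 goes to 0, whose partner 1 is left out of the image. The remaining indices
    are shifted by one, which reverses parity and so matches the chains. *)
Lemma delta_sub_true_false : delta_sub (palg_uda R true) (palg_uda R false).
Proof.
apply: (@delta_sub_of_embedding R false true (fun i => if i == 0%N then 0%N else i.+1)
  (fun i => if i is i'.+1 then (if i' == 0%N then None else Some i') else Some 0%N)).
- by case.
- by case=> [j [<-] //|[//|i] j [<-]].
- case=> [|i] [|j] //=; rewrite /chain2 /= ?eqSS.
  + by rewrite andbF.
  + by rewrite !eqb_id eqbF_neg negbK.
Qed.

(** The shift reverses parity, and its image omits exactly the isolated index 0. *)
Lemma delta_sub_false_true : delta_sub (palg_uda R false) (palg_uda R true).
Proof.
apply: (@delta_sub_of_embedding R true false succn (fun i => if i is i'.+1 then Some i' else None)).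
- by [].
- by case=> // i j [->].
- by move=> i j; rewrite /chain2 !eqSS /= eqb_id eqbF_neg.
Qed.

End NonEquivalence.

Theorem mainTheorem4 (R : realType) :
  exists A B : unital_dual_algebra R,
    [/\ ~ uda_selfadjoint A /\ ~ uda_selfadjoint B,
        delta_sub A B, delta_sub B A & ~ delta_equiv A B].
Proof.
exists (palg_uda R false), (palg_uda R true); split.
- by split=> -[L [alpha [ra]]]; exact: rep_not_selfadjoint ra.
- exact: delta_sub_false_true.
- exact: delta_sub_true_false.
- exact: not_delta_equiv.
Qed.
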